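(* Assume $\hat\Phi_{,1}(1,1,\dots,1)=0$. Let $\lambda>0$ and, for $\varepsilon\in(0,1)$, let $r_\varepsilon$ be the unique global minimizer of $\hat I_\varepsilon$ over $\mathcal{A}_\lambda^\varepsilon$. Let $\lambda_c$ be the critical boundary displacement. Then: 1. if $\lambda\le\lambda_c$, then $$\lim_{\varepsilon\to0}\ \sup_{R\in[\varepsilon,1]}|r_\varepsilon(R)-\lambda R|=0;$$ 2. if $\lambda>\lambda_c$, then $$\lim_{\varepsilon\to0}\ \sup_{R\in[\varepsilon,1]}|r_\varepsilon(R)-r_\lambda(R)|=0,$$ where $r_\lambda$ is the cavitating minimizer (i.e. with $r_\lambda(0)>0$) of $\hat I$ over $\mathcal{A}_\lambda$.
   Context: $n\in\{2,3\}$ and $\kappa>0$. The function $h:(0,\infty)\to[0,\infty)$ is $C^1$ (with second derivative existing) and satisfies: $h''(d)>0$ for all $d>0$; $\lim_{d\to0^+}h(d)=\infty$; $\lim_{d\to\infty}h(d)/d=\infty$; $\lim_{d\to0^+}h'(d)=-\infty$; $\lim_{d\to\infty}h'(d)=\infty$. Modified stored energy: $$\hat\Phi(v_1,\dots,v_n)=\frac{\kappa}{n}v_1^n+h(v_1\cdots v_n)+\kappa v_1\cdots v_n\left(\frac{n-1}{n}+\ln(v_2\cdots v_n)\right).$$ $\hat\Phi_{,i}$ is the partial derivative with respect to the $i$-th argument and $\hat\Phi_{,i}(r(R))=\hat\Phi_{,i}\left(r'(R),\frac{r(R)}{R},\dots,\frac{r(R)}{R}\right)$. For $\varepsilon\in[0,1)$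 put $$\hat I_\varepsilon(r)=\int_\varepsilon^1R^{n-1}\hat\Phi\left(r'(R),\frac{r(R)}{R},\dots,\frac{r(R)}{R}\right)dR-\frac{\kappa(n-1)}{n}\lambda^n\ln\lambda,$$ $$\mathcal{A}_\lambda^\varepsilon=\{r\in W^{1,1}(\varepsilon,1): r(1)=\lambda,\ r'(R)>0\text{ for a.e. }R\in(\varepsilon,1),\ r(\varepsilon)\ge0\},$$ and write $\hat I=\hat I_0$, $\mathcal{A}_\lambda=\mathcal{A}_\lambda^0$. For each $\varepsilon\in(0,1)$ the functional $\hat I_\varepsilon$ has a unique global minimizer over $\mathcal{A}^\varepsilon_\lambda$ (an existence and uniqueness statement established separately). The critical boundary displacement $\lambda_c$ is defined as follows. The modified radial Cauchy stress is $\hat T(r(R))=\left[\frac{r(R)}{R}\right]^{1-n}\hat\Phi_{,1}(r(R))$. Let $r_c$ be a cavitating solution (i.e. with $r_c(0)>0$, $r_c'>0$) of $\frac{d}{dR}\left[R^{n-1}\hat\Phi_{,1}(r(R))\right]=(n-1)R^{n-2}\hat\Phi_{,2}(r(R))$ with $\lim_{R\to0^+}\hat T(r_c(R))=0$, extended as a solution to $(0,\infty)$; it is unique up to the rescalings $r_c(\alpha R)/\alpha$, and $\lambda_c:=\lim_{R\to\infty}r_c(R)/R=\lim_{R\to\infty}r_c'(R)>1$, which does not depend on the choice of $r_c$. *)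

(* Defs.v *)
From HB Require Import structures.
From mathcomp Require Import all_boot all_order all_algebra.
From mathcomp Require Import all_classical all_reals all_analysis.

Set Implicit Arguments.
Unset Strict Implicit.
Unset Printing Implicit Defensive.

Import Order.TTheory GRing.Theory Num.Theory.
Import numFieldNormedType.Exports.

Local Open Scope ring_scope.
Local Open Scope classical_set_scope.

Section Sobolev.
Context {R : realType}.
Implicit Types (a b : R) (r g phi : R -> R).

(* The space C^1_c(]a, b[); it determines the same weak derivatives as
   C^oo_c(]a, b[). *)
Definition test_function a b phi : Prop :=
  [/\ forall x, derivable phi x 1,
      continuous (derive1 phi) &
      exists K : set R, [/\ compact K, K `<=` `]a, b[%classic &
                            forall x, ~ K x -> phi x = 0]].

Definition is_weak_derivative a b r g : Prop :=
  (@lebesgue_measure R).-integrable `]a, b[%classic (EFin \o g) /\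
  forall phi, test_function a b phi ->
    \int[@lebesgue_measure R]_(x in `]a, b[%classic) (r x * derive1 phi x) =
    - \int[@lebesgue_measure R]_(x in `]a, b[%classic) (g x * phi x).

(* An element of W^{1,1}(a,b) is represented by its continuous representative
   on [a, b], so that its boundary values make sense; the values of r outside
   [a, b] are irrelevant. *)
Definition W11 a b r : Prop :=
  [/\ {within `[a, b]%classic, continuous r},
      (@lebesgue_measure R).-integrable `]a, b[%classic (EFin \o r) &
      exists g, is_weak_derivative a b r g].

(* A choice of weak derivative (unique up to a.e. equality). *)
Definition weakD a b r : R -> R :=
  xget (fun=> 0) [set g | is_weak_derivative a b r g].

End Sobolev.

Section Elasticity.
Context {R : realType}.
Implicit Types (kappa lambda eps : R) (h r : R -> R) (n : nat).

Definition volumetric_energy h : Prop :=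
  [/\ forall d : R, 0 < d -> 0 <= h d,
      forall d : R, 0 < d ->
        [/\ derivable h d 1, derivable (derive1 h) d 1 &
            0 < derive1 (derive1 h) d],
      h d @[d --> 0^'+] --> +oo /\ h d / d @[d --> +oo] --> +oo,
      derive1 h d @[d --> 0^'+] --> -oo &
      derive1 h d @[d --> +oo] --> +oo].

(* The n principal stretches (v_1, ..., v_n), for n > 0, are the entries of a
   row vector; v_1 is the entry of index 0. *)
Definition Phihat n kappa h (v : 'rV[R]_n.-1.+1) : R :=
  kappa / n%:R * v 0 0 ^+ n + h (\prod_i v 0 i) +
  kappa * (\prod_i v 0 i) *
    ((n%:R - 1) / n%:R + ln (\prod_(i | i != 0) v 0 i)).

Definition partial m (F : 'rV[R]_m.+1 -> R) (i : 'I_m.+1)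
    (v : 'rV[R]_m.+1) : R :=
  'D_(delta_mx 0 i) F v.

Definition radial_stretches n (p q : R) : 'rV[R]_n.-1.+1 :=
  \row_i (if i == 0 then p else q).

(* Partial derivatives with respect to the first and second arguments, along a
   differentiable radial map. *)
Definition Phihat1 n kappa h r (x : R) : R :=
  partial (Phihat (n := n) kappa h) 0
    (radial_stretches n (derive1 r x) (r x / x)).

Definition Phihat2 n kappa h r (x : R) : R :=
  partial (Phihat (n := n) kappa h) (inord 1)
    (radial_stretches n (derive1 r x) (r x / x)).

Definition Ihat n kappa h lambda eps r : \bar R :=
  (\int[@lebesgue_measure R]_(x in `]eps, 1%R[%classic)
      (x ^+ n.-1 *
       Phihat kappa h (radial_stretches n (weakD eps 1 r x) (r x / x)))%:E
   - (kappa * (n%:R - 1) / n%:R * lambda ^+ n * ln lambda)%:E)%E.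

Definition admissible lambda eps r : Prop :=
  [/\ W11 eps 1 r, r 1 = lambda,
      {ae @lebesgue_measure R,
        forall x, `]eps, 1[%classic x -> 0 < weakD eps 1 r x} &
      0 <= r eps].

Definition global_minimizer n kappa h lambda eps r : Prop :=
  admissible lambda eps r /\
  forall s, admissible lambda eps s ->
    (Ihat n kappa h lambda eps r <= Ihat n kappa h lambda eps s)%E.

Definition unique_global_minimizer n kappa h lambda eps r : Prop :=
  global_minimizer n kappa h lambda eps r /\
  forall s, global_minimizer n kappa h lambda eps s ->
    forall x : R, `[eps, 1]%classic x -> s x = r x.

Definition cavitating_minimizer n kappa h lambda r : Prop :=
  global_minimizer n kappa h lambda 0 r /\ 0 < r 0.

Definition That n kappa h r (x : R) : R :=
  (r x / x) ^- n.-1 * Phihat1 n kappa h r x.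

(* Solution on ]0, +oo[ of the radial equilibrium equation, with r(0+) > 0 and
   zero Cauchy stress on the cavity surface. *)
Definition cavitating_solution n kappa h r : Prop :=
  [/\ 0 < r 0 /\ r x @[x --> 0^'+] --> r 0,
      forall x : R, 0 < x -> derivable r x 1 /\ 0 < derive1 r x,
      forall x : R, 0 < x ->
        is_derive x 1 (fun y => y ^+ n.-1 * Phihat1 n kappa h r y)
          ((n%:R - 1) * x ^+ n.-2 * Phihat2 n kappa h r x) &
      That n kappa h r x @[x --> 0^'+] --> (0 : R)].

Definition critical_displacement n kappa h (lambda_c : R) : Prop :=
  exists2 r_c : R -> R, cavitating_solution n kappa h r_c &
    r_c x / x @[x --> +oo] --> lambda_c.

Definition sup_dist eps r (s : R -> R) : \bar R :=
  ereal_sup [set (`|r x - s x|)%:E | x in `[eps, 1]%classic].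

End Elasticity.

(* Main.v *)
Require Import Defs.
From mathcomp Require Import all_boot all_order all_algebra.
From mathcomp Require Import all_classical all_reals all_analysis.
From mathcomp Require Import measurable_realfun ring lra.

(** The energy density of a radial map is [R^(n-1) Psi d U], where [U = (r/R)^n] and [d] is the
    determinant of the deformation gradient, so the problem is invariant under rescaling. A field
    of extremals in the [U] line is made of the homogeneous maps for [U <= lambda_c^n] and of the
    rescalings of the cavitating solution for [U > lambda_c^n]. Its slope function [D U] and value
    function [W] satisfy [Psi d U >= W U + W' U (d - U) + B d (D U)], where [B] is the Bregman
    distance of [h], and [R^(n-1) (W U + W' U (d - U))] is the derivative of [R^n W U / n] along
    every map. Hence a map whose energy is close to the value of the target has a small integral
    of [B d (D U)], i.e. almost solves the ODE [d = D U] solved by the target, and Gronwall's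
    inequality makes it uniformly close to the target. The cut-off radius [eps] only contributes
    the boundary term [eps^n W(U(eps))], which is negligible because [W] is sublinear. *)

Import Order.TTheory GRing.Theory Num.Theory.
Import numFieldNormedType.Exports.

Local Open Scope ring_scope.
Local Open Scope classical_set_scope.

Set Implicit Arguments.
Unset Strict Implicit.
Unset Printing Implicit Defensive.

(** * Absolutely continuous functions *)

(** Two different minimizations make the field calibrating. For fixed [d], [Psi d U] is least at
    [U = d], with value [homE d], so on the homogeneous branch convexity of [homE] suffices; on the
    cavitating branch convexity of [Psi] in [d] is used. The branches join in a C^1 way at
    [lambda_c^n] because the stress along the cavitating solution tends there to [homT]. As the
    slope of [homE] is singular at 0, [W] is continued by a tangent line below a value [U0]:
    equality is needed only where the target lives, at [lambda^n] for the homogeneous target and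
    beyond [lambda_c^n] for the cavitating one. Sublinearity of [W] expresses the zero traction on
    the cavity, which makes [W'] vanish at infinity. A cavitating solution is only known to have
    differentiable [r] and differentiable flux, so the phase plane is described by [U] and the
    stress, and facts about the stretch ratio are deduced from monotonicity of the stress law. The
    final estimate holds for all small [eps >= 0]; its case [eps = 0] gives the uniqueness of the
    cavitating minimizer. *)

Section IntervalIntegrals.
Context {R : realType}.
Notation mu := (@lebesgue_measure R).
Implicit Types (a b x y z : R) (f g F G M w : R -> R).

Definition seg a b f : R := \int[mu]_(t in `[a, b]) f t.
Definition segint a b f : Prop := mu.-integrable `[a, b] (EFin \o f).

Lemma segintS a b x y f : a <= x -> y <= b -> segint a b f -> segint x y f.
Proof.
move=> ax yb; apply: integrableS => //; apply: subset_itv; by rewrite bnd_simp.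
Qed.

Lemma seg_xx x f : seg x x f = 0.
Proof. by rewrite /seg set_itv1 Rintegral_set1. Qed.

Lemma seg_add x y z f : segint x z f -> x <= y -> y <= z ->
  seg x z f = seg x y f + seg y z f.
Proof.
move=> fi xy yz; rewrite /seg -(@Rintegral_itv_obnd_cbnd _ y); last first.
  apply: integrableS fi => //; apply: subset_itv; by rewrite bnd_simp.
rewrite -(@Rintegral_itvB _ f (BLeft x) (BRight z) y) ?bnd_simp//.
by rewrite subrKC.
Qed.

Lemma seg_le a b f g : segint a b f -> segint a b g ->
  (forall x, a <= x -> x <= b -> f x <= g x) -> seg a b f <= seg a b g.
Proof.
move=> fi gi fg; apply: le_Rintegral => // x /=.
by rewrite in_itv/= => /andP[]; exact: fg.
Qed.

Lemma seg_eq a b f g : (forall x, a <= x -> x <= b -> f x = g x) ->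
  seg a b f = seg a b g.
Proof.
move=> fg; apply: eq_Rintegral => x /[!inE]/=.
by rewrite in_itv/= => /andP[]; exact: fg.
Qed.

Lemma segint_eq a b f g : (forall x, a <= x -> x <= b -> f x = g x) ->
  segint a b f -> segint a b g.
Proof.
move=> fg; apply: eq_integrable => // x /[!inE]/=.
by rewrite in_itv/= => /andP[ax xb]; rewrite fg.
Qed.

Lemma seg_ge0 a b f : (forall x, a <= x -> x <= b -> 0 <= f x) ->
  0 <= seg a b f.
Proof.
by move=> f0; apply: Rintegral_ge0 => x /=; rewrite in_itv/= => /andP[]; exact: f0.
Qed.

Lemma segD a b f g : segint a b f -> segint a b g ->
  seg a b (fun x => f x + g x) = seg a b f + seg a b g.
Proof. by move=> fi gi; rewrite /seg RintegralD. Qed.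

Lemma segB a b f g : segint a b f -> segint a b g ->
  seg a b (fun x => f x - g x) = seg a b f - seg a b g.
Proof. by move=> fi gi; rewrite /seg RintegralB. Qed.

Lemma segZ a b f k : segint a b f ->
  seg a b (fun x => k * f x) = k * seg a b f.
Proof. by move=> fi; rewrite /seg RintegralZl. Qed.

Lemma seg_norm a b f : segint a b f -> `|seg a b f| <= seg a b (fun x => `|f x|).
Proof. by move=> fi; exact: le_normr_Rintegral. Qed.

Lemma seg_cst a b k : a <= b -> seg a b (fun=> k) = k * (b - a).
Proof.
move=> ab; rewrite /seg Rintegral_cst//= lebesgue_measure_itv/= lte_fin.
by move: ab; rewrite le_eqVlt => /predU1P[->|->//]; rewrite ltxx subrr.
Qed.

Lemma segintD a b f g : segint a b f -> segint a b g ->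
  segint a b (fun x => f x + g x).
Proof. by move=> fi gi; apply: (eq_integrable _ _ _ _ (integrableD _ fi gi)). Qed.

Lemma segintB a b f g : segint a b f -> segint a b g ->
  segint a b (fun x => f x - g x).
Proof. by move=> fi gi; apply: (eq_integrable _ _ _ _ (integrableB _ fi gi)). Qed.

Lemma segintZ a b f k : segint a b f -> segint a b (fun x => k * f x).
Proof. by move=> fi; apply: (eq_integrable _ _ _ _ (integrableZl _ k fi)). Qed.

Lemma segint_norm a b f : segint a b f -> segint a b (fun x => `|f x|).
Proof. by move=> fi; exact: integrable_norm. Qed.

Lemma segint_cont a b f : {within `[a, b], continuous f} -> segint a b f.
Proof.
by move=> cf; apply: continuous_compact_integrable => //; exact: segment_compact.
Qed.

Lemma segint_cst a b k : segint a b (fun=> k).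
Proof. by apply: segint_cont; apply: continuous_subspaceT => x; exact: cvg_cst. Qed.

Lemma segintM a b f g : {within `[a, b], continuous f} -> segint a b g ->
  segint a b (fun x => f x * g x).
Proof.
move=> cf gi.
have mf : measurable_fun `[a, b] f by exact: measurable_realfun.subspace_continuous_measurable_fun.
suff fb : [bounded f x | x in `[a, b]].
  have H := @integrableMr _ _ _ mu _ (measurable_itv _) _ _ mf fb gi.
  exact: H.
have /compact_bounded[M [_ mrt]] := continuous_compact cf (@segment_compact _ a b).
by exists M; split; rewrite ?num_real // => ? ? ? ?; exact: mrt.
Qed.

(** Heine-Cantor, from the near-covering form of compactness with the modulus [d] as the parameter
    near [0^'+]; half of the local radius is kept in reserve for the triangle inequality. *)
Lemma itv_unif_cont f a b : {within `[a, b], continuous f} ->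
  forall e : R, 0 < e -> exists2 d : R, 0 < d & forall x y, a <= x <= b ->
    a <= y <= b -> `|x - y| < d -> `|f x - f y| < e.
Proof.
move=> /subspace_continuousP cf e e0.
have := @segment_compact R a b; rewrite compact_near_coveringP.
move=> /(_ R (0^'+) (fun d x => a <= x <= b -> forall y, a <= y <= b ->
   `|x - y| < d -> `|f x - f y| < e)) H.
have : \forall d \near (0:R)^'+, `[a, b] `<=` (fun x => a <= x <= b -> forall y,
    a <= y <= b -> `|x - y| < d -> `|f x - f y| < e).
  apply: H => x xab.
  have /cvgrPdist_lt/(_ (e / 2)) := cf x xab.
  rewrite divr_gt0// => /(_ isT) [r /= r0 Hr].
  exists (ball x (r / 2), [set d | 0 < d < r / 2]) => /=.
    split; first by apply: nbhsx_ballx; rewrite divr_gt0.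
    exists (r / 2) => /=; first by rewrite divr_gt0.
    move=> d /=; rewrite sub0r normrN => dr d0; rewrite d0.
    by apply: le_lt_trans dr; exact: ler_norm.
  move=> [x' d] /= [xx' /andP[d0 dr]] x'ab y yab x'y.
  have h1 : `|f x - f x'| < e / 2.
    apply: Hr => /=; last by rewrite in_itv.
    by apply: lt_trans xx' _; rewrite ltr_pdivrMr// ltr_pMr// ltr1n.
  have h2 : `|f x - f y| < e / 2.
    apply: Hr => /=; last by rewrite in_itv.
    rewrite /ball_/= in xx' *.
    have := ler_normD (x - x') (x' - y); rewrite subrKA => /le_lt_trans; apply.
    rewrite [r]splitr; apply: ltrD => //; exact: lt_trans dr.
  rewrite distrC in h1.
  have := ler_normD (f x' - f x) (f x - f y); rewrite subrKA => /le_lt_trans; apply.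
  by rewrite [e]splitr; exact: ltrD.
move=> [r /= r0 Hr]; exists (r / 2); first by rewrite divr_gt0.
move=> x y xab yab xy; apply: (Hr (r / 2)) => //=.
- by rewrite sub0r normrN gtr0_norm ?divr_gt0// ltr_pdivrMr// ltr_pMr// ltr1n.
- by rewrite divr_gt0.
Qed.

(** Both sides are additive over a uniform partition, and the local errors add up to at most [e]
    times the integral of [M]. This gives the fundamental theorem of calculus for [F] without
    differentiating it almost everywhere. *)
Lemma increments_integral a b F G M : a <= b -> segint a b G -> segint a b M ->
  (forall e : R, 0 < e -> exists2 d : R, 0 < d &
     forall x y, a <= x -> x <= y -> y <= b ->
     y - x < d -> `|F y - F x - seg x y G| <= e * seg x y M) ->
  F b - F a = seg a b G.
Proof.
move=> ab Gi Mi H; apply/eqP; rewrite -subr_eq0 -normr_le0; apply/ler_addgt0Pr => e e0.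
rewrite add0r.
set K := seg a b M.
(* The tolerance is divided by the total mass of [M], plus 1 to keep the divisor positive, so that
   the accumulated error is at most [e]. *)
have [d d0 Hd] := H (e / (`|K| + 1)) (divr_gt0 e0 (ltr_wpDl (normr_ge0 _) ltr01)).
have [N HN] : exists N : nat, (b - a) < d * N.+1%:R.
  exists (Num.truncn ((b - a) / d)); rewrite -ltr_pdivrMl// mulrC.
  by apply: truncnS_gt.
pose p (k : nat) := a + (b - a) * (k%:R / N.+1%:R).
have pS k : p k.+1 - p k = (b - a) / N.+1%:R.
  have : N.+1%:R != 0 :> R by rewrite pnatr_eq0.
  by rewrite /p -[k.+1%:R]natr1; move: (N.+1%:R : R) => D D0; field.
have step : p 0%N = a by rewrite /p mul0r mulr0 addr0.
have pe : p N.+1 = b by rewrite /p divff ?pnatr_eq0// mulr1 subrKC.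
have ppos : 0 <= (b - a) / N.+1%:R by rewrite divr_ge0// subr_ge0.
have pmon k : p k <= p k.+1 by rewrite -subr_ge0 pS.
have pa k : a <= p k.
  by elim: k => [|k IH]; [rewrite step|exact: le_trans IH (pmon k)].
have pb k : (k <= N.+1)%N -> p k <= b.
  move=> kN; rewrite -pe /p lerD2l ler_wpM2l ?subr_ge0//.
  by rewrite ler_pM2r ?invr_gt0// ler_nat.
have ind k : (k <= N.+1)%N -> `|F (p k) - F a - seg a (p k) G|
    <= e / (`|K| + 1) * seg a (p k) M.
  elim: k => [_|k IH kN].
    by rewrite step !seg_xx subrr subr0 normr0 mulr0.
  have {}IH := IH (ltnW kN).
  have sub h : segint a b h -> segint a (p k.+1) h by apply: segintS => //; exact: pb.
  rewrite (seg_add (sub G Gi) (pa k) (pmon k)) (seg_add (sub M Mi) (pa k) (pmon k)).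
  rewrite [X in `|X|](_ : _ = (F (p k) - F a - seg a (p k) G) +
    (F (p k.+1) - F (p k) - seg (p k) (p k.+1) G)); last by ring.
  rewrite mulrDr; apply: le_trans (ler_normD _ _) _; apply: lerD => //.
  apply: Hd => //; first exact: pb.
  by rewrite pS ltr_pdivrMr// mulrC.
have := ind N.+1 (leqnn _); rewrite pe => /le_trans; apply.
rewrite -/K mulrAC ler_pdivrMr ?ltr_wpDl// ler_wpM2l//; first exact: ltW.
by apply: le_trans (ler_norm _) _; rewrite lerDl.
Qed.

(** Absolute continuity in integral form, with the density as an argument: the same predicate serves
    for weak derivatives and for classical ones, and the density may be changed on a null set. *)
Definition ac a b f g : Prop := segint a b g /\
  forall x y, a <= x -> x <= y -> y <= b -> f y - f x = seg x y g.

Lemma ac_sub a b c d f g : a <= c -> d <= b -> ac a b f g -> ac c d f g.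
Proof.
move=> ac_ db [gi H]; split; first exact: segintS gi.
move=> x y cx xy yd; apply: H => //; [exact: le_trans cx|exact: le_trans db].
Qed.

Lemma ac_cont a b f g : a <= b -> ac a b f g -> {within `[a, b], continuous f}.
Proof.
move=> ab [gi H].
apply: (@subspace_eq_continuous _ _ _ (fun x => f a + seg a x g)).
  move=> x /[!inE]/=; rewrite in_itv/= => /andP[ax xb].
  by rewrite -H// subrKC.
move=> x; apply: cvgD; first exact: cvg_cst.
exact: parameterized_integral_continuous.
Qed.

Lemma ac_eq a b f f' g g' : (forall x, a <= x -> x <= b -> f x = f' x) ->
  (forall x, a <= x -> x <= b -> g x = g' x) -> ac a b f g -> ac a b f' g'.
Proof.
move=> ff gg [gi H]; split; first exact: segint_eq gi.
move=> x y ax xy yb; rewrite -!ff ?H//; try lra.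
apply: seg_eq => z xz zy; apply: gg; lra.
Qed.

Lemma acD a b f f' g g' : ac a b f g -> ac a b f' g' ->
  ac a b (fun x => f x + f' x) (fun x => g x + g' x).
Proof.
move=> [gi H] [gi' H']; split; first exact: segintD.
move=> x y ax xy yb; rewrite segD -?H -?H'//; first by ring.
  exact: segintS gi.
exact: segintS gi'.
Qed.

Lemma acZ a b f g k : ac a b f g -> ac a b (fun x => k * f x) (fun x => k * g x).
Proof.
move=> [gi H]; split; first exact: segintZ.
move=> x y ax xy yb; rewrite segZ -?H -?mulrBr//; exact: segintS gi.
Qed.

Lemma is_derive_cont w (x dw : R) : is_derive x 1 w dw -> {for x, continuous w}.
Proof. by move=> [dwx _]; apply/differentiable_continuous/derivable1_diffP. Qed.

Lemma is_derive_exprn n (u : R) :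
  is_derive u (1 : R) (fun u => u ^+ n) (n%:R * u ^+ n.-1).
Proof.
by split; [exact: exprn_derivable|rewrite exp_derive scaler1 -mulr_natl].
Qed.

Lemma within_comp (A : set R) f w : {within A, continuous f} -> continuous w ->
  {within A, continuous (fun x => w (f x))}.
Proof.
move=> /subspace_continuousP cf cw; apply/subspace_continuousP => x Ax.
apply: cvg_comp (cf x Ax) _; exact: cw.
Qed.

(** On a short interval the increment of [w \o f] is [w' (f t0)] times that of [f], and uniform
    continuity of [w' \o f] replaces [t0] by the running point at a cost proportional to the
    integral of the absolute density; [increments_integral] concludes. *)
Lemma ac_comp a b f g w w' : (forall u, is_derive u (1 : R) w (w' u)) ->
  continuous w' -> ac a b f g ->
  ac a b (fun x => w (f x)) (fun x => w' (f x) * g x).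
Proof.
move=> dw cw' acf.
have cont c d : a <= c -> c <= d -> d <= b -> {within `[c, d], continuous (w' \o f)}.
  move=> ac_ cd db; apply: within_comp => //.
  exact: (ac_cont cd (ac_sub ac_ db acf)).
have [gi H] := acf.
have gi' c d : a <= c -> c <= d -> d <= b -> segint c d (fun x => w' (f x) * g x).
  move=> ac_ cd db; apply: segintM; first exact: cont.
  exact: segintS gi.
split.
  have [ab|ab] := leP a b; first exact: gi'.
  rewrite /segint set_itv_ge ?bnd_simp -?ltNge//; exact: integrable_set0.
move=> c d ac_ cd db.
apply: (@increments_integral c d (w \o f) _ (fun x => `|g x|)) => //; first exact: gi'.
  by apply: segint_norm; exact: segintS gi.
move=> e e0.
have [r r0 Hr] := itv_unif_cont (cont c d ac_ cd db) e0.
exists r => // x y cx xy yd yx.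
have acxy : ac x y f g by apply: ac_sub acf; lra.
have ax : a <= x by lra.
have yb : y <= b by lra.
(* The mean value point lies between [f x] and [f y], hence is a value of [f] by the intermediate
   value theorem; both orders of [f x] and [f y] occur. *)
have [t0 txy E] : exists2 t0, x <= t0 <= y &
    w (f y) - w (f x) = w' (f t0) * (f y - f x).
  have cw c' d' : {within `[c', d'], continuous w}.
    apply: continuous_subspaceT => u; exact: is_derive_cont (dw u).
  have [fxy|fyx] := leP (f x) (f y).
    have [xi /[!in_itv]/= xii E] := MVT_segment fxy (fun u _ => dw u) (cw _ _).
    have [|t0] := @IVT _ f x y xi xy (ac_cont xy acxy).
      by rewrite min_l// max_r.
    by rewrite in_itv/= => ? tE; exists t0 => //; rewrite tE.
  have [xi /[!in_itv]/= xii E] := MVT_segment (ltW fyx) (fun u _ => dw u) (cw _ _).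
  have [|t0] := @IVT _ f x y xi xy (ac_cont xy acxy).
    by rewrite min_r ?max_l//; exact: ltW.
  rewrite in_itv/= => ? tE; exists t0 => //; rewrite tE.
  by apply: oppr_inj; rewrite opprB E; ring.
have gxy : segint x y g by apply: segintS gi.
rewrite /= E H// -segZ// -segB//; [|exact: segintZ|exact: gi'].
apply: le_trans (seg_norm _) _.
  apply: segintB; [exact: segintZ|exact: gi'].
rewrite -segZ; last exact: segint_norm.
apply: seg_le.
- apply: segint_norm; apply: segintB; [exact: segintZ|exact: gi'].
- by apply: segintZ; exact: segint_norm.
move=> t xt ty; rewrite -mulrBl normrM ler_wpM2r//.
apply/ltW/Hr; rewrite ?ltr_norml; lra.
Qed.

(** By polarization, the product is half of the square of the sum minus the two squares, so the
    chain rule for [u ^+ 2] is enough. *)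
Lemma acM a b f f' g g' : ac a b f g -> ac a b f' g' ->
  ac a b (fun x => f x * f' x) (fun x => g x * f' x + f x * g' x).
Proof.
move=> h h'.
pose w u : R := u ^+ 2; pose w' u : R := 2 * u.
have dw u : is_derive u (1 : R) w (w' u).
  exact: is_derive_exprn.
have cw : continuous w'.
  by move=> u; apply: cvgM; [exact: cvg_cst|exact: cvg_id].
have sum := ac_comp dw cw (acD h h').
have s1 := acZ (-1) (ac_comp dw cw h).
have s2 := acZ (-1) (ac_comp dw cw h').
have := acZ (2^-1) (acD sum (acD s1 s2)).
by apply: ac_eq => x _ _; rewrite /w /w'; field.
Qed.

Lemma ac_C1 a b F f : (forall x, a < x < b -> is_derive x 1 F (f x)) ->
  {within `[a, b], continuous F} -> {within `[a, b], continuous f} -> ac a b F f.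
Proof.
move=> dF cF cf; split; first exact: segint_cont.
move=> x y ax; rewrite le_eqVlt => /predU1P[-> _|xy yb].
  by rewrite subrr seg_xx.
have sxy : `[x, y] `<=` `[a, b] by apply: subset_itv; rewrite bnd_simp.
rewrite /seg /Rintegral (continuous_FTC2 (F := F) xy)//.
- exact: continuous_subspaceW cf.
- have [_ c1 c2] := (continuous_within_itvP F xy).1 (continuous_subspaceW sxy cF).
  split => // z; rewrite in_itv/= => zxy.
  have [] // : is_derive z 1 F (f z) by apply: dF; lra.
- move=> z; rewrite in_itv/= => zxy.
  have [_ dz] : is_derive z 1 F (f z) by apply: dF; lra.
  by rewrite derive1E dz.
Qed.

End IntervalIntegrals.

(** * Integrals of functions that agree off a null set *)

Section NullSets.
Context d (T : measurableType d) {R : realType} (mu : {measure set T -> \bar R}).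
Local Open Scope ereal_scope.

Import HBNNSimple.

(** Only [g] is known to be measurable, as happens when [f] is built from an arbitrarily chosen weak
    derivative; hence the integrals are compared through the simple functions below each
    integrand. *)
Lemma ge0_integral_eq_off_null (D N : set T) (f g : T -> \bar R) :
  measurable D -> measurable N -> mu N = 0 -> measurable_fun D g ->
  (forall x, 0 <= f x) -> (forall x, 0 <= g x) ->
  (forall x, D x -> ~ N x -> f x = g x) ->
  \int[mu]_(x in D) f x = \int[mu]_(x in D) g x.
Proof.
move=> mD mN N0 mg f0 g0 fg; rewrite integral_mkcond [RHS]integral_mkcond.
have mgD : measurable_fun setT (g \_ D) by exact/(measurable_restrictT _ _).1.
have fD0 x : 0 <= (f \_ D) x by apply: erestrict_ge0.
have gD0 x : 0 <= (g \_ D) x by apply: erestrict_ge0.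
have E x : ~ N x -> (f \_ D) x = (g \_ D) x.
  by move=> Nx; rewrite !patchE; case: ifPn => // /set_mem Dx; rewrite fg.
apply/eqP; rewrite eq_le; apply/andP; split.
  rewrite [leLHS]ge0_integralTE//; apply: ge_ereal_sup => _ [h /= hf <-].
  rewrite -integralT_nnsfun.
  have mh : measurable_fun setT (EFin \o h) by exact/measurable_EFinP.
  rewrite (@ge0_negligible_integral _ _ _ mu setT N)//; last first.
    by move=> x _; rewrite lee_fin.
  rewrite [leRHS](@ge0_negligible_integral _ _ _ mu setT N)//.
  apply: ge0_le_integral => //.
  - exact: measurableD.
  - by move=> x _; rewrite lee_fin.
  - exact: measurable_funS mh.
  - exact: measurable_funS mgD.
  - by move=> x [_ Nx]; rewrite -E.
(* Cut to the complement of [N], [g] lies below [f] everywhere, since [f] is nonnegative on [N]; its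
   simple minorants are therefore minorants of [f]. *)
rewrite (@ge0_negligible_integral _ _ _ mu setT N)// integral_mkcond.
have G0 x : 0 <= ((g \_ D) \_ (setT `\` N)) x by apply: erestrict_ge0.
rewrite ge0_integralTE// ge0_integralTE//; apply: ereal_sup_le => _ [h /= hG <-].
exists h => // x; apply: le_trans (hG x) _; rewrite patchE.
by case: ifPn => // /set_mem[_ Nx]; rewrite E.
Qed.

Lemma integral_eq_off_null (D N : set T) (f g : T -> \bar R) :
  measurable D -> measurable N -> mu N = 0 -> measurable_fun D g ->
  (forall x, D x -> ~ N x -> f x = g x) ->
  \int[mu]_(x in D) f x = \int[mu]_(x in D) g x.
Proof.
move=> mD mN N0 mg fg; rewrite integralE [RHS]integralE; congr (_ - _).
  apply: (@ge0_integral_eq_off_null D N) => //; first exact: measurable_funepos.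
  by move=> x Dx Nx; rewrite !funeposE fg.
apply: (@ge0_integral_eq_off_null D N) => //; first exact: measurable_funeneg.
by move=> x Dx Nx; rewrite !funenegE fg.
Qed.

End NullSets.

(** * Weak derivatives and absolute continuity *)

Section WeakDerivatives.
Context {R : realType}.
Notation mu := (@lebesgue_measure R).
Implicit Types (a b x y z : R) (f g F G M w : R -> R).

Lemma is_derive_eps f x l :
  (forall e : R, 0 < e -> \forall z \near x, `|f z - f x - l * (z - x)| <= e * `|z - x|) ->
  is_derive x (1 : R) f l.
Proof.
move=> H; apply/is_derive1_caratheodory.
exists (fun z => if z == x then l else (f z - f x) / (z - x)); split; last first.
- by rewrite eqxx.
- apply/cvgrPdist_le => e e0; rewrite eqxx.
  apply: filterS (H e e0) => z; case: eqP => [->|/eqP zx].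
    by move=> _; rewrite subrr normr0 ltW.
  have zx0 : z - x != 0 by rewrite subr_eq0.
  move=> h; rewrite distrC -(ler_pM2r (_ : 0 < `|z - x|)) ?normr_gt0// -normrM.
  by rewrite mulrBl divfK.
- move=> z; case: eqP => [->|/eqP zx]; first by rewrite !subrr mulr0.
  by rewrite divfK// subr_eq0.
Qed.

Lemma is_derive_conv f x (l l' : R) :
  is_derive x (1 : R) f l -> l = l' -> is_derive x (1 : R) f l'.
Proof. by move=> ? <-. Qed.

Lemma segint_oo a b f : segint a b f <-> mu.-integrable `]a, b[ (EFin \o f).
Proof.
split=> [|/integrableP[mf fi]].
  apply: integrableS => //; exact: subset_itv_oo_cc.
have mf' : measurable_fun `[a, b] (EFin \o f).
  move/measurable_EFinP : mf => mf; apply/measurable_EFinP.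
  exact: measurable_fun_itv_cc mf.
apply/integrableP; split => //.
rewrite integral_itv_bndoo//; exact: measurableT_comp.
Qed.

Lemma seg_oo a b f : segint a b f -> \int[mu]_(x in `]a, b[) f x = seg a b f.
Proof.
move=> /segint_oo/integrableP[mf _].
by rewrite /seg /Rintegral [in RHS]integral_itv_bndoo.
Qed.

Lemma seg_le_oo a b f g : segint a b f -> segint a b g ->
  (forall x, a < x < b -> f x <= g x) -> seg a b f <= seg a b g.
Proof.
move=> fi gi fg; rewrite -!seg_oo//; apply: le_Rintegral => //.
- by move/segint_oo : fi.
- by move/segint_oo : gi.
Qed.

(** A truncated square: its derivative is continuous across the kink, which is exactly the
    regularity demanded of test functions. *)
Definition ramp2 (t : R) : R := (Num.max t 0) ^+ 2.

Lemma ramp2_bound (t z : R) : - (z - t) ^+ 2 <=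
  Num.max z 0 ^+ 2 - Num.max t 0 ^+ 2 - 2 * Num.max t 0 * (z - t) <= (z - t) ^+ 2.
Proof.
have [tl|tl] := leP t 0; have [zl|zl] := leP z 0; apply/andP; split; try nra;
  by have := sqr_ge0 (z - t); lra.
Qed.

Lemma is_derive_ramp2 t : is_derive t (1 : R) ramp2 (2 * Num.max t 0).
Proof.
apply: is_derive_eps => e e0.
have : \forall z \near t, `|t - z| < e by exact: nbhsx_ballx.
apply: filterS => z te.
apply: (@le_trans _ _ (`|z - t| * `|z - t|)); last first.
  by rewrite ler_wpM2r// distrC ltW.
rewrite -normrM [X in _ <= X]ger0_norm -?expr2 ?sqr_ge0// /ramp2 ler_norml.
exact: ramp2_bound.
Qed.

(* A C^1 quadratic spline rising from 0 to 1 over [[0, 1]]. *)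
Definition step (t : R) : R := 2 * (ramp2 t - 2 * ramp2 (t - 2^-1) + ramp2 (t - 1)).
Definition step' (t : R) : R :=
  4 * (Num.max t 0 - 2 * Num.max (t - 2^-1) 0 + Num.max (t - 1) 0).

Lemma is_derive_step t : is_derive t (1 : R) step (step' t).
Proof.
have sh c : is_derive t (1 : R) (fun t => ramp2 (t - c)) (2 * Num.max (t - c) 0).
  have := is_derive_ramp2 (t - c) => d1.
  have d2 : is_derive t (1 : R) (fun t => t - c) 1 by apply: is_derive_eq; rewrite subr0.
  by have := @is_derive1_comp _ ramp2 (fun t => t - c) _ _ _ d1 d2; rewrite mulr1.
have d0 := is_derive_ramp2 t.
have d1 := sh (2^-1); have d2 := sh 1.
rewrite /step; apply: is_derive_eq; rewrite /step' /GRing.scale/=; lra.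
Qed.

Lemma max0_continuous : continuous (fun t : R => Num.max t 0).
Proof. by move=> t; apply: (@continuous_max _ _ id (cst 0)); [exact: cvg_id|exact: cvg_cst]. Qed.

Lemma step'_continuous : continuous step'.
Proof.
move=> t; rewrite /step'; apply: cvgM; first exact: cvg_cst.
have sh c : (fun t => Num.max (t - c) 0) x @[x --> t] --> Num.max (t - c) 0.
  apply: (@cvg_comp _ _ _ (fun t => t - c) (fun t => Num.max t 0) _ (nbhs (t - c))).
    by apply: cvgB; [exact: cvg_id|exact: cvg_cst].
  exact: max0_continuous.
apply: cvgD; last exact: sh.
apply: cvgB; first exact: max0_continuous.
by apply: cvgM; [exact: cvg_cst|exact: sh].
Qed.

Lemma step_le0 t : t <= 0 -> step t = 0.
Proof. move=> t0; rewrite /step /ramp2 !max_r; lra. Qed.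

Lemma step_ge1 t : 1 <= t -> step t = 1.
Proof. by move=> t0; rewrite /step /ramp2 !max_l; lra. Qed.

Lemma step'_ge0 t : 0 <= step' t.
Proof.
rewrite /step'; have [h1|h1] := leP t 0; have [h2|h2] := leP (t - 2^-1) 0;
  have [h3|h3] := leP (t - 1) 0; lra.
Qed.

Lemma step'_out t : t <= 0 \/ 1 <= t -> step' t = 0.
Proof.
by case=> t0; rewrite /step'; have [h1|h1] := leP t 0; have [h2|h2] := leP (t - 2^-1) 0;
  have [h3|h3] := leP (t - 1) 0; lra.
Qed.

(** Du Bois-Reymond: [c], the difference between [r] and the primitive of [g], is orthogonal to
    derivatives of test functions. Testing with a difference of two steps shows that the averages of
    [c] just right of any two points agree, so [c] is constant. *)
Lemma weak_derivative_ac a b r g : a < b -> {within `[a, b], continuous r} ->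
  is_weak_derivative a b r g -> ac a b r g.
Proof.
move=> ab cr [/segint_oo gi wd].
have acG : ac a b (fun x => seg a x g) g.
  split => // x y ax xy yb.
  rewrite (@seg_add _ a x y) 1?addrC ?addKr//; exact: segintS gi.
have cG := ac_cont (ltW ab) acG.
pose c x := r x - seg a x g.
have cc : {within `[a, b], continuous c}.
  by move=> x; apply: cvgB; [exact: cr|exact: cG].
have test0 phi : test_function a b phi -> seg a b (fun x => derive1 phi x * c x) = 0.
  move=> tphi; have := wd _ tphi; have [dphi cphi [K [_ Kab phi0]]] := tphi.
  have cphi0 : continuous phi.
    by move=> x; apply/differentiable_continuous/derivable1_diffP.
  have acphi : ac a b phi (derive1 phi).
    apply: ac_C1; last 2 first; [exact: continuous_subspaceT..|].
    by move=> x _; rewrite derive1E; exact: derivableP.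
  have [pa pb] : phi a = 0 /\ phi b = 0.
    by split; apply: phi0 => /Kab/=; rewrite in_itv/= ltxx ?andbF.
  have [_ /(_ a b (lexx _) (ltW ab) (lexx _))] := acM acG acphi.
  have cphi' := @continuous_subspaceT _ _ `[a, b] _ cphi.
  have cphi0' := @continuous_subspaceT _ _ `[a, b] _ cphi0.
  have i1 : segint a b (fun x => g x * phi x).
    by apply: segint_eq (segintM cphi0' gi) => x _ _; rewrite mulrC.
  have i2 : segint a b (fun x => seg a x g * derive1 phi x).
    by apply: segintM => //; exact: segint_cont.
  have i3 : segint a b (fun x => r x * derive1 phi x).
    by apply: segintM => //; exact: segint_cont.
  rewrite pa pb !mulr0 subr0 !seg_oo// => E1 E2.
  rewrite (@seg_eq _ _ _ _ (fun x => r x * derive1 phi x - seg a x g * derive1 phi x)); last first.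
    by move=> x _ _; rewrite /c; ring.
  rewrite segB// E2; move: E1; rewrite segD//; lra.
have close e x y : 0 < e -> a < x -> x < y -> y < b -> `|c x - c y| <= e.
  move=> e0 ax xy yb.
  have e20 : 0 < e / 2 by rewrite divr_gt0.
  have [d d0 Hd] := itv_unif_cont cc e20.
  (* The width [s] is within the modulus of continuity of [c] and leaves [y + s] below [b], so that
     the support of the test function is compact in the open interval. *)
  pose s := Num.min d ((b - y) / 2).
  have s0 : 0 < s by rewrite lt_min d0/=; lra.
  have sd : s <= d by rewrite ge_min lexx.
  have sb : y + s < b.
    have : s <= (b - y) / 2 by rewrite ge_min lexx orbT.
    lra.
  (* [p z] climbs from 0 to 1 over [z] to [z + s]; its derivative [q z] is a bump of mass 1
     supported there. *)
  pose p z t := step ((t - z) / s); pose q z t := step' ((t - z) / s) / s.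
  have dp z t : is_derive t (1 : R) (p z) (q z t).
    have d1 : is_derive t (1 : R) (fun t => (t - z) / s) s^-1.
      by apply: is_derive_eq; rewrite /GRing.scale/=; ring.
    exact: (@is_derive1_comp _ step (fun t => (t - z) / s) _ _ _ (is_derive_step _) d1).
  have cq z : continuous (q z).
    move=> t; apply: cvgM; last exact: cvg_cst.
    apply: (@cvg_comp _ _ _ (fun t => (t - z) / s) step' _ (nbhs ((t - z) / s))).
      apply: cvgM; last exact: cvg_cst.
      by apply: cvgB; [exact: cvg_id|exact: cvg_cst].
    exact: step'_continuous.
  have p0 z t : t <= z -> p z t = 0.
    by move=> tz; apply: step_le0; rewrite ler_pdivrMr// mul0r subr_le0.
  have p1 z t : z + s <= t -> p z t = 1.
    by move=> tz; apply: step_ge1; rewrite ler_pdivlMr// mul1r; lra.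
  have q0 z t : 0 <= q z t by rewrite divr_ge0 ?step'_ge0// ltW.
  have qout z t : t <= z \/ z + s <= t -> q z t = 0.
    move=> tz; rewrite /q step'_out ?mul0r//.
    case: tz => tz; [left|right].
      by rewrite ler_pdivrMr// mul0r subr_le0.
    by rewrite ler_pdivlMr// mul1r; lra.
  have tphi : test_function a b (fun t => p x t - p y t).
    have dd t : is_derive t (1 : R) (fun t => p x t - p y t) (q x t - q y t).
      have := dp x t; have := dp y t => h1 h2; exact: is_deriveB.
    have de : derive1 (fun t => p x t - p y t) = (fun t => q x t - q y t).
      by apply/funext => t; rewrite derive1E; have [_ ->] := dd t.
    split.
    - by move=> t; have [] := dd t.
    - by rewrite de => t; apply: cvgB; exact: cq.
    exists `[x, y + s]; split; first exact: segment_compact.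
      by apply: subset_itv; rewrite bnd_simp.
    move=> t /negP; rewrite in_itv/= negb_and -!ltNge => /orP[tx|ty].
      by rewrite !p0 ?subrr//; lra.
    by rewrite !p1 ?subrr//; lra.
  have de : derive1 (fun t => p x t - p y t) = (fun t => q x t - q y t).
    apply/funext => t; rewrite derive1E.
    have := dp x t; have := dp y t => h1 h2.
    by have [_ ->] : is_derive t (1 : R) (fun t => p x t - p y t) (q x t - q y t) by exact: is_deriveB.
  have := test0 _ tphi; rewrite de => E.
  have cqz z := @continuous_subspaceT _ _ `[a, b] _ (cq z).
  have iq z : segint a b (q z) by apply: segint_cont.
  have iqc z : segint a b (fun t => q z t * c t).
    by apply: segintM => //; exact: segint_cont.
  have one z : a < z -> z + s < b -> seg a b (q z) = 1.
    move=> az zb.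
    have [_ <-//] : ac a b (p z) (q z).
      apply: ac_C1 => //.
      by apply: continuous_subspaceT => t; exact: is_derive_cont (dp z t).
    - by rewrite p1 ?p0 ?subr0//; exact: ltW.
    - exact: ltW.
  have bd z : a < z -> z + s < b -> `|seg a b (fun t => q z t * c t) - c z| <= e / 2.
    move=> az zb.
    have -> : seg a b (fun t => q z t * c t) - c z =
        seg a b (fun t => q z t * c t - c z * q z t).
      by rewrite segB ?segZ ?one ?mulr1//; exact: segintZ.
    have i4 : segint a b (fun t => q z t * c t - c z * q z t).
      by apply: segintB => //; exact: segintZ.
    apply: le_trans (seg_norm i4) _.
    apply: (@le_trans _ _ (seg a b (fun t => e / 2 * q z t))); last first.
      by rewrite segZ// one// mulr1.
    apply: seg_le; [exact: segint_norm|exact: segintZ|].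
    move=> t at_ tb; have -> : q z t * c t - c z * q z t = (c t - c z) * q z t by ring.
    rewrite normrM [X in _ * X]ger0_norm//.
    have [tz|zt] := leP t z; first by rewrite qout ?mulr0//; left.
    have [tz'|zt'] := leP (z + s) t; first by rewrite qout ?mulr0//; right.
    rewrite ler_wpM2r//; apply/ltW/Hd; rewrite ?ltr_norml; lra.
  have := bd x ax; have := bd y; rewrite !ler_norml => h1 h2.
  have /andP[] := h1 (lt_trans ax xy) sb.
  have /andP[] := h2 ltac:(lra).
  have : seg a b (fun t => q x t * c t) - seg a b (fun t => q y t * c t) = 0.
    rewrite -segB//; rewrite -[RHS]E; apply: seg_eq => t _ _; ring.
  clear; lra.
have closeI x y : a < x -> x < y -> y < b -> c x = c y.
  move=> ax xy yb; apply/eqP; rewrite -subr_eq0 -normr_le0; apply/ler_addgt0Pr => e e0.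
  by rewrite add0r; exact: close.
have closeI' x y : a < x < b -> a < y < b -> c x = c y.
  move=> /andP[ax xb] /andP[ay yb]; have [xy|yx|->//] := ltgtP x y; first exact: closeI.
  by apply/esym/closeI.
have cst x y : a <= x <= b -> a <= y <= b -> c x = c y.
  move=> xab yab; apply/eqP; rewrite -subr_eq0 -normr_le0; apply/ler_addgt0Pr => e e0.
  have e20 : 0 < e / 2 by rewrite divr_gt0.
  have [d d0 Hd] := itv_unif_cont cc e20.
  (* End points are reached by a contraction towards the midpoint with factor [1 - th], which maps
     the closed interval into the open one and moves every point by less than [d]. *)
  have [th [th0 th1 thd]] : exists th, [/\ 0 < th, th < 1 & th * (b - a) < d].
    have ba : 0 < b - a by lra.
    exists (Num.min (2^-1) (d / (2 * (b - a)))); split.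
    - by rewrite lt_min; apply/andP; split; rewrite ?divr_gt0//; lra.
    - by rewrite gt_min; apply/orP; left; lra.
    - have : Num.min (2^-1) (d / (2 * (b - a))) <= d / (2 * (b - a)).
        by rewrite ge_min lexx orbT.
      rewrite -(ler_pM2r ba) => /le_lt_trans; apply.
      have -> : d / (2 * (b - a)) * (b - a) = d / 2 by field; lra.
      lra.
  pose mid := (a + b) / 2.
  have inn z : a <= z <= b -> let z' := z + th * (mid - z) in
      a < z' < b /\ `|z - z'| < d.
    move=> zab /=; clear -ab zab th0 th1 thd; split; first by rewrite /mid; apply/andP; split; nra.
    rewrite ltr_norml /mid; apply/andP; split; nra.
  have [x'ab xx'] := inn x xab; have [y'ab yy'] := inn y yab.
  have x'ab' : a <= x + th * (mid - x) <= b by clear -x'ab; lra.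
  have y'ab' : a <= y + th * (mid - y) <= b by clear -y'ab; lra.
  have := Hd _ _ xab x'ab' xx'; have := Hd _ _ yab y'ab' yy'.
  rewrite (closeI' _ _ x'ab y'ab) add0r !ltr_norml ler_norml; clear; lra.
split => // x y ax xy yb.
have := cst x y ltac:(lra) ltac:(lra); rewrite /c.
by have [_ /(_ x y ax xy yb)] := acG; lra.
Qed.

Lemma ac_weak_derivative a b r g : a < b -> ac a b r g -> is_weak_derivative a b r g.
Proof.
move=> ab acr; have [gi _] := acr; have cr := ac_cont (ltW ab) acr.
split; first exact/segint_oo.
move=> phi [dphi cphi [K [_ Kab phi0]]].
have cphi0 : continuous phi.
  by move=> x; apply/differentiable_continuous/derivable1_diffP.
have acphi : ac a b phi (derive1 phi).
  apply: ac_C1; last 2 first; [exact: continuous_subspaceT..|].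
  by move=> x _; rewrite derive1E; exact: derivableP.
have [pa pb] : phi a = 0 /\ phi b = 0.
  by split; apply: phi0 => /Kab/=; rewrite in_itv/= ltxx ?andbF.
have [_ /(_ a b (lexx _) (ltW ab) (lexx _))] := acM acr acphi.
have cphi' := @continuous_subspaceT _ _ `[a, b] _ cphi.
have cphi0' := @continuous_subspaceT _ _ `[a, b] _ cphi0.
have i1 : segint a b (fun x => g x * phi x).
  by apply: segint_eq (segintM cphi0' gi) => x _ _; rewrite mulrC.
have i2 : segint a b (fun x => r x * derive1 phi x).
  by apply: segintM => //; exact: segint_cont.
rewrite !seg_oo// pa pb !mulr0 subr0 segD//; lra.
Qed.

Lemma ac_W11 a b r g : a < b -> ac a b r g -> W11 a b r.
Proof.
move=> ab acr; have cr := ac_cont (ltW ab) acr.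
split => //; last by exists g; exact: ac_weak_derivative.
exact/segint_oo/segint_cont.
Qed.

Lemma W11_ac a b r : a < b -> W11 a b r -> ac a b r (weakD a b r).
Proof.
move=> ab [cr _ [g wg]]; apply: weak_derivative_ac => //.
rewrite /weakD; exact: (@xgetPex _ (fun=> 0) [set g | is_weak_derivative a b r g] (ex_intro _ g wg)).
Qed.

(** The indefinite integral of [g1 - g2] vanishes identically, and Lebesgue differentiation recovers
    the integrand almost everywhere. *)
Lemma ac_ae_eq a b f g1 g2 : ac a b f g1 -> ac a b f g2 ->
  {ae mu, forall x, a < x < b -> g1 x = g2 x}.
Proof.
move=> [i1 h1] [i2 h2].
pose k := (fun x => g1 x - g2 x) \_ `[a, b].
have ki : mu.-integrable `[a, b] (EFin \o (fun x => g1 x - g2 x)) by exact: segintB.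
have kiT : mu.-integrable setT (EFin \o k).
  by have /integrable_mkcond := ki; rewrite restrict_EFin; apply.
have kloc : locally_integrable [set: R] k by exact: integrable_locally.
have ky y : mu.-integrable `[a, y] (EFin \o k) by apply: integrableS kiT.
have := FTC1 ky kloc; apply: filterS; first exact: (ae_filter_ringOfSetsType mu).
move=> x /= + /andP[ax xb].
rewrite lte_fin => /(_ ax)[_].
have -> : (fun x => \int[mu]_(t in `[a, x]) k t) = cst 0.
  apply/funext => y; rewrite /k -Rintegral_mkcondr.
  have aux z : z <= b -> \int[mu]_(t in `[a, z]) (g1 t - g2 t) = 0.
    have [az|za] := leP a z; last first.
      by rewrite set_itv_ge ?Rintegral_set0// bnd_simp -ltNge.
    move=> zb; have := @segB _ a z g1 g2 (segintS (lexx _) zb i1) (segintS (lexx _) zb i2).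
    rewrite /seg => ->; rewrite -/(seg a z g1) -/(seg a z g2).
    by rewrite -h1 ?h2 ?subrr.
  rewrite (_ : `[a, y] `&` `[a, b] = `[a, Num.min y b]%classic).
    by apply: aux; rewrite ge_min lexx orbT.
  apply/seteqP; split=> t /=; rewrite !in_itv/= le_min.
    by move=> [/andP[-> ->] /andP[_ ->]].
  by move=> /and3P[-> -> ->].
rewrite derive1_cst /k patchE mem_set/=; last by rewrite in_itv/= !ltW.
by move=> /esym/eqP; rewrite subr_eq0 => /eqP.
Qed.

End WeakDerivatives.

(** * The radial stored energy *)

Section Elementary.
Context {R : realType}.
Implicit Types (a b x y : R).

(** The tangent-line inequality for a power at an arbitrary point [b]: after the induction
    hypothesis is multiplied by [a], the defect is a nonnegative multiple of the square of
    [a - b]. *)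
Lemma bernoulli n a b : 0 <= a -> 0 <= b ->
  b ^+ n.+1 + n.+1%:R * b ^+ n * (a - b) <= a ^+ n.+1.
Proof.
move=> a0 b0; elim: n => [|n IH].
  by rewrite !expr1 expr0; lra.
rewrite [leRHS]exprS.
apply: le_trans (ler_wpM2l a0 IH).
rewrite -subr_ge0.
have -> : a * (b ^+ n.+1 + n.+1%:R * b ^+ n * (a - b)) -
  (b ^+ n.+2 + n.+2%:R * b ^+ n.+1 * (a - b)) = n.+1%:R * b ^+ n * (a - b) ^+ 2.
  by rewrite -[n.+2%:R]natr1 !(exprS b); ring.
by apply: mulr_ge0; [apply: mulr_ge0 => //; exact: exprn_ge0|exact: sqr_ge0].
Qed.

Lemma ln_le_subr1 x : 0 < x -> ln x <= x - 1.
Proof. by move=> x0; have := @le_ln1Dx R (x - 1); rewrite subrKC; apply; lra. Qed.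

Lemma xlnx_convex a b : 0 < a -> 0 < b ->
  b * ln b + (1 + ln b) * (a - b) <= a * ln a.
Proof.
move=> a0 b0; have ab : 0 < b / a by rewrite divr_gt0.
have := ln_le_subr1 ab; rewrite ln_div ?posrE// => h.
have := ler_wpM2l (ltW a0) h.
have -> : a * (b / a - 1) = b - a by field; lra.
lra.
Qed.

Lemma is_derive_ln x : 0 < x -> is_derive x (1 : R) (@ln R) x^-1.
Proof. exact: is_derive1_ln. Qed.

(** Superadditivity of powers, with the larger number written as the smaller one plus [c]. It
    converts closeness of n-th powers into closeness of radii with no loss near 0. *)
Lemma exprn_distr_le n a b : 0 <= a -> 0 <= b ->
  `|a - b| ^+ n.+1 <= `|a ^+ n.+1 - b ^+ n.+1|.
Proof.
wlog ba : a b / b <= a.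
  move=> H a0 b0; have [ab|/ltW ba] := leP a b; last exact: H.
  by rewrite distrC [leRHS]distrC; exact: H.
move=> a0 b0; rewrite !ger0_norm ?subr_ge0 ?lerXn2r ?nnegrE//.
have [c [c0 ->]] : exists c, 0 <= c /\ a = b + c by exists (a - b); split; lra.
rewrite [b + c - b]addrAC subrr add0r lerBrDl.
elim: n => [|n IH]; first by rewrite !expr1.
rewrite [leRHS]exprS; apply: le_trans (ler_wpM2l _ IH); last by lra.
rewrite !(exprS _ n.+1) -subr_ge0.
have -> : (b + c) * (b ^+ n.+1 + c ^+ n.+1) - (b * b ^+ n.+1 + c * c ^+ n.+1) =
  b * c ^+ n.+1 + c * b ^+ n.+1 by ring.
by rewrite addr_ge0// mulr_ge0// exprn_ge0.
Qed.

End Elementary.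

(** * Convexity of the stored energy in the determinant *)

Section Energy.
Context {R : realType} (kappa : R) (h : R -> R) (m : nat).
Hypothesis kappa_gt0 : 0 < kappa.
Hypothesis hh : volumetric_energy h.
Hypothesis m_gt0 : (0 < m)%N.
Implicit Types (d D U p q x y : R).

(** With dimension [m.+1], this is the common coefficient obtained when the logarithm of the product
    of the circumferential stretches is rewritten as [m / m.+1] times [ln U]. *)
Definition beta : R := kappa * m%:R / m.+1%:R.

(* [Psi d U] is the stored energy of the radial deformation gradient in terms of
   its determinant [d] and of [U = (r / R)^n]; [stress] is the Cauchy stress. *)
Definition Psi d U : R :=
  kappa / m.+1%:R * (d ^+ m.+1 / U ^+ m) + h d + beta * d * (1 + ln U).
Definition stress d U : R :=
  kappa * (d / U) ^+ m + derive1 h d + beta * (1 + ln U).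
(** The restriction of [Psi] to the diagonal [U = d]. Since [Psi d U] is stationary in [U] there,
    [homT d] is at once the derivative of [homE] and the stress on the diagonal, which allows the
    two branches to match to first order. *)
Definition homE d : R := kappa * d + h d + beta * d * ln d.
Definition homT d : R := kappa + derive1 h d + beta * (1 + ln d).
Definition bregman d D : R := h d - h D - derive1 h D * (d - D).

Lemma beta_gt0 : 0 < beta.
Proof. by rewrite divr_gt0 ?mulr_gt0 ?ltr0n. Qed.

Lemma kappaE : kappa = kappa / m.+1%:R + beta.
Proof.
rewrite /beta; have : m.+1%:R != 0 :> R by rewrite pnatr_eq0.
by rewrite -natr1 => n0; field.
Qed.

Lemma h_ge0 d : 0 < d -> 0 <= h d.
Proof. by case: hh => + _ _ _ _; exact. Qed.

Lemma is_derive_h d : 0 < d -> is_derive d (1 : R) h (derive1 h d).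
Proof. by move=> d0; case: hh => _ /(_ d d0)[? _ _] _ _ _; rewrite derive1E; exact: derivableP. Qed.

Lemma h'_continuous d : 0 < d -> {for d, continuous (derive1 h)}.
Proof.
move=> d0; case: hh => _ /(_ d d0)[_ ? _] _ _ _.
exact/differentiable_continuous/derivable1_diffP.
Qed.

Lemma h'_lt x y : 0 < x -> x < y -> derive1 h x < derive1 h y.
Proof.
move=> x0 xy.
have [_ hd _ _ _] := hh.
have [||c cxy E] := @MVT _ (derive1 h) (derive1 (derive1 h)) x y xy.
- move=> c; rewrite in_itv/= => /andP[xc _].
  have [_ ? _] := hd c (lt_trans x0 xc).
  by rewrite [X in is_derive _ _ _ X]derive1E; exact: derivableP.
- apply: continuous_in_subspaceT => c; rewrite inE/= in_itv/= => /andP[xc _].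
  by apply: h'_continuous; exact: lt_le_trans xc.
move: cxy; rewrite in_itv/= => /andP[xc _].
by rewrite -subr_gt0 E mulr_gt0 ?subr_gt0//; have [] := hd c (lt_trans x0 xc).
Qed.

Lemma h'_le x y : 0 < x -> x <= y -> derive1 h x <= derive1 h y.
Proof. by move=> x0; rewrite le_eqVlt => /predU1P[->//|/(h'_lt x0)/ltW]. Qed.

Lemma h_mvt x y : 0 < x -> x <= y ->
  exists2 c, x <= c <= y & h y - h x = derive1 h c * (y - x).
Proof.
move=> x0 xy.
have [||c cxy E] := @MVT_segment _ h (derive1 h) x y xy.
- move=> c; rewrite in_itv/= => /andP[xc _].
  by apply: is_derive_h; exact: lt_trans xc.
- apply: continuous_in_subspaceT => c; rewrite inE/= in_itv/= => /andP[xc _].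
  by apply: is_derive_cont; apply: is_derive_h; exact: lt_le_trans xc.
by exists c => //; move: cxy; rewrite in_itv.
Qed.

Lemma bregman_ge0 d D : 0 < d -> 0 < D -> 0 <= bregman d D.
Proof.
move=> d0 D0; rewrite /bregman; have [dD|Dd] := leP D d.
  have [c /andP[c1 c2] ->] := h_mvt D0 dD.
  by have := h'_le D0 c1; nra.
have [c /andP[c1 c2] E] := h_mvt d0 (ltW Dd).
have := h'_le (lt_le_trans d0 c1) c2; nra.
Qed.

(** Uniformity down to [D = 0] is the point: the increment of [h'] over a fixed shift is bounded
    below on a compact range by a minimum, and near 0 because [h'] tends to [-oo]. Strict convexity
    alone thus gives control of the distance up to [delta]. *)
Lemma bregman_coercive M (delta : R) : 0 < M -> 0 < delta -> exists2 C, 0 < C &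
  forall d D, 0 < d -> 0 < D -> D <= M -> `|d - D| <= delta + C * bregman d D.
Proof.
move=> M0 de0; pose e := delta / 2; have e0 : 0 < e by rewrite divr_gt0.
have [c c0 Hc] : exists2 c, 0 < c & forall D, 0 < D -> D <= M ->
    c <= derive1 h (D + e) - derive1 h D.
  have : \forall D \near (0:R)^'+, derive1 h D <= derive1 h e - 1.
    by case: hh => _ _ _ /cvgrNyPle/(_ (derive1 h e - 1)).
  move=> [D1 /= D10 HD1].
  pose D0 := Num.min (D1 / 2) M.
  have D00 : 0 < D0 by rewrite lt_min M0 divr_gt0.
  have D0M : D0 <= M by rewrite ge_min lexx orbT.
  have D01 : D0 < D1.
    have : D0 <= D1 / 2 by rewrite ge_min lexx.
    lra.
  have [|x /[!in_itv]/= xin Hx] := @EVT_min _ (fun D => derive1 h (D + e) - derive1 h D) D0 M D0M.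
    apply: continuous_in_subspaceT => z; rewrite inE/= in_itv/= => /andP[z1 z2].
    have z0 : 0 < z by exact: lt_le_trans z1.
    apply: cvgB; last exact: h'_continuous.
    apply: (@cvg_comp _ _ _ (fun D => D + e) (derive1 h) _ (nbhs (z + e))).
      by apply: cvgD; [exact: cvg_id|exact: cvg_cst].
    by apply: h'_continuous; lra.
  exists (Num.min 1 (derive1 h (x + e) - derive1 h x)).
    rewrite lt_min ltr01/= subr_gt0 h'_lt//; lra.
  move=> D Dp DM; have [DD0|D0D] := leP D0 D.
    rewrite ge_min Hx ?orbT// in_itv/=; exact/andP.
  rewrite ge_min; apply/orP; left.
  have : derive1 h D <= derive1 h e - 1.
    by apply: HD1 => //=; rewrite sub0r normrN gtr0_norm//; lra.
  have : derive1 h e <= derive1 h (D + e) by apply: h'_le => //; lra.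
  lra.
exists (2 / c); first by rewrite divr_gt0.
move=> d D d0 D0 DM.
have key : c * `|d - D| <= c * delta + 2 * bregman d D.
  have B0 := bregman_ge0 d0 D0.
  have [small|large] := leP `|d - D| delta.
    by have := ler_wpM2l (ltW c0) small; lra.
  rewrite ltr_normr in large.
  have [Dd|dD] := leP D d.
    have d1 : D + delta < d by move: large => /orP[]; lra.
    (* Three-point argument with the tangent at [D + e]: the Bregman distance is at least
       [c * (d - D - e)], and [d - D > 2 * e] makes the last factor at least half of [d - D], whence
       the constant 2. The other side uses [D - e]. *)
    have := Hc D D0 DM; have := @bregman_ge0 d (D + e) d0; have := @bregman_ge0 (D + e) D.
    rewrite /bregman ger0_norm ?subr_ge0//.
    have De0 : 0 < D + e by lra.
    have eE : delta = 2 * e by rewrite /e; lra.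
    move=> /(_ De0 D0) h1 /(_ De0) h2 h3.
    have : c * (d - D - e) <= (derive1 h (D + e) - derive1 h D) * (d - D - e).
      by rewrite ler_wpM2r//; lra.
    nra.
  have d1 : d + delta < D by move: large => /orP[]; lra.
  have eE : delta = 2 * e by rewrite /e; lra.
  have De0 : 0 < D - e by lra.
  have DeM : D - e <= M by lra.
  have := Hc (D - e) De0 DeM; have := @bregman_ge0 d (D - e) d0; have := @bregman_ge0 (D - e) D De0 D0.
  rewrite /bregman ltr0_norm ?subr_lt0// subrK opprB.
  move=> h1 /(_ De0) h2 h3.
  have : c * (D - e - d) <= (derive1 h D - derive1 h (D - e)) * (D - e - d).
    by rewrite ler_wpM2r//; lra.
  nra.
rewrite -(ler_pM2l c0) mulrDr; apply: le_trans key _.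
rewrite lerD2l le_eqVlt; apply/orP; left; apply/eqP; field; lra.
Qed.

(** In [d] the energy is a convex power, handled by [bernoulli], plus a linear term, plus [h], whose
    convexity defect is by definition the Bregman distance. *)
Lemma Psi_ge_tangent d D U : 0 < d -> 0 < D -> 0 < U ->
  Psi D U + stress D U * (d - D) + bregman d D <= Psi d U.
Proof.
move=> d0 D0 U0; rewrite /Psi /stress /bregman.
have := @bernoulli _ m d D (ltW d0) (ltW D0).
have c0 : 0 < kappa / m.+1%:R / U ^+ m by rewrite !divr_gt0 ?exprn_gt0.
move=> /(ler_wpM2l (ltW c0)).
have -> : kappa / m.+1%:R / U ^+ m * (D ^+ m.+1 + m.+1%:R * D ^+ m * (d - D)) =
   kappa / m.+1%:R * (D ^+ m.+1 / U ^+ m) + kappa * (D / U) ^+ m * (d - D).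
  rewrite expr_div_n; have : m.+1%:R != 0 :> R by rewrite pnatr_eq0.
  have : U ^+ m != 0 by rewrite expf_neq0// gt_eqF.
  move: (U ^+ m) (m.+1%:R : R) => Um M Um0 M0; field.
  by rewrite Um0 M0.
have -> : kappa / m.+1%:R / U ^+ m * d ^+ m.+1 = kappa / m.+1%:R * (d ^+ m.+1 / U ^+ m).
  by rewrite [d ^+ _ / _]mulrC mulrA.
move: (kappa / m.+1%:R * (D ^+ m.+1 / U ^+ m)) (kappa / m.+1%:R * (d ^+ m.+1 / U ^+ m)).
move: (kappa * (D / U) ^+ m) (ln U) (derive1 h D) beta => A L h1 b B C; lra.
Qed.

(** At a given determinant the homogeneous state is optimal: the inequality is [ln w <= w - 1] at
    [w = (d / U) ^+ m]. *)
Lemma Psi_ge_homE d U : 0 < d -> 0 < U -> homE d <= Psi d U.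
Proof.
move=> d0 U0; rewrite /Psi /homE.
have w0 : 0 < (d / U) ^+ m by rewrite exprn_gt0// divr_gt0.
have := ln_le_subr1 w0; rewrite lnXn ?divr_gt0// ln_div ?posrE// => H.
have c0 : 0 < kappa / m.+1%:R * d by rewrite mulr_gt0// divr_gt0.
have := ler_wpM2l (ltW c0) H.
have -> : kappa / m.+1%:R * d * ((ln d - ln U) *+ m) = beta * d * (ln d - ln U).
  by rewrite -[(ln d - ln U) *+ m]mulr_natl /beta; move: (m.+1%:R^-1 : R) (m%:R : R) => M M'; ring.
have -> : kappa / m.+1%:R * d * ((d / U) ^+ m - 1) =
  kappa / m.+1%:R * (d ^+ m.+1 / U ^+ m) - kappa / m.+1%:R * d.
  rewrite expr_div_n exprS.
  by move: (m.+1%:R^-1 : R) (d ^+ m) ((U ^+ m)^-1) => M D V; ring.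
have -> : kappa * d = kappa / m.+1%:R * d + beta * d by rewrite -mulrDl -kappaE.
move: (kappa / m.+1%:R * (d ^+ m.+1 / U ^+ m)) (kappa / m.+1%:R * d) => A B.
by move: (ln d) (ln U) beta => L L' b; lra.
Qed.

Lemma Psi_diag d : 0 < d -> Psi d d = homE d.
Proof.
move=> d0; rewrite /Psi /homE exprS mulfK ?expf_neq0 ?gt_eqF//.
have -> : kappa * d = kappa / m.+1%:R * d + beta * d by rewrite -mulrDl -kappaE.
by move: (kappa / m.+1%:R * d) => A; ring.
Qed.

Lemma homE_ge_tangent d D : 0 < d -> 0 < D ->
  homE D + homT D * (d - D) + bregman d D <= homE d.
Proof.
move=> d0 D0; rewrite /homE /homT /bregman.
have := ler_wpM2l (ltW beta_gt0) (xlnx_convex d0 D0); nra.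
Qed.

(** Comes from [d * ln d >= d - 1]. A uniform bound from below is what allows integrals to be
    treated as those of nonnegative functions. *)
Lemma Psi_ge_Nbeta d U : 0 < d -> 0 < U -> - beta <= Psi d U.
Proof.
move=> d0 U0; apply: le_trans (Psi_ge_homE d0 U0); rewrite /homE.
have := ler_wpM2l (ltW beta_gt0) (xlnx_convex d0 ltr01); rewrite ln1.
have := h_ge0 d0; have := mulr_gt0 kappa_gt0 d0; have := mulr_gt0 beta_gt0 d0; nra.
Qed.

Lemma is_derive_homE d : 0 < d -> is_derive d (1 : R) homE (homT d).
Proof.
move=> d0; have dh := is_derive_h d0; have dl := is_derive_ln d0.
rewrite /homE; apply: is_derive_eq; rewrite /homT /GRing.scale/=; field; lra.
Qed.

Lemma homT_continuous d : 0 < d -> {for d, continuous homT}.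
Proof.
move=> d0; apply: cvgD.
  by apply: cvgD; [exact: cvg_cst|exact: h'_continuous].
apply: cvgM; first exact: cvg_cst.
by apply: cvgD; [exact: cvg_cst|exact: continuous_ln].
Qed.

End Energy.

(** * From principal stretches to determinant and volume ratio *)

Section RadialStretches.
Context {R : realType} (kappa : R) (h : R -> R).
Hypothesis kappa_gt0 : 0 < kappa.
Hypothesis hh : volumetric_energy h.

Lemma partialE k (F : 'rV[R]_k.+1 -> R) i v :
  partial F i v = derive1 (fun t => F (t *: delta_mx 0 i + v)) 0.
Proof.
rewrite /partial derive1E /derive.
have -> : (fun t => t^-1 *: ((F \o shift v) (t *: delta_mx 0 i) - F v)) =
  (fun t : R => t^-1 *: (((fun u => F (u *: delta_mx 0 i + v)) \o shift 0) (t *: (1 : R)) -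
     F (0 *: delta_mx 0 i + v))); last by [].
by apply/funext => t /=; rewrite addr0 scale0r add0r [t%:A]mulr1.
Qed.

Lemma Phihat2E (v : 'rV[R]_2) : Phihat (n := 2) kappa h v =
  kappa / 2 * v 0 0 ^+ 2 + h (v 0 0 * v 0 1) +
  kappa * (v 0 0 * v 0 1) * ((2 - 1) / 2 + ln (v 0 1)).
Proof.
rewrite /Phihat [X in ln X]big_mkcond !big_ord_recl !big_ord0/= !mulr1 mul1r.
by have -> : lift ord0 ord0 = 1 :> 'I_2 by exact: val_inj.
Qed.

Lemma Phihat3E (v : 'rV[R]_3) : Phihat (n := 3) kappa h v =
  kappa / 3 * v 0 0 ^+ 3 + h (v 0 0 * (v 0 1 * v 0 2)) +
  kappa * (v 0 0 * (v 0 1 * v 0 2)) * ((3 - 1) / 3 + ln (v 0 1 * v 0 2)).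
Proof.
rewrite /Phihat [X in ln X]big_mkcond !big_ord_recl !big_ord0/= !mulr1 mul1r.
have -> : lift ord0 ord0 = 1 :> 'I_3 by exact: val_inj.
by have -> : lift ord0 (lift ord0 ord0) = 2 :> 'I_3 by exact: val_inj.
Qed.

Lemma Phihat_shift1 n t p q : n = 2%N \/ n = 3%N ->
  Phihat (n := n) kappa h (t *: delta_mx 0 0 + radial_stretches n p q) =
  kappa / n%:R * (t + p) ^+ n + h ((t + p) * q ^+ n.-1) +
  kappa * ((t + p) * q ^+ n.-1) * ((n%:R - 1) / n%:R + ln (q ^+ n.-1)).
Proof.
by case=> ->; rewrite ?Phihat2E ?Phihat3E !mxE/= ?mulr0 ?add0r ?mulr1 ?expr1 ?expr2.
Qed.

(** Only one of the equal circumferential stretches is moved, hence the mixed product of [q ^+ n.-2]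
    and [t + q]. *)
Lemma Phihat_shift2 n t p q : n = 2%N \/ n = 3%N ->
  Phihat (n := n) kappa h (t *: delta_mx 0 (inord 1) + radial_stretches n p q) =
  kappa / n%:R * p ^+ n + h (p * q ^+ n.-2 * (t + q)) +
  kappa * (p * q ^+ n.-2 * (t + q)) * ((n%:R - 1) / n%:R + ln (q ^+ n.-2 * (t + q))).
Proof.
case=> ->.
  have -> : inord 1 = 1 :> 'I_2 by apply: val_inj; rewrite /= inordK.
  by rewrite Phihat2E !mxE/= mulr0 add0r expr0 !mulr1 mul1r.
have -> : inord 1 = 1 :> 'I_3 by apply: val_inj; rewrite /= inordK.
rewrite Phihat3E !mxE/= ?mulr0 ?add0r ?mulr1 expr1.
have -> : p * q * (t + q) = p * (q * (t + q)) by rewrite mulrA.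
by rewrite [(t + q) * q]mulrC.
Qed.

Lemma Phihat_radial n p q : n = 2%N \/ n = 3%N -> 0 < p -> 0 < q ->
  Phihat (n := n) kappa h (radial_stretches n p q) =
  Psi kappa h n.-1 (p * q ^+ n.-1) (q ^+ n).
Proof.
move=> n23 p0 q0; have := Phihat_shift1 0 p q n23.
rewrite scale0r !add0r => ->; have [m ->] : exists m, n = m.+1.
  by case: n23 => ->; [exists 1%N|exists 2%N].
rewrite /= /Psi /beta !lnXn// -[ln q *+ m]mulr_natl -[ln q *+ m.+1]mulr_natl.
have -> : (p * q ^+ m) ^+ m.+1 / q ^+ m.+1 ^+ m = p ^+ m.+1.
  by rewrite exprMn exprAC mulfK// !expf_neq0// gt_eqF.
have : m.+1%:R != 0 :> R by rewrite pnatr_eq0.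
rewrite -natr1; move: (m%:R : R) (ln q) (q ^+ m) (h _) (p ^+ m.+1) => M L Q H P M0.
by field.
Qed.

Lemma partial1_radial n p q : n = 2%N \/ n = 3%N -> 0 < p -> 0 < q ->
  partial (Phihat (n := n) kappa h) 0 (radial_stretches n p q) =
  q ^+ n.-1 * stress kappa h n.-1 (p * q ^+ n.-1) (q ^+ n).
Proof.
move=> n23 p0 q0; rewrite partialE.
under [X in derive1 X]funext do rewrite (Phihat_shift1 _ _ _ n23).
have : 0 < q ^+ n.-1 by exact: exprn_gt0.
set Q := q ^+ n.-1 => Q0.
have d0 : is_derive (0 : R) (1 : R) (fun t => (t + p) * Q) Q.
  by apply: is_derive_eq; rewrite /GRing.scale/=; ring.
have d1 : is_derive ((fun t => (t + p) * Q) 0) (1 : R) h (derive1 h (p * Q)).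
  by rewrite /= add0r; apply: is_derive_h => //; exact: mulr_gt0.
have d2 : is_derive (0 : R) (1 : R) (fun t => h ((t + p) * Q)) _ :=
  @is_derive1_comp _ h (fun t => (t + p) * Q) 0 _ _ d1 d0.
have d3 : is_derive (0 : R) (1 : R) (fun t => t + p) 1.
  by apply: is_derive_eq; rewrite addr0.
have d4 : is_derive ((fun t => t + p) 0) (1 : R) (fun u => u ^+ n) (n%:R * p ^+ n.-1).
  by rewrite /= add0r; exact: is_derive_exprn.
have d5 : is_derive (0 : R) (1 : R) (fun t => (t + p) ^+ n) _ :=
  @is_derive1_comp _ (fun u => u ^+ n) (fun t => t + p) 0 _ _ d4 d3.
rewrite derive1E; apply: derive_val.
have [m nE] : exists m, n = m.+1 by case: n23 => ->; [exists 1%N|exists 2%N].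
apply: is_derive_eq; rewrite /GRing.scale/= /stress /beta /Q nE /= !lnXn//.
rewrite -[ln q *+ m]mulr_natl -[ln q *+ m.+1]mulr_natl.
have -> : p * q ^+ m / q ^+ m.+1 = p / q.
  by rewrite exprS invfM mulrACA divff ?mulr1// ?expf_neq0// gt_eqF.
rewrite expr_div_n.
have : q ^+ m != 0 by rewrite expf_neq0// gt_eqF.
have : m.+1%:R != 0 :> R by rewrite pnatr_eq0.
rewrite -natr1; move: (derive1 h) => h1.
move: (m%:R : R) (ln q) (q ^+ m) (p ^+ m) => M L Q' P M0 Q0'.
by field; apply/andP.
Qed.

Lemma partial2_radial n p q : n = 2%N \/ n = 3%N -> 0 < p -> 0 < q ->
  partial (Phihat (n := n) kappa h) (inord 1) (radial_stretches n p q) =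
  p * q ^+ n.-2 * (derive1 h (p * q ^+ n.-1) + beta kappa n.-1 * (1 + ln (q ^+ n)) + kappa).
Proof.
move=> n23 p0 q0; rewrite partialE.
under [X in derive1 X]funext do rewrite (Phihat_shift2 _ _ _ n23).
have [m nE] : exists m, n = m.+2 by case: n23 => ->; [exists 0%N|exists 1%N].
rewrite nE /=.
have : 0 < q ^+ m by exact: exprn_gt0.
have QE : q ^+ m.+1 = q ^+ m * q by rewrite exprSr.
have LE : ln (q ^+ m * q) = m.+1%:R * ln q by rewrite -QE lnXn// mulr_natl.
rewrite lnXn// -[ln q *+ m.+2]mulr_natl.
move: QE LE; set Q := q ^+ m => QE LE Q0; set A := p * Q.
have A0 : 0 < A by exact: mulr_gt0.
have d0 B : is_derive (0 : R) (1 : R) (fun t => B * (t + q)) B.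
  by apply: is_derive_eq; rewrite /GRing.scale/=; ring.
have d1 : is_derive ((fun t => A * (t + q)) 0) (1 : R) h (derive1 h (A * q)).
  by rewrite /= add0r; apply: is_derive_h => //; exact: mulr_gt0.
have d2 : is_derive (0 : R) (1 : R) (fun t => h (A * (t + q))) _ :=
  @is_derive1_comp _ h (fun t => A * (t + q)) 0 _ _ d1 (d0 A).
have d3 : is_derive ((fun t => Q * (t + q)) 0) (1 : R) (@ln R) (Q * q)^-1.
  by rewrite /= add0r; apply: is_derive_ln; exact: mulr_gt0.
have d4 : is_derive (0 : R) (1 : R) (fun t => ln (Q * (t + q))) _ :=
  @is_derive1_comp _ (@ln R) (fun t => Q * (t + q)) 0 _ _ d3 (d0 Q).
rewrite derive1E; apply: derive_val.
apply: is_derive_eq; rewrite /GRing.scale/= /beta !add0r LE QE [p * (Q * q)]mulrA -/A.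
have : A != 0 by rewrite gt_eqF.
have : Q != 0 by rewrite gt_eqF.
have : q != 0 by rewrite gt_eqF.
have : m.+2%:R != 0 :> R by rewrite pnatr_eq0.
rewrite -[m.+2%:R]natr1.
move: (derive1 h) (m.+1%:R : R) (ln q) => h1 M L M0 q0' Q0' A0'.
by field; rewrite ?M0 ?q0' ?Q0'.
Qed.

End RadialStretches.

(** * Gluing homogeneous and cavitating fields *)

Section LocalBounds.
Context {R : realType}.
Implicit Types (f : R -> R) (a x l : R).

Lemma is_derive_near f x l : is_derive x (1 : R) f l ->
  forall e : R, 0 < e -> \forall z \near x, `|f z - f x - l * (z - x)| <= e * `|z - x|.
Proof.
move=> /is_derive1_caratheodory[g [fE gc gx]] e e0.
have : \forall z \near x, `|l - g z| <= e.
  by rewrite -gx; move/cvgrPdist_le : gc; exact.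
apply: filterS => z gz; rewrite fE -mulrBl normrM ler_wpM2r// distrC//.
Qed.

Lemma cont_near f x : {for x, continuous f} ->
  forall e : R, 0 < e -> \forall z \near x, `|f z - f x| <= e.
Proof.
move=> /cvgrPdist_le H e e0; have := H e e0; apply: filterS => z.
by rewrite distrC.
Qed.

(** One factor tends to 0 and the other is of first order, so the product is negligible. It is the
    replacement for a derivative of [f] in the envelope argument for [fK]. *)
Lemma increment_product_small f g x l : {for x, continuous f} ->
  is_derive x (1 : R) g l ->
  forall e : R, 0 < e -> \forall z \near x, `|(f z - f x) * (g z - g x)| <= e * `|z - x|.
Proof.
move=> cf dg e e0; near=> z.
have h1 : `|g z - g x - l * (z - x)| <= 1 * `|z - x|.
  by near: z; exact: is_derive_near.
have h2 : `|f z - f x| <= e / (1 + `|l|).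
  by near: z; apply: cont_near => //; rewrite divr_gt0// ltr_pwDl.
have h3 : `|g z - g x| <= (1 + `|l|) * `|z - x|.
  rewrite mulrDl -normrM; apply: le_trans (lerD h1 (lexx _)).
  by apply: le_trans (ler_normD _ _); rewrite subrK.
rewrite normrM; apply: le_trans (ler_pM (normr_ge0 _) (normr_ge0 _) h2 h3) _.
rewrite mulrA divfK// gt_eqF// ltr_pwDl//.
Unshelve. all: by end_near. Qed.

Lemma is_derive_paste f1 f2 a l : is_derive a (1 : R) f1 l ->
  (forall e : R, 0 < e -> exists2 d : R, 0 < d & forall z, a < z -> z < a + d ->
     `|f2 z - f1 a - l * (z - a)| <= e * (z - a)) ->
  is_derive a (1 : R) (fun z => if z <= a then f1 z else f2 z) l.
Proof.
move=> d1 d2; apply: is_derive_eps => e e0.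
have [d d0 Hd] := d2 e e0.
near=> z; rewrite lexx; case: ifPn => [_|].
  by near: z; exact: is_derive_near.
rewrite -ltNge => az; rewrite [X in _ <= _ * X]gtr0_norm ?subr_gt0//; apply: Hd => //.
by near: z; apply: lt_nbhsl; rewrite ltrDl.
Unshelve. all: by end_near. Qed.

Lemma continuous_paste f1 f2 a : {for a, continuous f1} ->
  (forall e : R, 0 < e -> exists2 d : R, 0 < d & forall z, a < z -> z < a + d ->
     `|f2 z - f1 a| <= e) ->
  {for a, continuous (fun z => if z <= a then f1 z else f2 z)}.
Proof.
move=> c1 c2; apply/cvgrPdist_le => e e0.
have [d d0 Hd] := c2 e e0.
near=> z; rewrite lexx; case: ifPn => [_|].
  by rewrite distrC; near: z; exact: cont_near.
rewrite -ltNge => az; rewrite distrC; apply: Hd => //.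
by near: z; apply: lt_nbhsl; rewrite ltrDl.
Unshelve. all: by end_near. Qed.

Lemma is_derive_exprVn n (u : R) : u != 0 ->
  is_derive u (1 : R) (fun v => (v ^+ n)^-1) (- (n%:R * (u ^+ n)^-1 / u)).
Proof.
move=> u0; have d := is_derive_exprn n u.
have un0 : u ^+ n != 0 by rewrite expf_neq0.
apply: (is_derive_conv (@is_deriveV _ (fun v => v ^+ n) u _ (1 : R) un0 d)).
rewrite /GRing.scale/=; case: n un0 {d} => [|n]; first by rewrite !mul0r mulr0 oppr0.
rewrite exprS /= => un0; have : u ^+ n != 0 by rewrite expf_neq0.
by move: (u ^+ n) (n.+1%:R : R) => P N P0; field; apply/andP.
Qed.

End LocalBounds.

(* A solution [W] of the Hamilton-Jacobi equation of the scale-invariant problem,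
   with slope [T = W'] and optimal determinant [D]. *)
Record calibration {R : realType} (kappa : R) (h : R -> R) (m : nat)
    (W T D : R -> R) : Prop := Calibration {
  cal_ge : forall d U, 0 < d -> 0 < U ->
    W U + T U * (d - U) + bregman h d (D U) <= Psi kappa h m d U;
  cal_derive : forall u, is_derive u (1 : R) W (T u);
  cal_cont : continuous T;
  cal_D_gt0 : forall u, 0 < D u;
  cal_D_le : exists M, forall u, D u <= M;
  cal_D_lip : forall M, exists2 L, 0 < L &
    forall u v, u <= v -> v <= M -> `|D u - D v| <= L * (v - u);
  cal_small : forall e, 0 < e -> exists C, forall u, 0 <= u -> `|W u| <= e * u + C }.

(** * Value function obtained from an abstract field beyond [Lam] *)

Section Glue.
Context {R : realType} (kappa : R) (h : R -> R) (m : nat) (Lam U0 : R) (fT fD fK : R -> R).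
Hypothesis kappa_gt0 : 0 < kappa.
Hypothesis hh : volumetric_energy h.
Hypothesis m_gt0 : (0 < m)%N.
Notation beta := (beta kappa m).
Notation stress := (stress kappa h m).
Notation homT := (homT kappa h m).
Notation homE := (homE kappa h m).
Notation Psi := (Psi kappa h m).
Hypothesis U0_gt0 : 0 < U0.
Hypothesis U0_le : U0 <= Lam.
Hypothesis fD_gt0 : forall u, Lam < u -> 0 < fD u.
Hypothesis fD_bounded : exists M, forall u, Lam < u -> fD u <= M.
Hypothesis fTE : forall u, Lam < u -> fT u = stress (fD u) u.
Hypothesis fKE : forall u, Lam < u -> fK u = Psi (fD u) u - fT u * (fD u - u).
Hypothesis is_derive_fK : forall u, Lam < u -> is_derive u (1 : R) fK (fT u).
Hypothesis fT_cont : forall u, Lam < u -> {for u, continuous fT}.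
Hypothesis fT_near : forall v, Lam < v -> 0 <= homT Lam - fT v <= m%:R * beta * (ln v - ln Lam).
Hypothesis fK_near : forall v, Lam < v ->
  `|fK v - homE Lam - homT Lam * (v - Lam)| <= m%:R * beta * (ln v - ln Lam) * (v - Lam).
Hypothesis fD_lip_Lam : forall M, Lam < M -> exists2 L, 0 < L & forall u v, Lam < u -> u <= v -> v <= M ->
  `|fD u - fD v| <= L * (v - u) /\ `|Lam - fD v| <= L * (v - Lam).
Hypothesis fT_small : forall e, 0 < e -> exists A, forall u, Lam < u -> A <= u -> `|fT u| <= e.
Implicit Types u v d x : R.
Let beta0 : 0 < beta := beta_gt0 kappa_gt0 m_gt0.
Let Lam0 : 0 < Lam := lt_le_trans U0_gt0 U0_le.

(** Since [homT] tends to [-oo] at 0, [homE] is followed only from [U0] on and replaced by its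
    tangent line before. The result is C^1 on the whole line and keeps the slope [D] away from 0 on
    this branch, at the price of equality in the calibration. *)
Let lowE u := if u <= U0 then homE U0 + homT U0 * (u - U0) else homE u.
Let lowT u := homT (Num.max u U0).
Definition glueW u := if u <= Lam then lowE u else fK u.
Definition glueT u := if u <= Lam then lowT u else fT u.
Definition glueD u := if u <= Lam then Num.max u U0 else fD u.

Let max_gt0 u : 0 < Num.max u U0.
Proof. by rewrite lt_max U0_gt0 orbT. Qed.

Let lowE_max u : lowE u = homE (Num.max u U0) + lowT u * (u - Num.max u U0).
Proof.
rewrite /lowE /lowT; case: ifPn => [uU|]; first by rewrite max_r.
by rewrite -ltNge => Uu; rewrite max_l ?(ltW Uu)// subrr mulr0 addr0.
Qed.

Let lowE_derive u : is_derive u (1 : R) lowE (lowT u).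
Proof.
have da v : is_derive v (1 : R) (fun u => homE U0 + homT U0 * (u - U0)) (homT U0).
  by apply: is_derive_eq; rewrite /GRing.scale/=; ring.
have [uU|Uu|->] := ltgtP u U0.
- rewrite /lowT max_r ?(ltW uU)//; apply: near_eq_is_derive (da u).
  near=> z; rewrite /lowE ifT//; apply/ltW; near: z; exact: lt_nbhsl.
- rewrite /lowT max_l ?(ltW Uu)//.
  apply: near_eq_is_derive (is_derive_homE kappa m hh (lt_trans U0_gt0 Uu)).
  near=> z; rewrite /lowE ifF//; apply/negbTE; rewrite -ltNge; near: z; exact: lt_nbhsr.
rewrite /lowT maxxx; apply: is_derive_paste (da U0) _ => e e0.
have := is_derive_near (is_derive_homE kappa m hh U0_gt0) e0.
move=> [d /= d0 Hd]; exists d => // z z1 z2.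
rewrite subrr mulr0 addr0 -[X in _ <= _ * X]gtr0_norm ?subr_gt0//; apply: Hd => /=.
by rewrite ltr_norml; lra.
Unshelve. all: by end_near. Qed.

Let max_dist u v : `|Num.max u U0 - Num.max v U0| <= `|u - v|.
Proof.
rewrite !maxEle; case: ifPn => a; case: ifPn => b; rewrite -?ltNge in a b.
- by rewrite subrr normr0.
- by rewrite !ler0_norm; lra.
- by rewrite !ger0_norm; lra.
- by [].
Qed.

Let lowT_cont : continuous lowT.
Proof.
move=> u; apply: (@cvg_comp _ _ _ (fun u => Num.max u U0) homT _ (nbhs (Num.max u U0))); last exact: homT_continuous.
apply/cvgrPdist_le => e e0; near=> z; apply: le_trans (max_dist _ _) _.
by near: z; apply: cvgr_dist_le => //; exact: cvg_id.
Unshelve. all: by end_near. Qed.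

Let log_small e : 0 < e -> exists2 d : R, 0 < d & forall z, Lam < z -> z < Lam + d ->
  m%:R * beta * (ln z - ln Lam) <= e.
Proof.
move=> e0; pose c := m%:R * beta; have c0 : 0 < c by rewrite mulr_gt0 ?ltr0n.
have : {for Lam, continuous (@ln R)} by exact: continuous_ln.
move/cont_near => /(_ (e / c) (divr_gt0 e0 c0))[d /= d0 Hd]; exists d => // z z1 z2.
have : `|ln z - ln Lam| <= e / c by apply: Hd => /=; rewrite ltr_norml; lra.
by rewrite ler_norml => /andP[_]; rewrite ler_pdivlMr// mulrC.
Qed.

(** At the junction [Lam], the remainder in [fK_near] carries a factor [ln v - ln Lam] that tends to
    0, so both sides have the same first-order expansion. *)
Lemma glue_derive u : is_derive u (1 : R) glueW (glueT u).
Proof.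
have [uU|Uu|->] := ltgtP u Lam.
- rewrite /glueT (ltW uU); apply: near_eq_is_derive (lowE_derive u).
  near=> z; rewrite /glueW ifT//; apply/ltW; near: z; exact: lt_nbhsl.
- rewrite /glueT leNgt Uu/=; apply: near_eq_is_derive (is_derive_fK Uu).
  near=> z; rewrite /glueW ifF//; apply/negbTE; rewrite -ltNge; near: z; exact: lt_nbhsr.
rewrite /glueT lexx; apply: is_derive_paste (lowE_derive Lam) _ => e e0.
have [d d0 Hd] := log_small e0; exists d => // z z1 z2.
rewrite lowE_max /lowT max_l// subrr mulr0 addr0; apply: le_trans (fK_near z1) _.
by rewrite ler_wpM2r ?subr_ge0 ?(ltW z1)//; exact: Hd.
Unshelve. all: by end_near. Qed.

Lemma glueT_cont : continuous glueT.
Proof.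
move=> u; have [uU|Uu|->] := ltgtP u Lam.
- have : glueT z @[z --> u] --> lowT u.
    apply: cvg_trans (@lowT_cont u); apply: near_eq_cvg.
    near=> z; rewrite /glueT ifT//; apply/ltW; near: z; exact: lt_nbhsl.
  by rewrite /continuous_at {3}/glueT (ltW uU).
- have : glueT z @[z --> u] --> fT u.
    apply: cvg_trans (@fT_cont u Uu); apply: near_eq_cvg.
    near=> z; rewrite /glueT ifF//; apply/negbTE; rewrite -ltNge; near: z; exact: lt_nbhsr.
  by rewrite /continuous_at {3}/glueT leNgt Uu.
apply: continuous_paste (@lowT_cont Lam) _ => e e0.
have [d d0 Hd] := log_small e0; exists d => // z z1 z2.
have /andP[t1 t2] := fT_near z1.
rewrite /lowT max_l// distrC ger0_norm//; apply: le_trans t2 _; exact: Hd.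
Unshelve. all: by end_near. Qed.

Lemma glueW_low u : u <= Lam ->
  glueW u = homE (Num.max u U0) + glueT u * (u - Num.max u U0).
Proof. by move=> uL; rewrite /glueW /glueT uL lowE_max. Qed.

(** Up to [Lam], drop to [homE] and use its convexity at [Num.max u U0]: the supporting line there
    is the one that [W] and [T] define at [u]. Beyond [Lam], [fKE] identifies the line with the
    tangent of [Psi] in [d] at [fD u]. *)
Lemma glue_ge d u : 0 < d -> 0 < u ->
  glueW u + glueT u * (d - u) + bregman h d (glueD u) <= Psi d u.
Proof.
move=> d0 u0; have [uL|Lu] := leP u Lam.
  rewrite glueW_low// /glueT /glueD uL /lowT.
  apply: le_trans (Psi_ge_homE h m kappa_gt0 d0 u0).
  have := homE_ge_tangent h kappa_gt0 m_gt0 d0 (max_gt0 u).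
  by move: (homT _) => T; lra.
rewrite /glueW /glueT /glueD [u <= Lam]leNgt Lu/= fKE//.
have := Psi_ge_tangent h m kappa_gt0 d0 (fD_gt0 Lu) u0; rewrite -fTE//.
by move: (fT u) => T; lra.
Qed.

(** Exactness at the values of [U] taken by the targets: the constant [U0] for a homogeneous map,
    values beyond [Lam] for a cavitating one. *)
Lemma glue_eq u : 0 < u -> u = U0 \/ Lam < u ->
  glueW u + glueT u * (glueD u - u) = Psi (glueD u) u.
Proof.
move=> u0 [->|Lu].
  rewrite glueW_low// /glueD U0_le maxxx !subrr !mulr0 !addr0 Psi_diag//.
rewrite /glueW /glueT /glueD [u <= Lam]leNgt Lu/= fKE//; ring.
Qed.

Lemma glueD_gt0 u : 0 < glueD u.
Proof. by rewrite /glueD; case: ifPn => //; rewrite -ltNge; exact: fD_gt0. Qed.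

Lemma glueD_le : exists M, forall u, glueD u <= M.
Proof.
have [M HM] := fD_bounded; exists (Num.max M Lam) => u.
rewrite /glueD; case: ifPn => [uL|]; rewrite le_max.
  by rewrite orbC ge_max uL U0_le.
by rewrite -ltNge => /HM ->.
Qed.

Lemma glueD_lip M : exists2 L, 0 < L &
  forall u v, u <= v -> v <= M -> `|glueD u - glueD v| <= L * (v - u).
Proof.
have LM1 : Lam < Num.max (Lam + 1) M by rewrite lt_max; apply/orP; left; lra.
have [L L0 HL] := fD_lip_Lam LM1; exists (L + 1) => [|u v uv vM]; first by lra.
have vM1 : v <= Num.max (Lam + 1) M by rewrite le_max vM orbT.
have uL1 w : w <= Lam -> `|Num.max u U0 - Num.max w U0| <= `|w - u|.
  by move=> _; rewrite [leRHS]distrC; exact: max_dist.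
rewrite /glueD; case: ifPn => uL; case: ifPn => vL; rewrite -?ltNge in uL vL.
- apply: le_trans (uL1 v vL) _; rewrite ger0_norm ?subr_ge0//.
  have : 0 <= L * (v - u) by rewrite mulr_ge0 ?subr_ge0// ltW.
  lra.
- have [_ H2] := HL v v vL (lexx _) vM1.
  have := uL1 Lam (lexx _); rewrite [Num.max Lam U0]max_l// [X in _ <= X -> _]ger0_norm ?subr_ge0// => H1.
  have := ler_normD (Num.max u U0 - Lam) (Lam - fD v); rewrite addrA subrK => H3.
  have : 0 <= L * (Lam - u) by rewrite mulr_ge0 ?subr_ge0// ltW.
  lra.
- by exfalso; lra.
- have [H1 _] := HL u v uL uv vM1; apply: le_trans H1 _.
  by rewrite ler_wpM2r ?subr_ge0//; lra.
Qed.

(** The slope is below [e] past some [A] and [W] is bounded on the compact range before it, so the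
    mean value theorem applies. *)
Lemma glueW_small e : 0 < e -> exists C, forall u, 0 <= u -> `|glueW u| <= e * u + C.
Proof.
move=> e0; have [A0 HA0] := fT_small e0.
pose A := Num.max (Lam + 1) A0.
have AL : Lam < A by rewrite lt_max; apply/orP; left; lra.
have A00 : 0 <= A by exact: ltW (lt_trans Lam0 AL).
have cW : {within `[0, A], continuous glueW}.
  by apply: continuous_subspaceT => z; exact: is_derive_cont (glue_derive z).
have cW' : {within `[0, A], continuous (fun u => - glueW u)}.
  by apply: continuous_subspaceT => z; apply: cvgN; exact: is_derive_cont (glue_derive z).
have [c1 _ H1] := EVT_max A00 cW.
have [c2 _ H2] := EVT_max A00 cW'.
pose C := Num.max (glueW c1) (- glueW c2).
have HC u : 0 <= u -> u <= A -> `|glueW u| <= C.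
  move=> u0 uA; have uin : (u \in `[0, A])%R by rewrite in_itv/= u0.
  have := H1 u uin; have := H2 u uin => h2 h1.
  rewrite ler_norml /C; apply/andP; split.
    by rewrite lerNl le_max h2 orbT.
  by rewrite le_max h1.
exists C => u u0; have [uA|Au] := leP u A.
  by apply: le_trans (HC u u0 uA) _; rewrite lerDr mulr_ge0// ltW.
have [||z zin E] := @MVT _ glueW glueT A u Au.
- by move=> z _; exact: glue_derive.
- by apply: continuous_subspaceT => z; exact: is_derive_cont (glue_derive z).
move: zin; rewrite in_itv/= => /andP[z1 z2].
have t1 : `|glueT z| <= e.
  rewrite /glueT [z <= Lam]leNgt (lt_trans AL z1)/=; apply: HA0; first exact: lt_trans z1.
  by apply: le_trans (ltW z1); rewrite /A le_max lexx orbT.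
have -> : glueW u = glueW A + glueT z * (u - A) by rewrite -E; ring.
apply: le_trans (ler_normD _ _) _; rewrite normrM [`|u - A|]gtr0_norm ?subr_gt0//.
have := HC A A00 (lexx _).
have : `|glueT z| * (u - A) <= e * (u - A) by rewrite ler_wpM2r// subr_ge0 ltW.
have : 0 <= e * A by rewrite mulr_ge0// ltW.
lra.
Qed.

Lemma glue_calibration : calibration kappa h m glueW glueT glueD.
Proof.
split; [exact: glue_ge|exact: glue_derive|exact: glueT_cont|exact: glueD_gt0
  |exact: glueD_le|exact: glueD_lip|exact: glueW_small].
Qed.

End Glue.

(** * The cavitating solution in the phase plane *)

Section CavitatingSolution.
Context {R : realType} (n : nat) (kappa : R) (h : R -> R) (r : R -> R).
Hypothesis n23 : n = 2%N \/ n = 3%N.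
Hypothesis kappa_gt0 : 0 < kappa.
Hypothesis hh : volumetric_energy h.
Hypothesis rsol : cavitating_solution n kappa h r.
Implicit Types x y : R.

Lemma dim_gt0 : (0 < n.-1)%N.
Proof. by case: n23 => ->. Qed.

Lemma dimE : n.-1.+1 = n.
Proof. by case: n23 => ->. Qed.

Definition cavU x : R := (r x / x) ^+ n.
(** The radial stretch divided by the circumferential one, i.e. the derivative of [ln r] with
    respect to [ln x]; the determinant is then [cavw x * cavU x]. *)
Definition cavw x : R := x * derive1 r x / r x.
Definition cavT x : R := stress kappa h n.-1 (cavw x * cavU x) (cavU x).

Lemma cav_derive x : 0 < x -> is_derive x (1 : R) r (derive1 r x).
Proof.
by case: rsol => _ /(_ x) + _ _ x0 => /(_ x0)[? _]; rewrite derive1E; exact: derivableP.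
Qed.

Lemma cav_derive_gt0 x : 0 < x -> 0 < derive1 r x.
Proof. by case: rsol => _ /(_ x) + _ _ x0 => /(_ x0)[_ ?]. Qed.

Lemma cav_lt x y : 0 < x -> x < y -> r x < r y.
Proof.
move=> x0 xy; have [||c cxy E] := @MVT _ r (derive1 r) x y xy.
- by move=> c; rewrite in_itv/= => /andP[xc _]; apply: cav_derive; exact: lt_trans xc.
- apply: continuous_in_subspaceT => c; rewrite inE/= in_itv/= => /andP[xc _].
  by apply: is_derive_cont; apply: cav_derive; exact: lt_le_trans xc.
move: cxy; rewrite in_itv/= => /andP[xc _].
by rewrite -subr_gt0 E mulr_gt0 ?subr_gt0// cav_derive_gt0// (lt_trans x0).
Qed.

Lemma cav_ge x : 0 < x -> r 0 <= r x.
Proof.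
move=> x0; have [[_ r0] _ _ _] := rsol.
apply: (@cvgr_to_le _ _ _ _ r _ _ r0); near=> y; apply/ltW/cav_lt.
- by near: y; exact: nbhs_right_gt.
- by near: y; exact: nbhs_right_lt.
Unshelve. all: by end_near. Qed.

Lemma cav_gt0 x : 0 < x -> 0 < r x.
Proof. by move=> x0; have [[r0 _] _ _ _] := rsol; exact: lt_le_trans (cav_ge x0). Qed.

Lemma cavU_gt0 x : 0 < x -> 0 < cavU x.
Proof. by move=> x0; rewrite exprn_gt0// divr_gt0// cav_gt0. Qed.

Lemma cavw_gt0 x : 0 < x -> 0 < cavw x.
Proof. by move=> x0; rewrite divr_gt0 ?mulr_gt0 ?cav_gt0 ?cav_derive_gt0. Qed.

Lemma cav_detE x : 0 < x -> derive1 r x * (r x / x) ^+ n.-1 = cavw x * cavU x.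
Proof.
move=> x0; have rx := cav_gt0 x0; rewrite /cavw /cavU -{2}dimE [in RHS]exprS.
by move: (_ ^+ n.-1) (derive1 r x) => Q p; field; rewrite !gt_eqF.
Qed.

Lemma is_derive_cavU x : 0 < x ->
  is_derive x (1 : R) cavU (n%:R * cavU x * (cavw x - 1) / x).
Proof.
move=> x0; have rx := cav_gt0 x0; have dr := cav_derive x0.
have x0' : x != 0 by rewrite gt_eqF.
have dV : is_derive x (1 : R) (fun y : R => y^-1) (- x ^- 2 *: (1 : R)) by exact: is_deriveV.
have d1 : is_derive x (1 : R) (fun y => r y / y) (derive1 r x / x - r x / x ^+ 2).
  by apply: is_derive_eq; rewrite /GRing.scale/=; field.
have d2 := is_derive_exprn n (r x / x).
apply: (is_derive_conv (@is_derive1_comp _ (fun u => u ^+ n) (fun y => r y / y) x _ _ d2 d1)).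
rewrite /cavU /cavw.
have -> : (r x / x) ^+ n = r x / x * (r x / x) ^+ n.-1 by rewrite -exprS dimE.
by move: (_ ^+ n.-1) (derive1 r x) => Q p; field; rewrite x0' gt_eqF.
Qed.

Lemma cav_Phihat1 x : 0 < x -> Phihat1 n kappa h r x = (r x / x) ^+ n.-1 * cavT x.
Proof.
move=> x0; rewrite /Phihat1 partial1_radial ?cav_derive_gt0 ?divr_gt0 ?cav_gt0//.
by rewrite cav_detE.
Qed.

(** The flux equals [r ^+ n.-1] times the stress, so only the flux and [r] are differentiated and no
    second derivative of [r] enters. The terms in [h'] and the logarithm cancel, which leaves an
    equation in [cavw] alone up to the factor [1 / x]. *)
Lemma is_derive_cavT x : 0 < x ->
  is_derive x (1 : R) cavT (n%:R * beta kappa n.-1 * cavw x * (1 - cavw x ^+ n.-1) / x).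
Proof.
move=> x0; have rx := cav_gt0 x0; have dr := cav_derive x0.
have x0' : x != 0 by rewrite gt_eqF.
have r0' : r x != 0 by rewrite gt_eqF.
have [_ _ /(_ x x0) dN _] := rsol.
have dm := is_derive_exprn n.-1 (r x).
have drm : is_derive x (1 : R) (fun y => r y ^+ n.-1) _ :=
  @is_derive1_comp _ (fun u => u ^+ n.-1) r x _ _ dm dr.
have rm0 : r x ^+ n.-1 != 0 by rewrite expf_neq0.
have dV : is_derive x (1 : R) (fun y => (r y ^+ n.-1)^-1) _ :=
  @is_deriveV _ (fun y => r y ^+ n.-1) x _ (1 : R) rm0 drm.
have dT := is_deriveM dN dV.
have E : \forall y \near x, ((fun y => y ^+ n.-1 * Phihat1 n kappa h r y) *
   (fun y => (r y ^+ n.-1)^-1)) y = cavT y.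
  near=> y.
  have y0 : 0 < y by near: y; exact: lt_nbhsr.
  rewrite /= fctE cav_Phihat1// expr_div_n.
  have : r y ^+ n.-1 != 0 by rewrite expf_neq0// gt_eqF// cav_gt0.
  have : y ^+ n.-1 != 0 by rewrite expf_neq0// gt_eqF.
  by move: (y ^+ n.-1) (r y ^+ n.-1) (cavT y) => A B C A0 B0; field; apply/andP.
apply: (is_derive_conv (near_eq_is_derive E dT)).
rewrite /GRing.scale/= cav_Phihat1// /Phihat2 partial2_radial ?cav_derive_gt0 ?divr_gt0//.
rewrite cav_detE// -/(cavU x).
have -> : derive1 h (cavw x * cavU x) + beta kappa n.-1 * (1 + ln (cavU x)) =
    cavT x - kappa * cavw x ^+ n.-1.
  rewrite /cavT /stress mulfK; last by rewrite gt_eqF// cavU_gt0.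
  by move: (derive1 h) => h1; ring.
have -> : n%:R * beta kappa n.-1 = n.-1%:R * kappa.
  by rewrite /beta dimE mulrCA mulrA mulfK 1?mulrC// pnatr_eq0 -lt0n; case: n23 => ->.
have -> : n%:R - 1 = n.-1%:R :> R by rewrite -{1}dimE -natr1 addrK.
have dim2 : n.-1 = n.-2.+1 by case: n23 => ->.
have xq : x ^+ n.-2 * (r x / x) ^+ n.-2 = r x ^+ n.-2.
  by rewrite expr_div_n mulrC divfK// expf_neq0.
have xq1 : x ^+ n.-1 * (r x / x) ^+ n.-1 = r x ^+ n.-1.
  by rewrite expr_div_n mulrC divfK// expf_neq0.
have wE : cavw x / x = derive1 r x / r x by rewrite /cavw; field; apply/andP.
rewrite mulrA xq1 -[RHS]mulrA -[RHS]mulrA.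
have -> : cavw x * ((1 - cavw x ^+ n.-1) / x) = derive1 r x / r x * (1 - cavw x ^+ n.-1).
  by rewrite -wE; ring.
have rm2 : r x ^+ n.-2 != 0 by rewrite expf_neq0.
rewrite [X in _ + _ * X](_ : _ = n.-1%:R * (x ^+ n.-2 * (r x / x) ^+ n.-2) * derive1 r x *
   (cavT x - kappa * cavw x ^+ n.-1 + kappa)); last by move: (derive1 r x) => ?; ring.
have rmE : r x ^+ n.-1 = r x * r x ^+ n.-2 by rewrite {1}dim2 exprS.
rewrite xq !rmE.
move: (derive1 r x) (cavT x) (cavw x ^+ n.-1) (n.-1%:R : R) (r x ^+ n.-2) rm2 => p T w m P P0.
by field; apply/andP.
Unshelve. all: by end_near. Qed.

End CavitatingSolution.

(** * Monotonicity from derivatives and first zeros *)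

Section RealFunctions.
Context {R : realType}.
Implicit Types (f df : R -> R) (x y : R).

Lemma derive_ge0_le f df x y : x <= y ->
  (forall z, x <= z <= y -> is_derive z (1 : R) f (df z)) ->
  (forall z, x < z < y -> 0 <= df z) -> f x <= f y.
Proof.
move=> xy d d0; have [||c cxy E] := @MVT_segment _ f df x y xy.
- by move=> z; rewrite in_itv/= => zxy; apply: d; rewrite !ltW//; case/andP: zxy.
- apply: continuous_in_subspaceT => z; rewrite inE/= in_itv/= => zxy.
  by apply: is_derive_cont; exact: d.
have [xy'|] := ltP x y; last by move=> yx; have -> : x = y by apply/le_anti/andP.
have [||c' c'xy E'] := @MVT _ f df x y xy'.
- by move=> z; rewrite in_itv/= => zxy; apply: d; rewrite !ltW//; case/andP: zxy.
- apply: continuous_in_subspaceT => z; rewrite inE/= in_itv/= => zxy.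
  by apply: is_derive_cont; exact: d.
by rewrite -subr_ge0 E' mulr_ge0 ?d0 ?subr_ge0.
Qed.

Lemma derive_gt0_lt f df x y : x < y ->
  (forall z, x <= z <= y -> is_derive z (1 : R) f (df z)) ->
  (forall z, x < z < y -> 0 < df z) -> f x < f y.
Proof.
move=> xy d d0; have [||c cxy E] := @MVT _ f df x y xy.
- by move=> z; rewrite in_itv/= => zxy; apply: d; rewrite !ltW//; case/andP: zxy.
- apply: continuous_in_subspaceT => z; rewrite inE/= in_itv/= => zxy.
  by apply: is_derive_cont; exact: d.
by rewrite -subr_gt0 E mulr_gt0 ?d0 ?subr_gt0//; move: cxy; rewrite in_itv.
Qed.

Lemma one_sub_expr_le n x : 0 <= x -> x <= 1 -> 1 - x ^+ n <= n%:R * (1 - x).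
Proof.
move=> x0 x1; case: n => [|n]; first by rewrite expr0 subrr mul0r.
have := @bernoulli R n x 1 x0 ler01; rewrite !expr1n; lra.
Qed.

Lemma one_sub_expr_ge n x : (0 < n)%N -> 0 <= x -> x <= 1 -> 1 - x <= 1 - x ^+ n.
Proof.
case: n => // n _ x0 x1; rewrite lerD2l lerN2 exprS ler_piMr//.
exact: exprn_ile1.
Qed.

(** The zero is the supremum of the points up to which [f] stays positive; continuity rules out
    either strict sign there. *)
Lemma first_nonpos f a b : a <= b -> {within `[a, b], continuous f} ->
  0 < f a -> f b <= 0 ->
  exists x0, [/\ a < x0, x0 <= b, f x0 = 0 & forall y, a <= y -> y < x0 -> 0 < f y].
Proof.
move=> ab cf fa fb.
pose S := [set x | a <= x <= b /\ forall y, a <= y -> y <= x -> 0 < f y].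
have Sa : S a by split; [rewrite lexx ab|move=> y ay ya; have -> : y = a by apply/le_anti/andP].
have ubS : ubound S b by move=> x [/andP[]].
have supS : has_sup S by split; [exists a|exists b].
pose x0 := sup S.
have ax0 : a <= x0 by apply: ub_le_sup => //; exists b.
have x0b : x0 <= b by apply: ge_sup => //; exists a.
have pos y : a <= y -> y < x0 -> 0 < f y.
  move=> ay yx0; have [|z [_ Hz] yz] := @sup_adherent _ S (x0 - y) _ supS.
    by rewrite subr_gt0.
  by apply: Hz => //; move: yz; rewrite -/x0 subKr => /ltW.
have cx0 e : 0 < e -> exists2 d, 0 < d & forall y, a <= y <= b -> `|x0 - y| < d -> `|f x0 - f y| < e.
  move=> e0; have [d d0 Hd] := itv_unif_cont cf e0; exists d => // y yab; apply: Hd => //.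
  exact/andP.
have f0 : f x0 = 0.
  apply/eqP; case: (ltgtP (f x0) 0) => // [neg|posx0].
    have [d d0 Hd] := cx0 (- f x0) ltac:(by rewrite oppr_gt0).
    have ltx : a < x0.
      by rewrite lt_neqAle ax0 andbT; apply/eqP => E; move: neg; rewrite -E; lra.
    pose y := Num.max a (x0 - d / 2).
    have ya : a <= y by rewrite le_max lexx.
    have yx : y < x0 by rewrite gt_max ltx/=; lra.
    have yd : x0 - d / 2 <= y by rewrite le_max lexx orbT.
    have := pos y ya yx; have := Hd y ltac:(lra) ltac:(rewrite ltr_norml; lra).
    rewrite ltr_norml; lra.
  have [d d0 Hd] := cx0 (f x0) posx0.
  have ltx : x0 < b.
    by rewrite lt_neqAle x0b andbT; apply/eqP => E; move: posx0; rewrite E; lra.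
  pose z := Num.min b (x0 + d / 2).
  have zb : z <= b by rewrite ge_min lexx.
  have zx : x0 < z by rewrite lt_min ltx/=; lra.
  have zd : z <= x0 + d / 2 by rewrite ge_min lexx orbT.
  suff : S z by move=> /(ub_le_sup (ex_intro _ b ubS)); rewrite -/x0; lra.
  split; first lra.
  move=> y ay yz; have [yx|xy] := ltP y x0; first exact: pos.
  have := Hd y ltac:(lra) ltac:(rewrite ltr_norml; lra); rewrite ltr_norml; lra.
exists x0; split => //; rewrite lt_neqAle ax0 andbT.
by apply/eqP => E; move: fa; rewrite E f0 ltxx.
Qed.

End RealFunctions.

(** * Phase-plane analysis and the field generated by the cavitating solution *)

Section Field.
Context {R : realType} (kappa : R) (h : R -> R) (m : nat) (Uc wc : R -> R) (Lam : R).
Hypothesis kappa_gt0 : 0 < kappa.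
Hypothesis hh : volumetric_energy h.
Hypothesis m_gt0 : (0 < m)%N.
Notation beta := (beta kappa m).
Notation stress := (stress kappa h m).
Notation homT := (homT kappa h m).
Notation homE := (homE kappa h m).
Notation Psi := (Psi kappa h m).
Let Tc x := stress (wc x * Uc x) (Uc x).
Hypothesis Uc_gt0 : forall x : R, 0 < x -> 0 < Uc x.
Hypothesis wc_gt0 : forall x : R, 0 < x -> 0 < wc x.
Hypothesis dUc : forall x : R, 0 < x ->
  is_derive x (1 : R) Uc (m.+1%:R * Uc x * (wc x - 1) / x).
Hypothesis dTc : forall x : R, 0 < x ->
  is_derive x (1 : R) Tc (m.+1%:R * beta * wc x * (1 - wc x ^+ m) / x).
Hypothesis Uc0 : Uc x @[x --> 0^'+] --> +oo.
Hypothesis Tc0 : Tc x @[x --> 0^'+] --> (0 : R).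
Hypothesis Ucy : Uc x @[x --> +oo] --> Lam.
Implicit Types (x y u v : R).
Let beta0 : 0 < beta := beta_gt0 kappa_gt0 m_gt0.

Lemma TcE x : 0 < x -> Tc x = kappa * wc x ^+ m + derive1 h (wc x * Uc x) + beta * (1 + ln (Uc x)).
Proof. by move=> x0; rewrite /Tc /stress mulfK// gt_eqF// Uc_gt0. Qed.

Let Dc x := wc x * Uc x.
Let Dc_gt0 x : 0 < x -> 0 < Dc x.
Proof. by move=> x0; rewrite mulr_gt0 ?wc_gt0 ?Uc_gt0. Qed.

(** Near the cavity the stress stays bounded while [beta * ln U] blows up; only [h'] can compensate,
    so the determinant falls below every [e]. *)
Lemma Dc_cvg0 : Dc x @[x --> 0^'+] --> (0 : R).
Proof.
apply/cvgrPdist_le => e e0.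
have [_ _ _ _ _] := hh.
near=> x.
have x0 : 0 < x by near: x; exact: nbhs_right_gt.
rewrite sub0r normrN gtr0_norm ?Dc_gt0// leNgt; apply/negP => eD.
have h1 : derive1 h e <= derive1 h (Dc x) by apply: (h'_le hh) => //; exact: ltW.
have := TcE x0.
have : Tc x <= 1 by near: x; apply: (cvgr_le _ Tc0); exact: ltr01.
(* For such [Uc x] the logarithmic term exceeds [1 - derive1 h e], which contradicts a stress of at
   most 1 when the determinant is above [e]. *)
have : expR ((1 - derive1 h e) / beta) <= Uc x by near: x; apply: (cvgryPge _).1.
rewrite -ler_ln ?posrE ?expR_gt0 ?Uc_gt0// expRK ler_pdivrMr// => h2 h3 h4.
have : 0 < kappa * wc x ^+ m by rewrite mulr_gt0// exprn_gt0// wc_gt0.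
rewrite /Dc in h1; have := beta0; lra.
Unshelve. all: by end_near. Qed.

Lemma wc_lt1_near0 : \forall x \near (0:R)^'+, wc x < 1.
Proof.
near=> x.
have x0 : 0 < x by near: x; exact: nbhs_right_gt.
have : Dc x < 1 by near: x; apply: (cvgr_lt _ Dc_cvg0); exact: ltr01.
have : 1 <= Uc x by near: x; apply: (cvgryPge _).1.
rewrite /Dc; have := wc_gt0 x0; nra.
Unshelve. all: by end_near. Qed.

(** The stress that a homogeneous state with the same [U] would have, minus the actual one. Its sign
    is that of [1 - wc x], and its continuity follows from that of [Uc] and [Tc], whereas continuity
    of [wc] is not among the data. *)
Let gap x := homT (Uc x) - Tc x.

Lemma gapE x : 0 < x ->
  gap x = kappa * (1 - wc x ^+ m) + (derive1 h (Uc x) - derive1 h (wc x * Uc x)).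
Proof. by move=> x0; rewrite /gap TcE// /homT; ring. Qed.

Lemma gap_gt0 x : 0 < x -> (0 < gap x) = (wc x < 1).
Proof.
move=> x0; rewrite gapE//; have w0 := wc_gt0 x0; have U0 := Uc_gt0 x0.
have [w1|w1|->] := ltgtP (wc x) 1.
- apply: addr_gt0; last by rewrite subr_gt0 (h'_lt hh) ?mulr_gt0// gtr_pMl.
  by rewrite mulr_gt0// subr_gt0 exprn_ilt1// -?lt0n ?ltW// gt_eqF.
- apply/negbTE; rewrite -leNgt -oppr_ge0 opprD addr_ge0//.
    by rewrite -mulrN opprB mulr_ge0 ?subr_ge0 ?exprn_ege1// ltW.
  by rewrite opprB subr_ge0 (h'_le hh)// ler_pMl// ltW.
- by rewrite expr1n mul1r !subrr mulr0 addr0 ltxx.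
Qed.

Lemma gap_eq0 x : 0 < x -> gap x = 0 -> wc x = 1.
Proof.
move=> x0; rewrite gapE//; have w0 := wc_gt0 x0; have U0 := Uc_gt0 x0.
have [w1|w1|//] := ltgtP (wc x) 1.
  by move/eqP; have := gap_gt0 x0; rewrite w1 gapE// => /lt0r_neq0/negbTE->.
have : 1 <= wc x ^+ m by rewrite exprn_ege1// ltW.
have : derive1 h (Uc x) < derive1 h (wc x * Uc x) by rewrite (h'_lt hh)// ltr_pMl.
have := kappa_gt0; nra.
Qed.

Lemma Uc_cont x : 0 < x -> {for x, continuous Uc}.
Proof. by move=> x0; exact: is_derive_cont (dUc x0). Qed.

Lemma Tc_cont x : 0 < x -> {for x, continuous Tc}.
Proof. by move=> x0; exact: is_derive_cont (dTc x0). Qed.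

Lemma gap_cont x : 0 < x -> {for x, continuous gap}.
Proof.
move=> x0; apply: cvgB; last exact: Tc_cont.
apply: (@cvg_comp _ _ _ Uc homT _ _ _ (Uc_cont x0)); apply: homT_continuous => //; exact: Uc_gt0.
Qed.

(** If [w * U <= U0], the [h'] terms have a favourable sign and the stress difference controls
    [1 - w]; otherwise [1 - w <= - ln w <= ln U - ln U0]. Monotonicity thus replaces a local bound
    on the second derivative of [h]. *)
Lemma hom_lipschitz w U U0 : 0 < w -> w <= 1 -> 0 < U0 -> U0 <= U ->
  stress (w * U) U <= homT U0 ->
  1 - w <= (1 + (1 + beta) / kappa) * ((homT U0 - stress (w * U) U) + (ln U - ln U0)).
Proof.
move=> w0 w1 U00 UU.
have U_gt0 : 0 < U by exact: lt_le_trans UU.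
rewrite /stress /homT mulfK ?gt_eqF//.
set T0 := kappa + _ + _; set T := kappa * _ + _ + _ => TT.
have yy : ln U0 <= ln U by rewrite ler_ln ?posrE.
have c0 : 0 < (1 + beta) / kappa by rewrite divr_gt0// addr_gt0.
have [case1|case2] := leP (w * U) U0.
  have hle := h'_le hh (mulr_gt0 w0 U_gt0) case1.
  have : kappa * (1 - w) <= kappa * (1 - w ^+ m).
    by rewrite ler_pM2l// one_sub_expr_ge// ltW.
  have TE : T0 - T = kappa * (1 - w ^+ m) + (derive1 h U0 - derive1 h (w * U))
     + beta * (ln U0 - ln U) by rewrite /T0 /T; ring.
  move=> k1; rewrite -(ler_pM2l kappa_gt0).
  have -> : kappa * ((1 + (1 + beta) / kappa) * (T0 - T + (ln U - ln U0))) =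
    (kappa + 1 + beta) * (T0 - T + (ln U - ln U0)) by field; rewrite gt_eqF.
  have := beta0; have := kappa_gt0; nra.
have : ln U0 <= ln w + ln U by rewrite -lnM ?posrE// ler_ln ?posrE ?mulr_gt0// ltW.
have := ln_le_subr1 w0; have c1 : 0 <= (1 + beta) / kappa * (T0 - T + (ln U - ln U0)).
  by apply: mulr_ge0; [exact: ltW|apply: addr_ge0; rewrite subr_ge0].
rewrite mulrDl mul1r; lra.
Qed.

Lemma is_derive_lnUc x : 0 < x ->
  is_derive x (1 : R) (fun x => ln (Uc x)) (m.+1%:R * (wc x - 1) / x).
Proof.
move=> x0; have U0 := Uc_gt0 x0.
apply: (is_derive_conv (@is_derive1_comp _ (@ln R) Uc x _ _ (is_derive_ln U0) (dUc x0))).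
by field; rewrite !gt_eqF.
Qed.

Lemma phase_mono x y : 0 < x -> x < y -> (forall z, x < z < y -> wc z < 1) ->
  Tc x < Tc y /\ Uc y < Uc x.
Proof.
move=> x0 xy wl; split.
  apply: (@derive_gt0_lt _ Tc (fun x => m.+1%:R * beta * wc x * (1 - wc x ^+ m) / x) x y xy).
    by move=> z /andP[xz _]; apply: dTc; exact: lt_le_trans xz.
  move=> z zz; have z0 : 0 < z by lra.
  have w0 := wc_gt0 z0; have w1 := wl z zz.
  apply: divr_gt0 => //; apply: mulr_gt0; first by rewrite mulr_gt0// mulr_gt0.
  by rewrite subr_gt0 exprn_ilt1 ?ltW// -lt0n.
rewrite -ltrN2.
apply: (@derive_gt0_lt _ (fun x => - Uc x) (fun x => - (m.+1%:R * Uc x * (wc x - 1) / x)) x y xy).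
  by move=> z /andP[xz _]; apply: is_deriveN; apply: dUc; exact: lt_le_trans xz.
move=> z zz; have z0 : 0 < z by lra.
have w1 := wl z zz.
by rewrite -mulNr -mulrN opprB divr_gt0// mulr_gt0 ?subr_gt0// mulr_gt0 ?Uc_gt0.
Qed.

(* Were [wc] to reach [1] first at [x0], the solution would coincide before [x0] with the
   homogeneous one through the same point, by uniqueness for the phase-plane system
   in [(Tc, ln Uc)], whose right-hand side is Lipschitz by [hom_lipschitz]. *)
Lemma wc_lt1 x : 0 < x -> wc x < 1.
Proof.
move=> x0; rewrite -gap_gt0// ltNge; apply/negP => gx.
have [a [a0 ax ga]] : exists a, [/\ 0 < a, a <= x & forall y, 0 < y -> y <= a -> 0 < gap y].
  have [e /= e0 He] := wc_lt1_near0.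
  exists (Num.min (e / 2) x); split.
  - by rewrite lt_min x0 divr_gt0.
  - by rewrite ge_min lexx orbT.
  move=> y y0 ye; rewrite gap_gt0//; apply: He => //=.
  rewrite sub0r normrN gtr0_norm//; apply: le_lt_trans ye _.
  have : Num.min (e / 2) x <= e / 2 by rewrite ge_min lexx.
  lra.
have [|x1 [ax1 x1x gx1 gpos]] := first_nonpos ax _ (ga a a0 (lexx a)) gx.
  apply: continuous_in_subspaceT => y; rewrite inE/= in_itv/= => /andP[ay _].
  by apply: gap_cont; exact: lt_le_trans ay.
have x10 : 0 < x1 by exact: lt_trans ax1.
have w1 := gap_eq0 x10 gx1.
have wlt y : 0 < y -> y < x1 -> wc y < 1.
  move=> y0 yx1; rewrite -gap_gt0//.
  by have [ya|ay] := leP y a; [exact: ga|apply: gpos => //; exact: ltW].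
have T1E : Tc x1 = homT (Uc x1) by move: gx1; rewrite /gap; lra.
(* The comparison runs on [b] to [x1], away from the singular factor [1 / x] of the system. *)
pose b := x1 / 2; have b0 : 0 < b by rewrite divr_gt0.
have bx : b < x1 by rewrite /b; lra.
have mono y : b <= y -> y <= x1 -> Tc y <= Tc x1 /\ Uc x1 <= Uc y.
  move=> yb; rewrite le_eqVlt => /predU1P[->//|yx].
  have [||h1 h2] := @phase_mono y x1 _ yx; first by lra.
    by move=> z zz; apply: wlt; lra.
  by split; exact: ltW.
pose C := 1 + (1 + beta) / kappa.
have C0 : 0 < C by rewrite /C addr_gt0// divr_gt0// addr_gt0.
(* The distance to the state at [x1] in the plane of stress and [ln U]; before [x1] both terms are
   nonnegative by monotonicity. *)
pose N y := (Tc x1 - Tc y) + (ln (Uc y) - ln (Uc x1)).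
have N0 y : b <= y -> y <= x1 -> 0 <= N y.
  move=> yb yx; have [h1 h2] := mono y yb yx; rewrite addr_ge0 ?subr_ge0// ler_ln ?posrE ?Uc_gt0//; lra.
have lip y : b <= y -> y < x1 -> 1 - wc y <= C * N y.
  move=> yb yx; have y0 : 0 < y by lra.
  have [h1 h2] := mono y yb (ltW yx).
  rewrite /N T1E; apply: hom_lipschitz; [exact: wc_gt0|by rewrite ltW// wlt|exact: Uc_gt0|exact: h2|].
  by rewrite -T1E.
pose K := m.+1%:R * (beta * m%:R + 1) * C.
have K0 : 0 < K by rewrite /K !mulr_gt0// addr_gt0// mulr_gt0// ltr0n.
pose L := K / b.
pose dN y := - (m.+1%:R * beta * wc y * (1 - wc y ^+ m) / y) + m.+1%:R * (wc y - 1) / y.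
have dNP y : 0 < y -> is_derive y (1 : R) N (dN y).
  move=> y0; have d1 := dTc y0; have d2 := is_derive_lnUc y0.
  by rewrite /N; apply: is_derive_eq; rewrite /dN; ring.
have dNge y : b <= y -> y < x1 -> - L * N y <= dN y.
  move=> yb yx; have y0 : 0 < y by lra.
  have w0 := wc_gt0 y0; have wl := wlt y y0 yx.
  have e1 := one_sub_expr_le m (ltW w0) (ltW wl).
  have e2 := lip y yb yx.
  have e3 : wc y * (1 - wc y ^+ m) <= m%:R * (1 - wc y).
    apply: le_trans e1; rewrite ler_piMl//; last exact: ltW.
    by rewrite subr_ge0 exprn_ile1 ?ltW.
  have -> : dN y = - ((m.+1%:R * (beta * (wc y * (1 - wc y ^+ m)) + (1 - wc y))) / y).
    by rewrite /dN; ring.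
  rewrite mulNr lerN2 /L.
  have step1 : m.+1%:R * (beta * (wc y * (1 - wc y ^+ m)) + (1 - wc y)) <= K * N y.
    apply: (@le_trans _ _ (m.+1%:R * ((beta * m%:R + 1) * (1 - wc y)))).
      rewrite ler_pM2l// mulrDl mul1r lerD2r -mulrA ler_pM2l//.
    have P1 : 0 < beta * m%:R + 1 by rewrite addr_gt0// mulr_gt0// ltr0n.
    have -> : K * N y = m.+1%:R * ((beta * m%:R + 1) * (C * N y)) by rewrite /K; ring.
    by rewrite !ler_pM2l.
  rewrite ler_pdivrMr//; apply: le_trans step1 _.
  have -> : K * N y = K / b * N y * b by field; rewrite gt_eqF.
  apply: ler_wpM2l => //; apply: mulr_ge0; first by rewrite divr_ge0 ?ltW.
  by apply: N0 => //; exact: ltW.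
(* Gronwall backwards: the weight makes [M] nondecreasing, and it vanishes at [x1], so [N b <= 0].
   That contradicts the strict decrease of [Uc]. *)
pose M y := N y * expR (L * y).
pose dM y := (dN y + N y * L) * expR (L * y).
have dMP y : 0 < y -> is_derive y (1 : R) M (dM y).
  move=> y0; have d1 := dNP y y0.
  have d2 : is_derive y (1 : R) (fun y => L * y) L by apply: is_derive_eq; rewrite /GRing.scale/=; ring.
  have d3 : is_derive y (1 : R) (fun y => expR (L * y)) _ :=
    @is_derive1_comp _ (@expR R) (fun y => L * y) y _ _ (is_derive_expR _) d2.
  by rewrite /M; apply: is_derive_eq; rewrite /dM /GRing.scale/=; ring.
have MbM : M b <= M x1.
  apply: (@derive_ge0_le _ M dM b x1 (ltW bx)) => z zz; first by apply: dMP; lra.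
  apply: mulr_ge0; last exact: expR_ge0.
  by have := dNge z ltac:(lra) ltac:(lra); lra.
have Mx1 : M x1 = 0 by rewrite /M /N !subrr addr0 mul0r.
have Nb : N b <= 0.
  by move: MbM; rewrite Mx1 /M pmulr_lle0// expR_gt0.
have [|h1 h2] := @phase_mono b x1 b0 bx.
  by move=> z zz; apply: wlt; lra.
have : ln (Uc x1) < ln (Uc b) by rewrite ltr_ln ?posrE ?Uc_gt0.
by rewrite /N in Nb; lra.
Qed.

Lemma Tc_lt x y : 0 < x -> x < y -> Tc x < Tc y.
Proof.
move=> x0 xy; have [|//] := @phase_mono x y x0 xy.
by move=> z zz; apply: wc_lt1; lra.
Qed.

Lemma Uc_lt x y : 0 < x -> x < y -> Uc y < Uc x.
Proof.
move=> x0 xy; have [|//] := @phase_mono x y x0 xy.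
by move=> z zz; apply: wc_lt1; lra.
Qed.

Lemma Tc_gt0 x : 0 < x -> 0 < Tc x.
Proof.
move=> x0; apply: (@le_lt_trans _ _ (Tc (x / 2))); last by apply: Tc_lt; lra.
apply: (@cvgr_to_le _ _ _ _ Tc _ _ Tc0); near=> y; apply/ltW/Tc_lt.
- by near: y; exact: nbhs_right_gt.
- by near: y; apply: nbhs_right_lt; lra.
Unshelve. all: by end_near. Qed.

Lemma Uc_gtLam x : 0 < x -> Lam < Uc x.
Proof.
move=> x0; apply: (@le_lt_trans _ _ (Uc (x + 1))); last by apply: Uc_lt; lra.
apply: (@cvgr_to_le _ _ _ _ Uc _ _ Ucy); near=> y; apply/ltW/Uc_lt; first lra.
by near: y; apply: nbhs_pinfty_gt; exact: num_real.
Unshelve. all: by end_near. Qed.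

Lemma Tc_lt_homT x : 0 < x -> Tc x < homT (Uc x).
Proof. by move=> x0; rewrite -subr_gt0 -/(gap x) gap_gt0// wc_lt1. Qed.

(* Along the solution the stress is bounded below, whereas [homT] tends to [-oo] at 0. *)
Lemma Lam_gt0 : 0 < Lam.
Proof.
have Lam0 : 0 <= Lam.
  apply: (@cvgr_to_ge _ _ _ _ Uc _ _ Ucy); near=> y; apply/ltW/Uc_gt0.
  by near: y; apply: nbhs_pinfty_gt; exact: num_real.
rewrite lt_neqAle Lam0 andbT; apply/eqP => E.
have := Tc_gt0 (ltr01 : 0 < (1 : R)) => T1.
have [_ _ _ hN _] := hh.
have : \forall d \near (0:R)^'+, homT d < Tc 1.
  near=> d.
  have d0 : 0 < d by near: d; exact: nbhs_right_gt.
  have : derive1 h d <= - kappa - beta by near: d; apply: (cvgrNyPle _).1.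
  have : ln d <= 0 by rewrite ln_le0//; apply/ltW; near: d; exact: nbhs_right_lt.
  by rewrite /homT; have := beta0; nra.
move=> [e /= e0 He].
have : \forall x \near +oo, Uc x < e by apply: (cvgr_lt _ Ucy); rewrite -E.
move=> [A [_ HA]].
pose x := Num.max 2 (A + 1).
have x2 : 2 <= x by rewrite le_max lexx.
have xA : A + 1 <= x by rewrite le_max lexx orbT.
have x0 : 0 < x by lra.
have : homT (Uc x) < Tc 1.
  apply: He => /=; last exact: Uc_gt0.
  by rewrite sub0r normrN gtr0_norm ?Uc_gt0//; apply: HA; lra.
have := Tc_lt_homT x0; have := @Tc_lt 1 x ltr01; lra.
Unshelve. all: by end_near. Qed.

Lemma gap_lt x y : 0 < x -> x < y -> gap y < gap x.
Proof.
move=> x0 xy; have U1 := Uc_lt x0 xy; have T1 := Tc_lt x0 xy.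
have y0 : 0 < Uc y by apply: Uc_gt0; lra.
have := h'_lt hh y0 U1; have : ln (Uc y) < ln (Uc x) by rewrite ltr_ln ?posrE//; lra.
have := beta0; rewrite /gap /homT; nra.
Qed.

(* If the gap stayed above [c], [wc] would stay away from [1] and [ln Uc], whose
   derivative with respect to [ln x] is [n (wc - 1)], would tend to [-oo]. *)
Lemma gap_cvg : gap x @[x --> +oo] --> (0 : R).
Proof.
apply/cvgrPdist_le => e e0.
suff [x0 x00 gx0] : exists2 x0, 0 < x0 & gap x0 <= e.
  near=> x.
  have xx0 : x0 < x by near: x; apply: nbhs_pinfty_gt; exact: num_real.
  have x_gt0 : 0 < x by lra.
  have g0 : 0 < gap x by rewrite gap_gt0// wc_lt1.
  rewrite sub0r normrN gtr0_norm//; have := gap_lt x00 xx0; lra.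
apply: contrapT => H.
have gap_ge x : 0 < x -> e < gap x.
  by move=> x0; rewrite ltNge; apply/negP => gx; apply: H; exists x.
have [c c0 Hc] : exists2 c, 0 < c & forall x, 1 <= x -> c <= 1 - wc x.
  have L0 := Lam_gt0; have U1 : Lam < Uc 1 by apply: Uc_gtLam.
  have cont : {within `[Lam / 2, Uc 1], continuous (derive1 h)}.
    apply: continuous_in_subspaceT => z; rewrite inE/= in_itv/= => /andP[z1 _].
    by apply: (h'_continuous hh); lra.
  have e20 : 0 < e / 2 by rewrite divr_gt0.
  have [d d0 Hd] := itv_unif_cont cont e20.
  have U10 : 0 < Uc 1 by lra.
  have km : 0 < 2 * kappa * m%:R by rewrite !mulr_gt0// ltr0n.
  (* If [1 - wc x < c], the first bound keeps [wc x * Uc x] above [Lam / 2], the second keeps it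
     within the modulus of [h'], and the third makes the power term at most [e / 2]; the gap would
     then be below [e]. *)
  pose c := Num.min (2^-1) (Num.min (d / Uc 1) (e / (2 * kappa * m%:R))).
  have c1 : c <= 2^-1 by rewrite ge_min lexx.
  have c2 : c * Uc 1 <= d by rewrite -ler_pdivlMr// !ge_min lexx orbT.
  have c3 : c * (2 * kappa * m%:R) <= e by rewrite -ler_pdivlMr// !ge_min lexx !orbT.
  have c0 : 0 < c by rewrite !lt_min !divr_gt0//= ?invr_gt0 ?andbT; lra.
  exists c => // x x1; rewrite leNgt; apply/negP => wc1.
  have x0 : 0 < x by lra.
  have w1 := wc_lt1 x0; have w0 := wc_gt0 x0.
  have := gap_ge x x0; rewrite gapE//.
  have UL := Uc_gtLam x0.
  have UU : Uc x <= Uc 1 by move: x1; rewrite le_eqVlt => /predU1P[<-//|/(Uc_lt ltr01)/ltW].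
  have e1 := one_sub_expr_le m (ltW w0) (ltW w1).
  have : kappa * (1 - wc x ^+ m) <= e / 2.
    apply: le_trans (ler_wpM2l (ltW kappa_gt0) e1) _.
    have : m%:R * kappa * (1 - wc x) <= m%:R * kappa * c.
      by rewrite ler_pM2l ?mulr_gt0 ?ltr0n//; exact: ltW.
    lra.
  have wU : (1 - wc x) * Uc x < d.
    apply: lt_le_trans c2; apply: (@lt_le_trans _ _ (c * Uc x)).
      by rewrite ltr_pM2r// Uc_gt0.
    by rewrite ler_pM2l.
  have := Hd (Uc x) (wc x * Uc x) ltac:(lra) ltac:(nra) ltac:(rewrite ltr_norml; nra).
  by rewrite ltr_norml; lra.
(* Monotonicity of [f] says that [Uc] decays at least like a power of [x] with exponent [- c]. *)
pose f x := - ln (Uc x) - c * ln x.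
pose df x := - (m.+1%:R * (wc x - 1) / x) - c * x^-1.
have fmono y : 1 <= y -> f 1 <= f y.
  move=> y1; apply: (@derive_ge0_le _ f df 1 y y1) => z zz.
    have z0 : 0 < z by lra.
    have d1 := is_derive_lnUc z0; have d2 := is_derive_ln z0.
    by rewrite /f; apply: is_derive_eq; rewrite /df /GRing.scale/=; ring.
  have z0 : 0 < z by lra.
  have hc := Hc z ltac:(lra).
  have -> : df z = (m.+1%:R * (1 - wc z) - c) / z by rewrite /df; ring.
  apply: divr_ge0; last exact: ltW.
  rewrite subr_ge0; apply: (le_trans hc).
  rewrite ler_peMl ?ler1n//; lra.
(* Chosen so that [c * ln y] is the whole drop from [ln (Uc 1)] to [ln Lam], while [Uc y] still
   exceeds [Lam]. *)
pose y := expR ((ln (Uc 1) - ln Lam) / c).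
have y1 : 1 <= y.
  rewrite /y -expR0 ler_expR; apply: divr_ge0; last exact: ltW.
  rewrite subr_ge0 ler_ln ?posrE ?Uc_gt0 ?Lam_gt0//.
  exact/ltW/Uc_gtLam.
have := fmono y y1; rewrite /f {2}/y expRK ln1 mulr0 subr0.
have -> : c * ((ln (Uc 1) - ln Lam) / c) = ln (Uc 1) - ln Lam by field; rewrite gt_eqF.
have : ln Lam < ln (Uc y).
  by rewrite ltr_ln ?posrE ?Lam_gt0 ?Uc_gt0 ?Uc_gtLam//; lra.
lra.
Unshelve. all: by end_near. Qed.

Lemma wc_cvg : wc x @[x --> +oo] --> (1 : R).
Proof.
apply/cvgrPdist_le => e e0.
near=> x.
have x0 : 0 < x by near: x; apply: nbhs_pinfty_gt; exact: num_real.
have w0 := wc_gt0 x0; have w1 := wc_lt1 x0.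
rewrite gtr0_norm ?subr_gt0// -(ler_pM2l kappa_gt0).
apply: (@le_trans _ _ (kappa * (1 - wc x ^+ m))).
  by rewrite ler_pM2l// one_sub_expr_ge// ltW.
have : gap x <= kappa * e.
  by near: x; apply: (cvgr_le _ gap_cvg); rewrite mulr_gt0.
rewrite gapE//.
have : derive1 h (wc x * Uc x) < derive1 h (Uc x).
  by apply: (h'_lt hh); rewrite ?mulr_gt0 ?Uc_gt0// gtr_pMl// Uc_gt0.
by lra.
Unshelve. all: by end_near. Qed.

Lemma Dc_cvg : Dc x @[x --> +oo] --> Lam.
Proof. by rewrite -[Lam]mul1r; exact: (cvgM wc_cvg Ucy). Qed.

Lemma Tc_cvg : Tc x @[x --> +oo] --> homT Lam.
Proof.
have hU : homT (Uc x) @[x --> +oo] --> homT Lam.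
  by apply: (@cvg_comp _ _ _ Uc homT _ _ _ Ucy); apply: homT_continuous => //; exact: Lam_gt0.
rewrite -[homT Lam]subr0 (_ : Tc = (fun x => homT (Uc x) - gap x)).
  exact: (cvgB hU gap_cvg).
by apply/funext => x; rewrite /gap subKr.
Qed.

(** Along the curve the slope of the stress against [- ln U] is [beta * w * (1 - w ^+ m) / (1 - w)],
    at most [m%:R * beta]; the bound is obtained by monotonicity of a combination of the two. *)
Lemma Tc_lip x y : 0 < x -> x <= y ->
  0 <= Tc y - Tc x <= m%:R * beta * (ln (Uc x) - ln (Uc y)).
Proof.
move=> x0; rewrite le_eqVlt => /predU1P[->|xy]; first by rewrite !subrr mulr0 lexx.
rewrite subr_ge0 (ltW (Tc_lt x0 xy))/=.
pose f x := - Tc x - m%:R * beta * ln (Uc x).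
pose df x := - (m.+1%:R * beta * wc x * (1 - wc x ^+ m) / x) -
  m%:R * beta * (m.+1%:R * (wc x - 1) / x).
suff : f x <= f y by rewrite /f; lra.
apply: (@derive_ge0_le _ f df x y (ltW xy)) => z zz.
  have z0 : 0 < z by lra.
  have d1 := is_derive_lnUc z0; have d2 := dTc z0.
  by rewrite /f; apply: is_derive_eq; rewrite /df /GRing.scale/=; ring.
have z0 : 0 < z by lra.
have w0 := wc_gt0 z0; have w1 := wc_lt1 z0.
have e1 := one_sub_expr_le m (ltW w0) (ltW w1).
have -> : df z = m.+1%:R * beta * (m%:R * (1 - wc z) - wc z * (1 - wc z ^+ m)) / z.
  by rewrite /df; ring.
apply: divr_ge0; last exact: ltW.
apply: mulr_ge0; first by rewrite mulr_ge0// ltW.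
rewrite subr_ge0; apply: le_trans e1; rewrite ler_piMl ?ltW//.
by rewrite subr_gt0 exprn_ilt1 ?ltW// -lt0n.
Qed.

(** If [wc] decreased, every term of the stress would be no larger at [y], and the power term
    strictly smaller, although the stress does not decrease. *)
Lemma wc_mono x y : 0 < x -> x <= y -> wc x <= wc y.
Proof.
move=> x0 xy; rewrite leNgt; apply/negP => yx.
have y0 : 0 < y by lra.
have /andP[T1 _] := Tc_lip x0 xy.
have UU : Uc y <= Uc x by move: xy; rewrite le_eqVlt => /predU1P[->//|/(Uc_lt x0)/ltW].
have wx := wc_gt0 x0; have wy := wc_gt0 y0; have Ux := Uc_gt0 x0; have Uy := Uc_gt0 y0.
have h1 : derive1 h (wc y * Uc y) <= derive1 h (wc x * Uc x).
  apply: (h'_le hh); first exact: mulr_gt0.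
  by apply: ler_pM => //; exact: ltW.
have w1 : wc y ^+ m < wc x ^+ m.
  by rewrite ltrXn2r ?nnegrE ?ltW// -lt0n.
have l1 : ln (Uc y) <= ln (Uc x) by rewrite ler_ln ?posrE.
move: T1; rewrite !TcE//; have := kappa_gt0; have := beta0; nra.
Qed.

(** When the determinant grows, the [h'] terms can be discarded and the stress increment controls
    the increment of the power; otherwise the logarithm of [wc] grows less than [- ln U]. The factor
    at [a] bounds the slope of the power from below. *)
Lemma wc_lip a x y : 0 < a -> a <= x -> x <= y ->
  kappa * wc a ^+ m.-1 * (wc y - wc x) <=
    (kappa + m.+1%:R * beta) * (ln (Uc x) - ln (Uc y)).
Proof.
move=> a0 ax xy; have x0 : 0 < x by lra.
have y0 : 0 < y by lra.
have /andP[_ T1] := Tc_lip x0 xy.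
have wxy := wc_mono x0 xy; have wax := wc_mono a0 ax.
have wa := wc_gt0 a0; have wx := wc_gt0 x0; have wy := wc_gt0 y0.
have Ux := Uc_gt0 x0; have Uy := Uc_gt0 y0.
have UU : Uc y <= Uc x by move: xy; rewrite le_eqVlt => /predU1P[->//|/(Uc_lt x0)/ltW].
have l1 : ln (Uc y) <= ln (Uc x) by rewrite ler_ln ?posrE.
have wa1 : wc a ^+ m.-1 <= 1 by rewrite exprn_ile1 ?ltW// ?wc_lt1.
have wa0 : 0 < wc a ^+ m.-1 by rewrite exprn_gt0.
have wy1 := wc_lt1 y0.
have [case1|case2] := leP (wc x * Uc x) (wc y * Uc y).
  have h1 := h'_le hh (mulr_gt0 wx Ux) case1.
  have b1 : wc x ^+ m.-1 * (wc y - wc x) <= wc y ^+ m - wc x ^+ m.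
    have := @bernoulli R m.-1 (wc y) (wc x) (ltW wy) (ltW wx); rewrite prednK//.
    have : 1 * (wc x ^+ m.-1 * (wc y - wc x)) <= m%:R * (wc x ^+ m.-1 * (wc y - wc x)).
      by rewrite ler_wpM2r ?ler1n// mulr_ge0 ?subr_ge0// exprn_ge0// ltW.
    by rewrite mul1r mulrA; lra.
  have b2 : wc a ^+ m.-1 * (wc y - wc x) <= wc x ^+ m.-1 * (wc y - wc x).
    by rewrite ler_wpM2r ?subr_ge0// lerXn2r ?nnegrE// ltW.
  have b3 := ler_wpM2l (ltW kappa_gt0) (le_trans b2 b1).
  rewrite -mulrA; apply: le_trans b3 _.
  move: T1; rewrite !TcE// -natr1; have := kappa_gt0; nra.
have : ln (wc y) + ln (Uc y) < ln (wc x) + ln (Uc x).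
  by rewrite -!lnM ?posrE// ltr_ln ?posrE ?mulr_gt0.
have := @ln_le_subr1 R (wc x / wc y) (divr_gt0 wx wy); rewrite ln_div ?posrE// => c1.
have c2 : wc y * (1 - wc x / wc y) = wc y - wc x by field; rewrite gt_eqF.
move=> c3.
have c4 : wc y - wc x <= ln (Uc x) - ln (Uc y).
  rewrite -c2; apply: (@le_trans _ _ (1 - wc x / wc y)); last by lra.
  by apply: ler_piMl; [rewrite subr_ge0 ler_pdivrMr// mul1r|exact: ltW].
have k1 : kappa * wc a ^+ m.-1 <= kappa by rewrite ler_piMr// ltW.
apply: (@le_trans _ _ (kappa * (ln (Uc x) - ln (Uc y)))).
  by apply: ler_pM => //; rewrite ?mulr_ge0 ?subr_ge0// ltW.
by rewrite ler_wpM2r ?subr_ge0// lerDl mulr_ge0// ltW.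
Qed.

Let Lam0 : 0 < Lam.
Proof. exact: Lam_gt0. Qed.

Lemma Uc_surj u : Lam < u -> exists x, 0 < x /\ Uc x = u.
Proof.
move=> Lu.
have [a [a0 ua]] : exists a, 0 < a /\ u <= Uc a.
  have : \forall x \near (0:R)^'+, u <= Uc x by apply: (cvgryPge _).1.
  move=> [e /= e0 He]; exists (e / 2); split; first by rewrite divr_gt0.
  apply: He => /=; last by rewrite divr_gt0.
  by rewrite sub0r normrN gtr0_norm ?divr_gt0//; lra.
have [b [ab ub]] : exists b, a < b /\ Uc b <= u.
  have : \forall x \near +oo, Uc x <= u by apply: (cvgr_le _ Ucy).
  move=> [A [_ HA]]; exists (Num.max (a + 1) (A + 1)); split.
    by rewrite lt_max ltrDl ltr01.
  by apply: HA; rewrite lt_max orbC ltrDl ltr01.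
have [||x] := @IVT _ Uc a b u (ltW ab).
- apply: continuous_in_subspaceT => z; rewrite inE/= in_itv/= => /andP[az _].
  by apply: Uc_cont; exact: lt_le_trans az.
- by rewrite ge_min ub orbT/= le_max ua.
by rewrite in_itv/= => /andP[ax _] xu; exists x; split => //; exact: lt_le_trans ax.
Qed.

Definition Xc u : R := xget 1 [set x | 0 < x /\ Uc x = u].

Lemma XcP u : Lam < u -> 0 < Xc u /\ Uc (Xc u) = u.
Proof. by move=> /Uc_surj ex; exact: (@xgetPex _ 1 [set x | 0 < x /\ Uc x = u] ex). Qed.

Lemma Xc_gt0 u : Lam < u -> 0 < Xc u. Proof. by move=> /XcP[]. Qed.
Lemma UcK u : Lam < u -> Uc (Xc u) = u. Proof. by move=> /XcP[]. Qed.

Lemma XcK x : 0 < x -> Xc (Uc x) = x.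
Proof.
move=> x0; have [y0 yU] := XcP (Uc_gtLam x0).
have [xy|yx|//] := ltgtP (Xc (Uc x)) x.
  by have := Uc_lt y0 xy; rewrite yU ltxx.
by have := Uc_lt x0 yx; rewrite yU ltxx.
Qed.

Lemma Xc_le u v : Lam < u -> u <= v -> Xc v <= Xc u.
Proof.
move=> Lu uv; have Lv : Lam < v by exact: lt_le_trans uv.
rewrite leNgt; apply/negP => H.
by have := Uc_lt (Xc_gt0 Lu) H; rewrite !UcK// ltNge uv.
Qed.

Definition fT u := Tc (Xc u).
Definition fw u := wc (Xc u).
Definition fD u := fw u * u.

Lemma fDE u : Lam < u -> fD u = Dc (Xc u).
Proof. by move=> Lu; rewrite /fD /fw /Dc UcK. Qed.

Lemma fTE u : Lam < u -> fT u = stress (fD u) u.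
Proof. by move=> Lu; rewrite /fT /Tc UcK. Qed.

Lemma fw_gt0 u : Lam < u -> 0 < fw u.
Proof. by move=> Lu; apply: wc_gt0; exact: Xc_gt0. Qed.

Lemma fw_lt1 u : Lam < u -> fw u < 1.
Proof. by move=> Lu; apply: wc_lt1; exact: Xc_gt0. Qed.

Lemma fD_gt0 u : Lam < u -> 0 < fD u.
Proof. by move=> Lu; rewrite mulr_gt0 ?fw_gt0//; exact: lt_trans Lu. Qed.

Lemma is_derive_Xc u : Lam < u ->
  is_derive u (1 : R) Xc (m.+1%:R * u * (fw u - 1) / Xc u)^-1.
Proof.
move=> Lu; have x0 := Xc_gt0 Lu; have d := dUc x0.
rewrite -{1}(UcK Lu); rewrite UcK// in d.
apply: is_derive_inverse d _.
- near=> y; apply: XcK; near: y; exact: lt_nbhsr.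
- near=> y; apply: Uc_cont; near: y; exact: lt_nbhsr.
- have u0 : u != 0 by rewrite gt_eqF//; exact: lt_trans Lu.
  have w0 : fw u - 1 != 0 by rewrite subr_eq0 lt_eqF// fw_lt1.
  have xn0 : (Xc u)^-1 != 0 by rewrite invr_eq0 gt_eqF.
  by rewrite !mulf_neq0 ?pnatr_eq0.
Unshelve. all: by end_near. Qed.

Lemma is_derive_fT u : Lam < u -> is_derive u (1 : R) fT
  (m.+1%:R * beta * fw u * (1 - fw u ^+ m) / Xc u * (m.+1%:R * u * (fw u - 1) / Xc u)^-1).
Proof.
move=> Lu; exact: (@is_derive1_comp _ Tc Xc u _ _ (dTc (Xc_gt0 Lu)) (is_derive_Xc Lu)).
Qed.

Lemma ln_sub_le u v : 0 < u -> u <= v -> ln v - ln u <= (v - u) / u.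
Proof.
move=> u0 uv; have v0 : 0 < v by exact: lt_le_trans uv.
have := @ln_le_subr1 R (v / u) (divr_gt0 v0 u0); rewrite ln_div ?posrE//.
by rewrite mulrBl divff// gt_eqF.
Qed.

(** The bound [M] is essential to the constant: it supplies the positive lower bound [fw M] for the
    stretch ratio, which tends to 0 for large [U]. *)
Lemma fD_lip M : Lam < M -> exists2 L, 0 < L & forall u v, Lam < u -> u <= v -> v <= M ->
  `|fD u - fD v| <= L * (v - u).
Proof.
move=> LM; pose q := kappa * fw M ^+ m.-1.
have q0 : 0 < q by rewrite mulr_gt0// exprn_gt0// fw_gt0.
pose c := (kappa + m.+1%:R * beta) / (q * Lam).
have c0 : 0 < c by apply: divr_gt0; [rewrite addr_gt0// mulr_gt0|exact: mulr_gt0].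
exists (c * M + 1); first by rewrite addr_gt0// mulr_gt0//; exact: lt_trans LM.
move=> u v Lu uv vM.
have u0 : 0 < u by exact: lt_trans Lu.
have Lv : Lam < v by exact: lt_le_trans uv.
have := wc_lip (Xc_gt0 LM) (Xc_le Lv vM) (Xc_le Lu uv).
rewrite -/q !UcK// -/(fw u) -/(fw v) => l1.
have l2 := ln_sub_le u0 uv.
have l3 : (v - u) / u <= (v - u) / Lam.
  by rewrite ler_wpM2l ?subr_ge0// lef_pV2 ?posrE//; exact: ltW.
have l4 : fw u - fw v <= c * (v - u).
  rewrite -(ler_pM2l q0); apply: le_trans l1 _.
  apply: (@le_trans _ _ ((kappa + m.+1%:R * beta) * ((v - u) / Lam))).
    rewrite ler_wpM2l//; last exact: le_trans l3.
    by apply/ltW; rewrite addr_gt0// mulr_gt0.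
  rewrite /c le_eqVlt; apply/orP; left; apply/eqP; field.
  by rewrite !gt_eqF.
have w1 : 0 <= fw u - fw v.
  by rewrite subr_ge0; apply: wc_mono; [exact: Xc_gt0|exact: Xc_le].
have w2 := fw_lt1 Lv; have w3 := fw_gt0 Lv.
rewrite /fD (_ : fw u * u - fw v * v = (fw u - fw v) * u - fw v * (v - u)); last by ring.
apply: le_trans (ler_normB _ _) _; rewrite [(c * M + 1) * _]mulrDl mul1r; apply: lerD.
  rewrite ger0_norm; last by rewrite mulr_ge0// ltW.
  rewrite mulrAC; apply: ler_pM => //; first exact: ltW.
  exact: le_trans vM.
by rewrite ger0_norm ?mulr_ge0 ?subr_ge0 ?(ltW w3)// ler_piMl ?subr_ge0// ltW.
Qed.

Lemma fD_lip_Lam M : Lam < M -> exists2 L, 0 < L & forall u v, Lam < u -> u <= v -> v <= M ->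
  `|fD u - fD v| <= L * (v - u) /\ `|Lam - fD v| <= L * (v - Lam).
Proof.
move=> LM; have [L L0 HL] := fD_lip LM; exists L => // u v Lu uv vM.
split; first exact: HL.
have Lv : Lam < v by exact: lt_le_trans uv.
have c1 : `|Dc x - fD v| @[x --> +oo] --> `|Lam - fD v|.
  by apply: cvg_norm; apply: cvgB; [exact: Dc_cvg|exact: cvg_cst].
apply: (@cvgr_to_le _ _ _ _ _ _ _ c1); near=> x.
have x0 : 0 < x by near: x; apply: nbhs_pinfty_gt; exact: num_real.
have Ux := Uc_gtLam x0.
have -> : Dc x = fD (Uc x) by rewrite fDE// XcK.
apply: le_trans (HL _ _ Ux _ vM) _.
  by apply/ltW; near: x; apply: (cvgr_lt _ Ucy).
by rewrite ler_pM2l//; lra.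
Unshelve. all: by end_near. Qed.

Lemma fT_near v : Lam < v -> 0 <= homT Lam - fT v <= m%:R * beta * (ln v - ln Lam).
Proof.
move=> Lv.
have c1 : Tc x - fT v @[x --> +oo] --> homT Lam - fT v.
  by apply: cvgB; [exact: Tc_cvg|exact: cvg_cst].
apply/andP; split.
  apply: (@cvgr_to_ge _ _ _ _ _ _ _ c1); near=> x.
  have x1 : Xc v < x by near: x; apply: nbhs_pinfty_gt; exact: num_real.
  by have /andP[] := Tc_lip (Xc_gt0 Lv) (ltW x1).
apply: (@cvgr_to_le _ _ _ _ _ _ _ c1); near=> x.
have x1 : Xc v < x by near: x; apply: nbhs_pinfty_gt; exact: num_real.
have /andP[_] := Tc_lip (Xc_gt0 Lv) (ltW x1); rewrite UcK// => /le_trans; apply.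
rewrite ler_wpM2l//; first by rewrite mulr_ge0// ltW.
have x0 : 0 < x by apply: lt_trans x1; exact: Xc_gt0.
by rewrite lerD2l lerN2 ler_ln ?posrE ?Uc_gt0//; apply/ltW/Uc_gtLam.
Unshelve. all: by end_near. Qed.

Lemma fD_continuous u : Lam < u -> {for u, continuous fD}.
Proof.
move=> Lu; have Lu1 : Lam < u + 1 by lra.
have [L L0 HL] := fD_lip Lu1.
  apply/cvgrPdist_le => e e0; near=> z.
  have Lz : Lam < z by near: z; exact: lt_nbhsr.
  have zu : z <= u + 1 by apply/ltW; near: z; apply: lt_nbhsl; rewrite ltrDl.
  have le : `|u - z| <= e / L.
    by near: z; apply: cvgr_dist_le; [exact: cvg_id|rewrite divr_gt0].
  rewrite ler_pdivlMr// mulrC in le; apply: le_trans le.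
  have [uz|zu'] := leP u z.
    by rewrite [`|u - z|]ler0_norm ?subr_le0// opprB; exact: HL.
  rewrite distrC [`|u - z|]gtr0_norm ?subr_gt0//; apply: HL => //; first exact: ltW.
  by rewrite lerDl.
Unshelve. all: by end_near. Qed.

(** The candidate for [W], solved from equality in the calibration at [d = fD u]. *)
Definition fK u := Psi (fD u) u - fT u * (fD u - u).

(* The field is stationary in [D] (envelope theorem), so only the explicit dependence on [u]
   contributes to the derivative; [fD] itself need not be differentiable. *)
Lemma is_derive_fK u : Lam < u -> is_derive u (1 : R) fK (fT u).
Proof.
move=> Lu; have u0 : 0 < u by exact: lt_trans Lu.
have u0' : u != 0 by rewrite gt_eqF.
have Du := fD_gt0 Lu.
(* The slope is frozen at [fD u]; the vanishing derivative of [phi] at [u] is the equilibrium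
   equation in terms of [U]. *)
pose phi v := Psi (fD u) v + (fT v - fT u) * (v - fD u).
have dphi : is_derive u (1 : R) phi 0.
  have d1 := is_derive_exprVn m u0'; have d2 := is_derive_ln u0; have d3 := is_derive_fT Lu.
  rewrite /phi /Psi; apply: is_derive_eq; rewrite /GRing.scale/=.
  have w1 : fw u - 1 != 0 by rewrite subr_eq0 lt_eqF// fw_lt1.
  have xn0 : Xc u != 0 by rewrite gt_eqF// Xc_gt0.
  have mn0 : m.+1%:R != 0 :> R by rewrite pnatr_eq0.
  rewrite subrr mul0r !add0r /fD exprMn exprSr.
  have um : u ^+ m != 0 by rewrite expf_neq0.
  rewrite /beta exprSr.
  move: (m.+1%:R : R) (m%:R : R) (fw u) (Xc u) (u ^+ m) (fw u ^+ m) mn0 w1 xn0 um.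
  move=> N M w X P Q N0 w0 X0 P0.
  by field; rewrite N0 w0 X0 P0 u0'.
have cD := fD_continuous Lu.
have cDn : {for u, continuous (fun v => fD v ^+ m.+1)}.
  by apply: (@cvg_comp _ _ _ fD (fun x => x ^+ m.+1) _ _ _ cD); exact: exprn_continuous.
pose g v := beta * ln v - fT v.
have dg : is_derive u (1 : R) g (beta * u^-1 - m.+1%:R * beta * fw u * (1 - fw u ^+ m) / Xc u *
    (m.+1%:R * u * (fw u - 1) / Xc u)^-1).
  have d2 := is_derive_ln u0; have d3 := is_derive_fT Lu.
  by rewrite /g; apply: is_derive_eq; rewrite /GRing.scale/=; ring.
have dp := is_derive_exprVn m u0'.
apply: is_derive_eps => e e0.
have e30 : 0 < e / 3 by rewrite divr_gt0.
have e3k : 0 < e / 3 / (kappa / m.+1%:R) by rewrite !divr_gt0.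
near=> v.
have Lv : Lam < v by near: v; exact: lt_nbhsr.
have v0 : 0 < v by exact: lt_trans Lv.
have Dv := fD_gt0 Lv.
have b1 : `|phi v - phi u - 0 * (v - u)| <= e / 3 * `|v - u| by near: v; exact: is_derive_near.
have b2 : `|(fD v ^+ m.+1 - fD u ^+ m.+1) * ((v ^+ m)^-1 - (u ^+ m)^-1)|
    <= e / 3 / (kappa / m.+1%:R) * `|v - u|.
  by near: v; apply: increment_product_small dp _ e3k.
have b3 : `|(fD v - fD u) * (g v - g u)| <= e / 3 * `|v - u|.
  by near: v; exact: increment_product_small.
have t1 := Psi_ge_tangent h m kappa_gt0 Du Dv v0.
have t2 := Psi_ge_tangent h m kappa_gt0 Dv Du u0.
have B1 := bregman_ge0 hh Du Dv; have B2 := bregman_ge0 hh Dv Du.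
rewrite -!fTE// in t1 t2.
(* The tangent inequality at [v] bounds the increment from above, the one at [u] from below; the two
   bounds differ by products of increments, negligible by [increment_product_small]. *)
have up : fK v - fK u - fT u * (v - u) <= phi v - phi u.
  by rewrite /phi /fK subrr mul0r; lra.
have low : phi v - phi u + kappa / m.+1%:R * ((fD v ^+ m.+1 - fD u ^+ m.+1) * ((v ^+ m)^-1 - (u ^+ m)^-1))
   + (fD v - fD u) * (g v - g u) <= fK v - fK u - fT u * (v - u).
  rewrite /phi /fK /g subrr mul0r addr0.
  have E : Psi (fD v) v - Psi (fD v) u - Psi (fD u) v + Psi (fD u) u =
    kappa / m.+1%:R * ((fD v ^+ m.+1 - fD u ^+ m.+1) * ((v ^+ m)^-1 - (u ^+ m)^-1))
    + (fD v - fD u) * (beta * ln v - beta * ln u).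
    by rewrite /Psi; ring.
  by move: E t2 B1 B2; move: (kappa / m.+1%:R * (_ * _)) => Q; lra.
have b2' : `|kappa / m.+1%:R * ((fD v ^+ m.+1 - fD u ^+ m.+1) * ((v ^+ m)^-1 - (u ^+ m)^-1))| <= e / 3 * `|v - u|.
  have k0 : 0 < kappa / m.+1%:R by rewrite divr_gt0.
  rewrite normrM gtr0_norm//; apply: le_trans (ler_wpM2l (ltW k0) b2) _.
  by rewrite mulrA mulrC [_ * (e / 3 / _)]mulrC divfK ?gt_eqF// mulrC.
move: b1 b2' b3 up low; rewrite mul0r subr0.
move: (kappa / m.+1%:R * (_ * _)) ((fD v - fD u) * _) (phi v - phi u) `|v - u| => Q1 Q2 Q3 Q4.
by rewrite !ler_norml; lra.
Unshelve. all: by end_near. Qed.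

Lemma fK_cvg : fK (Uc x) @[x --> +oo] --> homE Lam.
Proof.
have P : Psi (Dc x) (Uc x) @[x --> +oo] --> Psi Lam Lam.
  rewrite /Psi; apply: cvgD; first apply: cvgD.
  - apply: cvgM; first exact: cvg_cst.
    apply: cvgM.
      by apply: (@cvg_comp _ _ _ Dc (fun x => x ^+ m.+1) _ _ _ Dc_cvg); exact: exprn_continuous.
    apply: cvgV; first by rewrite expf_neq0// gt_eqF.
    by apply: (@cvg_comp _ _ _ Uc (fun x => x ^+ m) _ _ _ Ucy); exact: exprn_continuous.
  - apply: (@cvg_comp _ _ _ Dc h _ _ _ Dc_cvg).
    exact: is_derive_cont (is_derive_h hh Lam_gt0).
  - apply: cvgM; first by apply: cvgM; [exact: cvg_cst|exact: Dc_cvg].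
    apply: cvgD; first exact: cvg_cst.
    by apply: (@cvg_comp _ _ _ Uc (@ln R) _ _ _ Ucy); exact: continuous_ln.
have -> : homE Lam = Psi Lam Lam - homT Lam * (Lam - Lam) by rewrite subrr mulr0 subr0 Psi_diag.
apply: cvg_trans (cvgB P (cvgM Tc_cvg (cvgB Dc_cvg Ucy))); apply: near_eq_cvg.
near=> x.
have x0 : 0 < x by near: x; apply: nbhs_pinfty_gt; exact: num_real.
by rewrite /fK fDE ?Uc_gtLam// /fT XcK.
Unshelve. all: by end_near. Qed.

Lemma fT_cont u : Lam < u -> {for u, continuous fT}.
Proof. by move=> Lu; exact: is_derive_cont (is_derive_fT Lu). Qed.

Lemma fT_anti u v : Lam < u -> u <= v -> fT v <= fT u.
Proof.
move=> Lu uv; have Lv : Lam < v by exact: lt_le_trans uv.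
by have /andP[+ _] := Tc_lip (Xc_gt0 Lv) (Xc_le Lu uv); rewrite subr_ge0.
Qed.

(** The mean value theorem between [Uc x] and [v] turns the slope estimate [fT_near] into a value
    estimate, and [x] then goes to infinity so that [Uc x] reaches [Lam]. *)
Lemma fK_near v : Lam < v ->
  `|fK v - homE Lam - homT Lam * (v - Lam)| <= m%:R * beta * (ln v - ln Lam) * (v - Lam).
Proof.
move=> Lv; set c := m%:R * beta * (ln v - ln Lam).
have c1 : `|fK v - fK (Uc x) - homT Lam * (v - Uc x)| @[x --> +oo] -->
    `|fK v - homE Lam - homT Lam * (v - Lam)|.
  apply: cvg_norm; apply: cvgB; first by apply: cvgB; [exact: cvg_cst|exact: fK_cvg].
  by apply: cvgM; [exact: cvg_cst|apply: cvgB; [exact: cvg_cst|exact: Ucy]].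
apply: (@cvgr_to_le _ _ _ _ _ _ _ c1); near=> x.
have x0 : 0 < x by near: x; apply: nbhs_pinfty_gt; exact: num_real.
have UL := Uc_gtLam x0.
have Uv : Uc x < v by near: x; apply: (cvgr_lt _ Ucy).
have [||z zin ->] := @MVT _ fK fT (Uc x) v Uv.
- by move=> z; rewrite in_itv/= => /andP[z1 _]; apply: is_derive_fK; exact: lt_trans z1.
- apply: continuous_in_subspaceT => z; rewrite inE/= in_itv/= => /andP[z1 _].
  exact: is_derive_cont (is_derive_fK (lt_le_trans UL z1)).
move: zin; rewrite in_itv/= => /andP[z1 z2].
have Lz : Lam < z by exact: lt_trans z1.
have /andP[t1 t2] := fT_near Lz.
have /andP[t3 t4] := fT_near Lv.
have t5 := fT_anti Lz (ltW z2).
rewrite (_ : _ - _ = - ((homT Lam - fT z) * (v - Uc x))) ?normrN; last by ring.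
rewrite ger0_norm; last by rewrite mulr_ge0// subr_ge0 ltW.
apply: (@le_trans _ _ (c * (v - Uc x))).
  by rewrite ler_wpM2r ?subr_ge0 ?(ltW Uv)// /c; lra.
by rewrite ler_wpM2l ?lerD2l ?lerN2 ?(ltW UL)// /c; lra.
Unshelve. all: by end_near. Qed.

(** The stress never exceeds its limit [homT Lam], whereas a large determinant would make [h']
    exceed it. *)
Lemma fD_bounded : exists M, forall u, Lam < u -> fD u <= M.
Proof.
have [_ _ _ _ /cvgryPgt/(_ (kappa + derive1 h Lam))[M [_ HM]]] := hh.
exists (Num.max Lam (M + 1)) => u Lu; rewrite leNgt; apply/negP; rewrite gt_max => /andP[D1 D2].
have D0 := fD_gt0 Lu; have x0 := Xc_gt0 Lu.
have := HM (fD u) ltac:(lra).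
have /andP[+ _] := fT_near Lu; rewrite /fT TcE// UcK// -/(fw u) -/(fD u) /homT.
have : ln Lam <= ln u by rewrite ler_ln ?posrE//; [exact: ltW|exact: lt_trans Lu].
have : 0 < fw u ^+ m by rewrite exprn_gt0// fw_gt0.
have := kappa_gt0; have := beta0; nra.
Qed.

(** Large [U] corresponds to points near the cavity, where the traction vanishes; this is the source
    of the sublinearity of [W]. *)
Lemma fT_small e : 0 < e -> exists A, forall u, Lam < u -> A <= u -> `|fT u| <= e.
Proof.
move=> e0; have : \forall x \near (0:R)^'+, Tc x <= e by apply: (cvgr_le _ Tc0).
move=> [d /= d0 Hd]; exists (Uc (d / 2)) => u Lu Au.
have d20 : 0 < d / 2 by rewrite divr_gt0.
have x0 := Xc_gt0 Lu.
rewrite /fT gtr0_norm ?Tc_gt0//; apply: Hd => //=.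
rewrite sub0r normrN gtr0_norm//.
have := Xc_le (Uc_gtLam d20) Au; rewrite XcK//; lra.
Qed.

Lemma Uc_calibration U0 : 0 < U0 -> U0 <= Lam ->
  calibration kappa h m (glueW kappa h m Lam U0 fK) (glueT kappa h m Lam U0 fT)
    (glueD Lam U0 fD).
Proof.
move=> U00 U0L; apply: (glue_calibration kappa_gt0 hh m_gt0 U00 U0L fD_gt0 fD_bounded fTE).
- by [].
- exact: is_derive_fK.
- exact: fT_cont.
- exact: fT_near.
- exact: fK_near.
- exact: fD_lip_Lam.
- exact: fT_small.
Qed.

End Field.

(** * Calibrated energies *)

Section Competitors.
Context {R : realType}.
Notation mu := (@lebesgue_measure R).
Implicit Types (a b x y z eps lambda : R) (f g r G : R -> R).

Lemma segint_off_null a b (N : set R) f g : measurable N -> mu N = 0%E ->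
  measurable_fun `[a, b] g ->
  (forall x, a <= x <= b -> ~ N x -> f x = g x) -> segint a b f ->
  segint a b g /\ forall x y, a <= x -> y <= b -> seg x y f = seg x y g.
Proof.
move=> mN N0 mg fg fi; split.
  have /integrableP[mf fin] := fi.
  apply/integrableP; split; first exact/measurable_EFinP.
  rewrite -(@integral_eq_off_null _ _ _ mu `[a, b] N (fun x => `|(EFin \o f) x|%E))//.
    by apply: measurableT_comp => //; exact/measurable_EFinP.
  by move=> x /=; rewrite in_itv/= => /fg H /H ->.
move=> x y ax yb; rewrite /seg /Rintegral; congr fine.
have sub : `[x, y] `<=` `[a, b] by apply: subset_itv; rewrite bnd_simp.
apply: (@integral_eq_off_null _ _ _ mu `[x, y] N) => //.
  by apply/measurable_EFinP; exact: measurable_funS mg.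
by move=> z /sub /=; rewrite in_itv/= => /fg H /H ->.
Qed.

Lemma ae_null_set (P : R -> Prop) : {ae mu, forall x, P x} ->
  exists N : set R, [/\ measurable N, mu N = 0%E & forall x, ~ N x -> P x].
Proof.
move=> [N [mN N0 sN]]; exists N; split => // x Nx; apply: contrapT => Px.
by apply: Nx; exact: sN.
Qed.

(** Carries a representative [G] of the weak derivative that is positive at every positive point, so
    that determinants are positive pointwise and not only almost everywhere. *)
Definition competitor lambda eps r G : Prop :=
  [/\ ac eps 1 r G, r 1 = lambda, 0 <= r eps & forall x, 0 < x -> 0 < G x].

Lemma admissible_competitor lambda eps r : eps < 1 -> admissible lambda eps r ->
  exists G, competitor lambda eps r G /\ exists N : set R, [/\ measurable N, mu N = 0%E &
    forall x, eps < x < 1 -> ~ N x -> weakD eps 1 r x = G x].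
Proof.
move=> e1 [w11 rl wpos r0].
have [gi gE] := W11_ac e1 w11; set g := weakD eps 1 r in gi gE wpos *.
have [N0 [mN0 N00 HN0]] := ae_null_set wpos.
(* The end points are added because admissibility constrains the derivative on the open interval
   only. *)
pose N := N0 `|` ([set eps] `|` [set 1]).
have mN : measurable N by apply: measurableU => //; exact: measurableU.
have muN : mu N = 0%E.
  have n1 : mu.-negligible [set eps : R] by apply/negligibleP => //; exact: lebesgue_measure_set1.
  have n2 : mu.-negligible [set 1 : R] by apply/negligibleP => //; exact: lebesgue_measure_set1.
  by apply/negligibleP => //; apply: negligibleU; [apply/negligibleP|exact: negligibleU].
pose G x := if 0 < g x then g x else 1.
have mg : measurable_fun `[eps, 1] g by have /integrableP[/measurable_EFinP] := gi.
have mG : measurable_fun `[eps, 1] G.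
  apply: measurable_fun_if => //.
  - exact: measurable_fun_ltr.
  - by apply: measurable_funS mg => // x [].
have gG x : eps <= x <= 1 -> ~ N x -> g x = G x.
  move=> xe Nx; rewrite /G ifT//; apply: HN0 => [n0|/=]; first by apply: Nx; left.
  rewrite in_itv/= !lt_neqAle eq_sym; case/andP : xe => -> ->; rewrite !andbT.
  by apply/andP; split; apply/eqP => xE; apply: Nx; right; [left|right].
have [Gi GE] := segint_off_null mN muN mG gG gi.
exists G; split; last by exists N; split => // x xe; apply: gG; lra.
split => //; last by move=> x _; rewrite /G; case: ifPn.
by split => // x y xe xy y1; rewrite gE//; exact: GE.
Qed.

Lemma competitor_mono lambda eps r G x y : 0 <= eps -> competitor lambda eps r G ->
  eps < x -> x <= y -> y <= 1 -> r x <= r y.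
Proof.
move=> e0 [[_ gE] _ _ G0] ex xy y1; rewrite -subr_ge0 gE//; last exact: ltW.
apply: seg_ge0 => z xz zy; apply/ltW/G0; lra.
Qed.

Lemma competitor_mono_left lambda eps r G x : 0 <= eps -> competitor lambda eps r G ->
  eps < x -> x <= 1 -> r eps <= r x.
Proof.
move=> e0 C ex x1; have [Hac _ _ _] := C.
have cr := ac_cont (ltW (lt_le_trans ex x1)) Hac.
have [_ cl _] := (continuous_within_itvP r (lt_le_trans ex x1)).1 cr.
apply: (@cvgr_to_le _ _ _ _ r _ _ cl).
have nz : \forall z \near eps^'+, eps < z < x.
  by near=> z; apply/andP; split; near: z; [exact: nbhs_right_gt|exact: nbhs_right_lt].
apply: filterS nz => z /andP[ez zx].
exact: competitor_mono e0 C ez (ltW zx) x1.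
Unshelve. all: by end_near. Qed.

(** A monotone map that is nonpositive at [x] vanishes on the whole interval from [eps] to [x]; then
    0 is also a density there, against the positivity of [G]. *)
Lemma competitor_gt0 lambda eps r G x : 0 <= eps -> competitor lambda eps r G ->
  eps < x -> x <= 1 -> 0 < r x.
Proof.
move=> e0 C ex x1; have [Hac _ r0 G0] := C.
rewrite ltNge; apply/negP => rx0.
have rz z : eps <= z -> z <= x -> r z = 0.
  rewrite le_eqVlt => /predU1P[<- _|ez zx].
    by have := competitor_mono_left e0 C ex x1; lra.
  have := competitor_mono_left e0 C ez (le_trans zx x1).
  by have := competitor_mono e0 C ez zx x1; lra.
have ac1 : ac eps x r G by exact: ac_sub Hac.
have ac0 : ac eps x r (fun=> 0).
  split; first exact: segint_cst.
  move=> a b ea ab bx; rewrite seg_cst// mul0r !rz ?subrr//; lra.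
have [N [mN N0 HN]] := ae_null_set (ac_ae_eq ac1 ac0).
have sub : `]eps, x[ `<=` N.
  move=> z /=; rewrite in_itv/= => ez; apply: contrapT => /HN /(_ ez) Gz.
  by have := G0 z ltac:(lra); rewrite Gz ltxx.
have : (mu `]eps, x[ <= mu N)%E by apply: le_measure; rewrite ?inE.
rewrite N0 lebesgue_measure_itv/= lte_fin ex -EFinB lee_fin; lra.
Qed.

End Competitors.

(** * Measurability and integrability of the energy density *)

Section Density.
Context {R : realType} (kappa : R) (h : R -> R) (m : nat).
Hypothesis kappa_gt0 : 0 < kappa.
Hypothesis hh : volumetric_energy h.
Hypothesis m_gt0 : (0 < m)%N.
Notation mu := (@lebesgue_measure R).
Implicit Types (a b x y z eps lambda : R) (f g r G : R -> R).

Definition ratioU r x := (r x / x) ^+ m.+1.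
Definition detD r G x := G x * (r x / x) ^+ m.
Definition density r G x := x ^+ m * Psi kappa h m (detD r G x) (ratioU r x).

Lemma ratioU_gt0 r x : 0 < x -> 0 < r x -> 0 < ratioU r x.
Proof. by move=> x0 rx; rewrite exprn_gt0// divr_gt0. Qed.

Lemma detD_gt0 lambda eps r G x : 0 <= eps -> competitor lambda eps r G ->
  eps < x -> x <= 1 -> 0 < detD r G x.
Proof.
move=> e0 C ex x1; have rx := competitor_gt0 e0 C ex x1.
case: C => _ _ _ G0; have x0 : 0 < x by lra.
by rewrite mulr_gt0 ?G0// exprn_gt0// divr_gt0.
Qed.

Lemma density_measurable lambda eps r G : 0 <= eps -> eps < 1 -> competitor lambda eps r G ->
  measurable_fun `]eps, 1[ (density r G).
Proof.
move=> e0 e1 C; have [Hac _ _ _] := C.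
have sub : `]eps, 1[ `<=` `[eps, 1] by exact: subset_itv_oo_cc.
have mr : measurable_fun `]eps, 1[ r.
  apply: measurable_funS sub _ => //; apply: measurable_realfun.subspace_continuous_measurable_fun => //.
  exact: ac_cont (ltW e1) Hac.
have mG : measurable_fun `]eps, 1[ G.
  by have [/integrableP[/measurable_EFinP mG _] _] := Hac; exact: measurable_funS mG.
have mi : measurable_fun `]eps, 1[ (fun x : R => x^-1).
  apply: open_continuous_measurable_fun => // x; rewrite inE/= in_itv/= => /andP[ex _].
  apply: inv_continuous; rewrite gt_eqF//; lra.
have mq : measurable_fun `]eps, 1[ (fun x => r x / x) by exact: measurable_funM.
have md : measurable_fun `]eps, 1[ (detD r G).
  by apply: measurable_funM => //; exact: measurable_funX.
have mU : measurable_fun `]eps, 1[ (ratioU r) by exact: measurable_funX.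
have min0 : measurable_fun (`]0, +oo[%classic : set R) (fun x : R => x^-1).
  apply: open_continuous_measurable_fun => // x; rewrite inE/= in_itv/= andbT => x0.
  by apply: inv_continuous; rewrite gt_eqF.
have mh0 : measurable_fun (`]0, +oo[%classic : set R) h.
  apply: open_continuous_measurable_fun => // x; rewrite inE/= in_itv/= andbT => x0.
  exact: is_derive_cont (is_derive_h hh x0).
(* [h] is controlled on positive numbers only, so measurability is composed through the open
   half-line. *)
have mh : measurable_fun `]eps, 1[ (h \o detD r G).
  apply: (measurable_comp _ _ mh0 md) => // y [x /=]; rewrite !in_itv/= => /andP[ex x1] <-.
  by rewrite (detD_gt0 e0 C ex (ltW x1)).
have mUi : measurable_fun `]eps, 1[ ((fun x : R => x^-1) \o (fun x => ratioU r x ^+ m)).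
  apply: (measurable_comp _ _ min0) => //; last exact: measurable_funX.
  move=> y [x /=]; rewrite !in_itv/= => /andP[ex x1] <-.
  rewrite exprn_gt0// ratioU_gt0//; first lra.
  exact: (competitor_gt0 e0 C ex (ltW x1)).
have ml : measurable_fun `]eps, 1[ (@ln R \o ratioU r).
  exact: measurableT_comp (@measurable_ln R) mU.
apply: measurable_funM; first exact: measurable_funX.
apply: measurable_funD; first apply: measurable_funD => //.
  apply: measurable_funM => //; apply: measurable_funM => //; exact: measurable_funX.
apply: measurable_funM; first exact: measurable_funM.
exact: measurable_funD.
Qed.

Lemma density_ge lambda eps r G x : 0 <= eps -> competitor lambda eps r G ->
  eps < x -> x <= 1 -> - beta kappa m <= density r G x.
Proof.
move=> e0 C ex x1; have x0 : 0 < x by lra.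
have d0 := detD_gt0 e0 C ex x1; have u0 := ratioU_gt0 x0 (competitor_gt0 e0 C ex x1).
have := Psi_ge_Nbeta kappa_gt0 hh m_gt0 d0 u0.
have b0 := beta_gt0 kappa_gt0 m_gt0.
have xm0 : 0 <= x ^+ m by rewrite exprn_ge0// ltW.
have xm1 : x ^+ m <= 1 by rewrite exprn_ile1// ltW.
move=> /(ler_wpM2l xm0) H; apply: le_trans H; nra.
Qed.

(* Negative parts being bounded, a finite upper bound on the integral forces integrability. *)
Lemma integrable_of_bound a b f c M : measurable_fun `]a, b[ f ->
  (forall x, a < x < b -> - c <= f x) -> 0 <= c ->
  (\int[mu]_(x in `]a, b[) (f x)%:E <= M%:E)%E -> segint a b f.
Proof.
move=> mf fc c0 fM; apply/segint_oo/integrableP; split; first exact/measurable_EFinP.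
have mD : measurable (`]a, b[%classic : set R) by [].
have mfE : measurable_fun `]a, b[ (EFin \o f) by exact/measurable_EFinP.
have neg_fin : (\int[mu]_(x in `]a, b[) ((EFin \o f)^\- x) < +oo)%E.
  apply: (@le_lt_trans _ _ (\int[mu]_(x in `]a, b[) (cst c%:E x))%E).
    apply: ge0_le_integral => //; first exact: measurable_funeneg.
    move=> x /=; rewrite in_itv/= => /fc H.
    by rewrite funenegE ge_max /= !lee_fin c0 andbT lerNl.
  rewrite integral_cst//= -ge0_fin_numE; last first.
    by apply: mule_ge0 => //; rewrite lee_fin.
  apply: fin_numM => //; rewrite lebesgue_measure_itv/=; by case: ifP.
have -> : (fun x => `|(EFin \o f) x|%E) = ((EFin \o f)^\+ \+ (EFin \o f)^\-)%E.
  by rewrite -fune_abse.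
rewrite ge0_integralD//; last 2 first.
- exact: measurable_funepos.
- exact: measurable_funeneg.
apply: lte_add_pinfty => //.
move: neg_fin fM; rewrite [X in (X <= _)%E]integralE.
have p0 : (0 <= \int[mu]_(x in `]a, b[) ((EFin \o f)^\+ x))%E by apply: integral_ge0.
have n0 : (0 <= \int[mu]_(x in `]a, b[) ((EFin \o f)^\- x))%E by apply: integral_ge0.
move: p0 n0; move: (\int[mu]_(x in `]a, b[) ((EFin \o f)^\+ x))%E (\int[mu]_(x in `]a, b[) ((EFin \o f)^\- x))%E.
by move=> [u| |] [v| |]//= *; exact: ltry.
Qed.

End Density.

(** * Excess energy and extremals of a calibration *)

Section Calibrated.
Context {R : realType} (kappa : R) (h : R -> R) (m : nat) (W T D : R -> R) (lambda : R).
Hypothesis kappa_gt0 : 0 < kappa.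
Hypothesis hh : volumetric_energy h.
Hypothesis m_gt0 : (0 < m)%N.
Hypothesis cal : calibration kappa h m W T D.
Hypothesis lambda_gt0 : 0 < lambda.
Notation mu := (@lebesgue_measure R).
Notation beta := (beta kappa m).
Notation density := (density kappa h m).
Notation ratioU := (ratioU m).
Notation detD := (detD m).
Implicit Types (a b x y z eps : R) (f g r G : R -> R).
Let beta0 : 0 < beta := beta_gt0 kappa_gt0 m_gt0.

Definition null_density r G x : R :=
  x ^+ m * (W (ratioU r x) + T (ratioU r x) * (detD r G x - ratioU r x)).
Definition excess r G x : R := density r G x - null_density r G x.
(** The outer boundary value of the primitive of [null_density], common to all competitors with the
    same [lambda]. *)
Definition value : R := W (lambda ^+ m.+1) / m.+1%:R.

Lemma ac_ratioU eps a r G : 0 < a -> eps <= a -> a <= 1 -> ac eps 1 r G ->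
  ac a 1 (ratioU r) (fun x => m.+1%:R * (detD r G x - ratioU r x) / x).
Proof.
move=> a0 ea a1 Hac; have ac1 : ac a 1 r G by exact: ac_sub Hac.
have w'c : continuous (fun u : R => m.+1%:R * u ^+ m).
  by move=> u; apply: cvgM; [exact: cvg_cst|exact: exprn_continuous].
have P := ac_comp (fun u : R => is_derive_exprn m.+1 u) w'c ac1.
have Q : ac a 1 (fun x => (x ^+ m.+1)^-1) (fun x => - (m.+1%:R * (x ^+ m.+1)^-1 / x)).
  have ci k : {within `[a, 1], continuous (fun x : R => (x ^+ k)^-1)}.
    apply: continuous_in_subspaceT => x; rewrite inE/= in_itv/= => /andP[ax _].
    apply: is_derive_cont; apply: is_derive_exprVn; rewrite gt_eqF//; lra.
  apply: ac_C1 => //; first by move=> x ax; apply: is_derive_exprVn; rewrite gt_eqF//; lra.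
  apply: continuous_in_subspaceT => x; rewrite inE/= in_itv/= => /andP[ax _].
  have x0 : x != 0 by rewrite gt_eqF//; lra.
  apply: cvgN; apply: cvgM; last exact: inv_continuous.
  apply: cvgM; first exact: cvg_cst.
  exact: is_derive_cont (is_derive_exprVn m.+1 x0).
apply: ac_eq (acM P Q) => x ax _; have x0 : x != 0 by rewrite gt_eqF//; lra.
  by rewrite /ratioU expr_div_n.
rewrite /ratioU /detD !expr_div_n !(exprS _ m).
have : x ^+ m != 0 by rewrite expf_neq0.
move: (x ^+ m) (r x ^+ m) (m.+1%:R : R) => X V N X0; field.
by rewrite X0 x0.
Qed.

Lemma null_density_ac eps a r G : 0 < a -> eps <= a -> a <= 1 -> ac eps 1 r G ->
  ac a 1 (fun x => x ^+ m.+1 * W (ratioU r x)) (fun x => m.+1%:R * null_density r G x).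
Proof.
move=> a0 ea a1 Hac.
have P := ac_comp (cal_derive cal) (cal_cont cal) (ac_ratioU a0 ea a1 Hac).
have Q : ac a 1 (fun x => x ^+ m.+1) (fun x => m.+1%:R * x ^+ m).
  apply: ac_C1 => [x _||].
  - exact: is_derive_exprn.
  - by apply: continuous_subspaceT; exact: exprn_continuous.
  - apply: continuous_subspaceT => u; apply: cvgM; [exact: cvg_cst|exact: exprn_continuous].
apply: ac_eq (acM Q P) => x ax _ //; have x0 : x != 0 by rewrite gt_eqF//; lra.
rewrite /null_density exprS.
move: (x ^+ m) (detD _ _ _) (ratioU r x) (m.+1%:R : R) => X d U N; field.
exact: x0.
Qed.

Lemma null_density_integral eps a r G : 0 < a -> eps <= a -> a <= 1 ->
  competitor lambda eps r G ->
  segint a 1 (null_density r G) /\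
  seg a 1 (null_density r G) = value - a ^+ m.+1 * W (ratioU r a) / m.+1%:R.
Proof.
move=> a0 ea a1 [Hac r1 _ _]; have [i E] := null_density_ac a0 ea a1 Hac.
have n0 : m.+1%:R != 0 :> R by rewrite pnatr_eq0.
have i' : segint a 1 (null_density r G).
  by apply: segint_eq (segintZ (m.+1%:R^-1) i) => x _ _; rewrite mulKf.
split => //; have := E a 1 (lexx _) a1 (lexx _); rewrite segZ// expr1n mul1r {1}/ratioU r1 divr1.
rewrite /value => /(congr1 (fun t => t / m.+1%:R)); rewrite [m.+1%:R * _]mulrC mulfK// => <-.
by rewrite mulrBl.
Qed.

Lemma excess_ge eps r G x : 0 <= eps -> competitor lambda eps r G -> eps < x -> x <= 1 ->
  x ^+ m * bregman h (detD r G x) (D (ratioU r x)) <= excess r G x.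
Proof.
move=> e0 C ex x1; have x0 : 0 < x by lra.
have d0 := detD_gt0 m e0 C ex x1; have u0 := ratioU_gt0 m x0 (competitor_gt0 e0 C ex x1).
have xm : 0 <= x ^+ m by rewrite exprn_ge0// ltW.
have := ler_wpM2l xm (cal_ge cal d0 u0).
by rewrite /excess /density /null_density; lra.
Qed.

Lemma excess_ge0 eps r G x : 0 <= eps -> competitor lambda eps r G -> eps < x -> x <= 1 ->
  0 <= excess r G x.
Proof.
move=> e0 C ex x1; apply: le_trans (excess_ge e0 C ex x1).
have x0 : 0 < x by lra.
have d0 := detD_gt0 m e0 C ex x1; have B := bregman_ge0 hh d0 (cal_D_gt0 cal (ratioU r x)).
by rewrite mulr_ge0// exprn_ge0// ltW.
Qed.

(** Sublinearity bounds the boundary term by a small multiple of [r a ^+ m.+1], itself at most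
    [lambda ^+ m.+1], plus a constant times [a ^+ m.+1]. The threshold depends neither on [eps] nor
    on the map. *)
Lemma inner_value_small e : 0 < e -> exists2 a0, 0 < a0 & forall eps r G a,
  0 <= eps -> competitor lambda eps r G -> eps < a -> a <= a0 -> a <= 1 ->
  `|a ^+ m.+1 * W (ratioU r a) / m.+1%:R| <= e.
Proof.
move=> e0; have l0 : 0 < lambda ^+ m.+1 by rewrite exprn_gt0.
have n1 : 1 <= m.+1%:R :> R by rewrite ler1n.
pose e1 := e / 2 / lambda ^+ m.+1; have e10 : 0 < e1 by rewrite !divr_gt0.
have [C HC] := cal_small cal e10.
pose C' := Num.max C 0 + 1.
have C'0 : 0 < C' by rewrite /C' ltr_wpDl// le_max lexx orbT.
have CC : C <= C'.
  by apply: le_trans (_ : Num.max C 0 <= _); [rewrite le_max lexx|rewrite lerDl].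
exists (e / 2 / C'); first by rewrite !divr_gt0.
move=> eps r G a eps0 Cr ea aa0 a1; have a0 : 0 < a by lra.
have ra := competitor_gt0 eps0 Cr ea a1.
have ral : r a <= lambda.
  by have [_ <- _ _] := Cr; exact: competitor_mono eps0 Cr ea a1 (lexx _).
have U0 := ratioU_gt0 m a0 ra.
have an0 : 0 < a ^+ m.+1 by rewrite exprn_gt0.
have an1 : a ^+ m.+1 <= a by rewrite exprS ler_piMr ?exprn_ile1// ltW.
rewrite normrM [`|m.+1%:R^-1|]gtr0_norm ?invr_gt0 ?ltr0n// ler_pdivrMr ?ltr0n//.
apply: (@le_trans _ _ (e * 1)); last by rewrite ler_pM2l.
rewrite mulr1 normrM gtr0_norm//.
apply: (@le_trans _ _ (a ^+ m.+1 * (e1 * ratioU r a + C'))).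
  by rewrite ler_pM2l//; apply: le_trans (HC _ (ltW U0)) _; rewrite lerD2l.
have -> : a ^+ m.+1 * (e1 * ratioU r a + C') = e1 * r a ^+ m.+1 + a ^+ m.+1 * C'.
  rewrite /ratioU expr_div_n; field.
  by rewrite expf_neq0// gt_eqF.
have h1 : e1 * r a ^+ m.+1 <= e / 2.
  apply: (@le_trans _ _ (e1 * lambda ^+ m.+1)); last by rewrite /e1 divfK// gt_eqF.
  by rewrite ler_pM2l// lerXn2r ?nnegrE// ltW.
have h2 : a ^+ m.+1 * C' <= e / 2.
  by rewrite -ler_pdivlMr//; exact: le_trans aa0.
lra.
Qed.

(* The energy in excess of [value] controls the integral of the excess up to the
   contribution of the inner end point, which the sublinearity of [W] makes small. *)
Lemma excess_integral_le e : 0 < e -> exists2 a0, 0 < a0 & forall eps r G a,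
  0 <= eps -> eps < a0 -> competitor lambda eps r G -> segint eps 1 (density r G) ->
  eps < a -> a < 1 ->
  segint a 1 (excess r G) /\
  seg a 1 (excess r G) <= seg eps 1 (density r G) - value + e.
Proof.
move=> e0; have e20 : 0 < e / 2 by rewrite divr_gt0.
have [a1 a10 H1] := inner_value_small e20.
pose a0 := Num.min a1 (e / 2 / beta).
have a00 : 0 < a0 by rewrite lt_min a10 divr_gt0.
exists a0 => // eps r G a eps0 ea0 C ei ea a_1.
have step b : eps < b -> b <= a -> segint b 1 (excess r G) /\
    seg b 1 (excess r G) <= seg eps 1 (density r G) - value + beta * b +
       b ^+ m.+1 * W (ratioU r b) / m.+1%:R.
  move=> eb ba; have b0 : 0 < b by lra.
  have b1 : b <= 1 by lra.
  have [i1 E1] := null_density_integral b0 (ltW eb) b1 C.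
  have i2 : segint b 1 (density r G) := segintS (ltW eb) (lexx _) ei.
  have i3 : segint eps b (density r G) := segintS (lexx _) b1 ei.
  split; first exact: segintB.
  rewrite /excess segB// E1 (seg_add ei (ltW eb) b1).
  (* The discarded piece next to [eps] is not of definite sign, but it contributes at least
     [- beta * (b - eps)]. *)
  have : seg eps b (fun=> - beta) <= seg eps b (density r G).
    apply: seg_le_oo => // [|x /andP[ex xb]]; first exact: segint_cst.
    by apply: (density_ge kappa_gt0 hh m_gt0 eps0 C ex); lra.
  rewrite seg_cst ?(ltW eb)//; have : 0 <= beta * eps by rewrite mulr_ge0// ltW.
  by move: (b ^+ m.+1 * _ / _) => Q; lra.
(* Excess being nonnegative, the integral from [a] is estimated by the one from a point [b] close
   enough to the centre for both boundary errors to be at most [e / 2]. *)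
pose b := Num.min a ((a0 + eps) / 2).
have ba : b <= a by rewrite /b ge_min lexx.
have eb : eps < b by rewrite lt_min ea; lra.
have b0 : 0 < b by lra.
have ba0 : b <= a0 by rewrite ge_min; apply/orP; right; lra.
have ba1 : b <= a1 by apply: le_trans ba0 _; rewrite ge_min lexx.
have bb : b * beta <= e / 2.
  by rewrite -ler_pdivlMr//; apply: le_trans ba0 _; rewrite ge_min lexx orbT.
have b1 : b <= 1 by lra.
have [ia Ea] := step a ea (lexx _); have [ib Eb] := step b eb ba.
split => //.
have := H1 eps r G b eps0 C eb ba1 b1; rewrite ler_norml => /andP[_ H2].
have : seg a 1 (excess r G) <= seg b 1 (excess r G).
  rewrite (seg_add ib ba (ltW a_1)) lerDr; apply: seg_ge0 => x bx xa.
  by apply: (excess_ge0 eps0 C); lra.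
by move: (b ^+ m.+1 * _ / _) H2 Eb => Q; lra.
Qed.

(** A competitor that follows the slope [D] through values of [U] where the calibration is exact, so
    that its excess vanishes. *)
Record extremal r G : Prop := Extremal {
  extremal_competitor : competitor lambda 0 r G;
  extremal_det : forall x, 0 < x -> x <= 1 -> detD r G x = D (ratioU r x);
  extremal_eq : forall x, 0 < x -> x <= 1 ->
    W (ratioU r x) + T (ratioU r x) * (D (ratioU r x) - ratioU r x) =
    Psi kappa h m (D (ratioU r x)) (ratioU r x) }.

Section Extremal.
Variables (rh drh : R -> R).
Hypothesis ext : extremal rh drh.

Lemma extremal_density x : 0 < x -> x <= 1 -> density rh drh x = null_density rh drh x.
Proof.
by move=> x0 x1; rewrite /density /null_density (extremal_det ext)// (extremal_eq ext).
Qed.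

Lemma extremal_restrict eps : 0 <= eps -> eps < 1 -> competitor lambda eps rh drh.
Proof.
move=> e0 e1; have [Hac r1 r0 G0] := extremal_competitor ext.
split => //; first exact: ac_sub Hac.
move: e0; rewrite le_eqVlt => /predU1P[<-//|e0].
by apply/ltW; apply: competitor_gt0 (lexx 0) (extremal_competitor ext) e0 (ltW e1).
Qed.

Lemma extremal_segint a : 0 < a -> a <= 1 -> segint a 1 (density rh drh) /\
  seg a 1 (density rh drh) = value - a ^+ m.+1 * W (ratioU rh a) / m.+1%:R.
Proof.
move=> a0 a1.
have [i E] := null_density_integral a0 (ltW a0) a1 (extremal_competitor ext).
have H x : a <= x -> x <= 1 -> null_density rh drh x = density rh drh x.
  by move=> ax x1; rewrite extremal_density//; lra.
split; first exact: segint_eq H i.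
by rewrite -E; apply: seg_eq => x ax x1; rewrite H.
Qed.

Lemma extremal_energy_eps e : 0 < e -> exists2 a0, 0 < a0 & forall eps,
  0 < eps -> eps < a0 -> eps < 1 ->
  (\int[mu]_(x in `]eps, 1%R[) (density rh drh x)%:E <= (value + e)%:E)%E.
Proof.
move=> e0; have [a0 a00 H] := inner_value_small e0.
exists a0 => // eps eps0 ea e1; have [i E] := extremal_segint eps0 (ltW e1).
have [/integrableP[md _]] := conj i I.
rewrite -[X in (X <= _)%E]fineK; last first.
  by apply: integrable_fin_num => //; exact/segint_oo.
rewrite lee_fin -/(Rintegral _ _ _) seg_oo// E.
have := H 0 rh drh eps (lexx _) (extremal_competitor ext) eps0 (ltW ea) (ltW e1).
by rewrite ler_norml; move: (_ * _ / _) => Q; lra.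
Qed.

Lemma extremal_energy0 :
  (\int[mu]_(x in `]0%R, 1%R[) (density rh drh x)%:E <= value%:E)%E.
Proof.
(* Shifted to be nonnegative, the density can be integrated up to the centre by monotone convergence
   over the intervals starting at [a k]; [k.+2] keeps [a k] below 1. *)
pose f x := density rh drh x + beta.
pose a (k : nat) : R := k.+2%:R^-1.
have a0 k : 0 < a k by rewrite invr_gt0.
have a1 k : a k < 1 by rewrite invf_lt1// ltr1n.
have EC := extremal_competitor ext.
have md : measurable_fun (`]0, 1[%classic : set R) (density rh drh).
  exact: density_measurable (lexx 0) ltr01 EC.
have mf : measurable_fun (`]0, 1[%classic : set R) (EFin \o f).
  by apply/measurable_EFinP; apply: measurable_funD.
have f0 x : `]0, 1[%classic x -> (0 <= (EFin \o f) x)%E.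
  move=> /=; rewrite in_itv/= lee_fin /f => /andP[x0 x1].
  have := density_ge kappa_gt0 hh m_gt0 (lexx 0) EC x0 (ltW x1); lra.
pose F k := `]a k, 1[%classic : set R.
have FU : \bigcup_k F k = `]0, 1[%classic.
  apply/seteqP; split=> [x [k _] /=|x /=]; rewrite /F/= !in_itv/=.
    by move=> /andP[ax ->]; rewrite (lt_trans (a0 k) ax).
  move=> /andP[x0 x1]; exists (Num.bound x^-1) => //=.
  rewrite in_itv/= x1 andbT /a invf_plt ?posrE//.
  have := archi_boundP (ltW (_ : 0 < x^-1)); rewrite invr_gt0 => /(_ x0) H.
  apply: lt_le_trans H _; rewrite ler_nat; exact: leqW.
have Fsub k : F k `<=` `]0, 1[ by rewrite -FU => x Fx; exists k.
have bound e : 0 < e -> (\int[mu]_(x in `]0%R, 1%R[) (EFin \o f) x <= (value + beta + e)%:E)%E.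
  move=> e0; have [b b0 H] := inner_value_small e0.
  have Ic : (\int[mu]_(x in F k) (EFin \o f) x)%E @[k --> \oo] -->
      (\int[mu]_(x in `]0%R, 1%R[) (EFin \o f) x)%E.
    rewrite -FU; apply: ge0_nondecreasing_set_cvg_integral.
    - move=> i j ij; apply/subsetPset/subset_itv; rewrite bnd_simp//.
      by rewrite lef_pV2 ?posrE// ler_nat.
    - by move=> i; exact: measurable_itv.
    - by move=> i; exact: measurable_funS mf.
    - by move=> i x Fx; apply: f0; exact: Fsub Fx.
  rewrite -(cvg_lim _ Ic)//; apply: lime_le; first by apply/cvg_ex; eexists; exact: Ic.
  near=> k.
  have ak : a k <= b.
    have : b^-1 < k%:R by near: k; exact: nbhs_infty_gtr.
    rewrite /a invf_ple ?posrE// => /ltW bk; apply: le_trans bk _.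
    by rewrite ler_nat; exact/leqW/leqW.
  have [i E] := extremal_segint (a0 k) (ltW (a1 k)).
  have i' : segint (a k) 1 f by apply: segintD => //; exact: segint_cst.
  rewrite /F -[X in (X <= _)%E]fineK; last first.
    by apply: integrable_fin_num => //; exact/segint_oo.
  rewrite lee_fin -/(Rintegral _ _ _) seg_oo// /f segD//; last exact: segint_cst.
  rewrite E seg_cst ?(ltW (a1 k))//.
  have := H 0 rh drh (a k) (lexx _) EC (a0 k) ak (ltW (a1 k)).
  rewrite ler_norml; have := mulr_gt0 beta0 (a0 k); move: (a k ^+ m.+1 * _ / _) => Q; lra.
have fle : (\int[mu]_(x in `]0%R, 1%R[) (EFin \o f) x <= (value + beta)%:E)%E.
  by apply/lee_addgt0Pr => e e0; rewrite -EFinD; exact: bound.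
have fi : segint 0 1 f.
  apply: (@integrable_of_bound _ 0 1 f 0 (value + beta)) => //; first exact/measurable_EFinP.
  by move=> x x01; rewrite oppr0 -lee_fin; apply: f0 => /=; rewrite in_itv.
have di : segint 0 1 (density rh drh).
  by apply: segint_eq (segintB fi (segint_cst _ _ beta)) => x _ _; rewrite /f addrK.
rewrite -[X in (X <= _)%E]fineK; last first.
  by apply: integrable_fin_num => //; exact/segint_oo.
rewrite lee_fin -/(Rintegral _ _ _) seg_oo//.
have : seg 0 1 f <= value + beta.
  rewrite -seg_oo// -lee_fin fineK//; apply: integrable_fin_num => //; exact/segint_oo.
by rewrite /f segD ?seg_cst//; [lra|exact: segint_cst].
Unshelve. all: by end_near. Qed.

End Extremal.
End Calibrated.

(** A weighted maximum replaces iteration: with weight [expR (2 * K * y)], the integral term at the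
    maximum point is at most half of the left-hand side and can be absorbed. This is the source of
    both factors 2. *)
Lemma gronwall {R : realType} (v : R -> R) (a b A K : R) : 0 <= a -> a <= b -> 0 < K ->
  {within `[a, b], continuous v} ->
  (forall x, a <= x -> x <= b -> `|v x| <= A + K * seg x b (fun y => `|v y|)) ->
  forall x, a <= x -> x <= b -> `|v x| <= 2 * A * expR (2 * K * b).
Proof.
move=> a0 ab K0 cv H x ax xb.
pose e (y : R) := expR (2 * K * y).
have e0 y : 0 < e y by exact: expR_gt0.
have ce : continuous e.
  move=> y; apply: (@cvg_comp _ _ _ (fun y => 2 * K * y) (@expR R) _ (nbhs (2 * K * y))).
    by apply: cvgM; [exact: cvg_cst|exact: cvg_id].
  exact: continuous_expR.
have cn : {within `[a, b], continuous (fun y => `|v y|)}.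
  by move=> y; apply: cvg_norm; exact: cv.
have cphi : {within `[a, b], continuous (fun y => `|v y| * e y)}.
  move=> y; apply: cvgM; first exact: cn.
  by apply: continuous_subspaceT => z; exact: ce.
have [c cin Hc] := EVT_max ab cphi.
move: cin; rewrite in_itv/= => /andP[lac cb].
set M := `|v c| * e c in Hc.
have HM y : a <= y -> y <= b -> `|v y| <= M * (e y)^-1.
  by move=> ay yb; rewrite ler_pdivlMr//; apply: Hc; rewrite in_itv/= ay.
pose F y := - (2 * K)^-1 * M * (e y)^-1.
have acF : ac c b F (fun y => M * (e y)^-1).
  have cei : continuous (fun y => (e y)^-1).
    by move=> y; apply: cvgV; [rewrite gt_eqF|exact: ce].
  apply: ac_C1.
  - move=> y _.
    have d1 : is_derive y (1 : R) (fun y => - (2 * K) * y) (- (2 * K)).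
      by apply: is_derive_eq; rewrite /GRing.scale/=; ring.
    have d2 : is_derive y (1 : R) (fun y => expR (- (2 * K) * y)) _ :=
      @is_derive1_comp _ (@expR R) (fun y => - (2 * K) * y) y _ _ (is_derive_expR _) d1.
    have -> : F = fun y => - (2 * K)^-1 * M * expR (- (2 * K) * y).
      by apply/funext => z; rewrite /F /e [- _ * z]mulNr expRN.
    apply: is_derive_eq; rewrite /GRing.scale/= /e.
    have -> : (expR (2 * K * y))^-1 = expR (- (2 * K) * y) by rewrite mulNr expRN.
    by move: (expR _) => E; field; rewrite gt_eqF.
  - by apply: continuous_subspaceT => y; apply: cvgM; [exact: cvg_cst|exact: cei].
  - by apply: continuous_subspaceT => y; apply: cvgM; [exact: cvg_cst|exact: cei].
have [iF EF] := acF.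
have vi : segint c b (fun y => `|v y|) := segintS lac (lexx _) (segint_cont cn).
have M0 : 0 <= M by rewrite mulr_ge0// ltW.
have S : seg c b (fun y => `|v y|) <= (2 * K)^-1 * M * (e c)^-1.
  apply: (@le_trans _ _ (seg c b (fun y => M * (e y)^-1))).
    by apply: seg_le => // y cy yb; apply: HM => //; exact: le_trans cy.
  have nn : 0 <= (2 * K)^-1 * M * (e b)^-1.
    have K20 : 0 <= (2 * K)^-1 by rewrite invr_ge0 mulr_ge0// ltW.
    have eb0 : 0 <= (e b)^-1 by rewrite invr_ge0 ltW.
    by apply: mulr_ge0 => //; exact: mulr_ge0.
  by rewrite -EF// /F !mulNr; lra.
(* At the maximum point [c], [M / e c] is the absolute value of [v c], and half of it is the bound
   on the integral term. *)
have MA : M <= 2 * A * e c.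
  have := H c lac cb; have := ler_wpM2l (ltW K0) S.
  rewrite (_ : K * ((2 * K)^-1 * M * (e c)^-1) = M / 2 * (e c)^-1); last first.
    by field; rewrite !gt_eqF.
  move=> h1 h2; have := le_trans h2 (lerD (lexx A) h1).
  rewrite -(ler_pM2r (e0 c)) -/M mulrDl divfK ?gt_eqF//; lra.
have A0 : 0 <= A by have := le_trans M0 MA; rewrite pmulr_lge0//; lra.
have eb : e c <= e b by rewrite ler_expR ler_pM2l// mulr_gt0.
apply: (@le_trans _ _ M).
  apply: le_trans (Hc x _); last by rewrite in_itv/= ax.
  rewrite ler_peMr// -expR0 ler_expR !mulr_ge0//; [exact: ltW|exact: le_trans ax].
by apply: le_trans MA _; rewrite ler_wpM2l// mulr_ge0.
Qed.

(** * Maps of small excess are close to the extremal *)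

Section Stability.
Context {R : realType} (kappa : R) (h : R -> R) (m : nat) (W T D : R -> R) (lambda : R).
Hypothesis kappa_gt0 : 0 < kappa.
Hypothesis hh : volumetric_energy h.
Hypothesis m_gt0 : (0 < m)%N.
Hypothesis cal : calibration kappa h m W T D.
Hypothesis lambda_gt0 : 0 < lambda.
Notation excess := (excess kappa h m W T).
Notation ratioU := (ratioU m).
Notation detD := (detD m).
Implicit Types (a b x y z eps : R) (f g r G : R -> R).
Variables (rh drh : R -> R).
Hypothesis ext : extremal kappa h m W T D lambda rh drh.

Lemma ac_exprn k a b f g : ac a b f g ->
  ac a b (fun x => f x ^+ k.+1) (fun x => k.+1%:R * (f x ^+ k * g x)).
Proof.
move=> H; have w'c : continuous (fun u : R => k.+1%:R * u ^+ k).
  by move=> u; apply: cvgM; [exact: cvg_cst|exact: exprn_continuous].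
by apply: ac_eq (ac_comp (fun u : R => is_derive_exprn k.+1 u) w'c H) => x _ _ //=; rewrite mulrA.
Qed.

(** The n-th power of a radius has derivative [n * z ^+ m] times the determinant, so in these
    variables the extremal equation is compared without dividing by a power of the radius. *)
Lemma dist_ac eps r G x y : 0 <= eps -> competitor lambda eps r G ->
  eps < x -> x <= y -> y <= 1 ->
  segint x y (fun z => m.+1%:R * (z ^+ m * (detD r G z - D (ratioU rh z)))) /\
  (r y ^+ m.+1 - rh y ^+ m.+1) - (r x ^+ m.+1 - rh x ^+ m.+1) =
   seg x y (fun z => m.+1%:R * (z ^+ m * (detD r G z - D (ratioU rh z)))).
Proof.
move=> e0 [Hac _ _ _] ex xy y1; have x0 : 0 < x by lra.
have [Hac' _ _ _] := extremal_competitor ext.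
have P := ac_exprn m (ac_sub (ltW ex) y1 Hac).
have Q := acZ (-1) (ac_exprn m (ac_sub (ltW x0) y1 Hac')).
suff [i E] : ac x y (fun x => r x ^+ m.+1 - rh x ^+ m.+1)
    (fun z => m.+1%:R * (z ^+ m * (detD r G z - D (ratioU rh z)))) by split; last exact: E.
apply: ac_eq (acD P Q) => z xz zy; first by rewrite mulN1r.
have z0 : 0 < z by lra.
rewrite -(extremal_det ext)//; last by lra.
rewrite /detD !expr_div_n; have : z ^+ m != 0 by rewrite expf_neq0// gt_eqF.
by move: (z ^+ m) (r z ^+ m) (rh z ^+ m) => Z A B Z0; field.
Qed.

(* Away from the centre Gronwall's inequality applies, [D] being locally Lipschitz; on the
   remaining small ball both curves have small volume increments because [D] is bounded. *)
Lemma stability delta : 0 < delta -> exists2 eta, 0 < eta & exists2 e0, 0 < e0 &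
  forall eps r G, 0 <= eps -> eps < e0 -> competitor lambda eps r G ->
  (forall a, eps < a -> a < 1 -> segint a 1 (excess r G) /\ seg a 1 (excess r G) <= eta) ->
  forall x, eps <= x -> x <= 1 -> `|r x ^+ m.+1 - rh x ^+ m.+1| <= delta.
Proof.
move=> de0; have d4 : delta / 4 <= delta by lra.
pose n : R := m.+1%:R; have n0 : 0 < n by rewrite ltr0n.
have [M' HM'] := cal_D_le cal; pose M := Num.max M' 1.
have M0 : 0 < M by rewrite lt_max ltr01 orbT.
have HM u : D u <= M by rewrite le_max HM'.
(* On the ball of radius [R0] the target slopes, bounded by [M], change the n-th powers by at most
   [n * M * R0], kept below [delta / 4]. *)
pose R0 := Num.min (2^-1) (delta / 4 / (n * M)).
have R00 : 0 < R0 by rewrite lt_min invr_gt0 ltr0n /= !divr_gt0// mulr_gt0.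
have R01 : R0 < 1 by rewrite gt_min; apply/orP; left; lra.
have R0d : n * M * R0 <= delta / 4.
  by rewrite mulrC -ler_pdivlMr ?mulr_gt0// ge_min lexx orbT.
(* Outside radius [R0] every competitor has [U] below this bound, because it is increasing with
   boundary value [lambda]. *)
have [L L0 HL] := cal_D_lip cal (lambda ^+ m.+1 / R0 ^+ m.+1).
pose K := n * L / R0; have K0 : 0 < K by rewrite divr_gt0// mulr_gt0.
(* The exponential cancels the Gronwall factor on the unit interval, leaving [delta / 4]. *)
pose A := delta / 8 * expR (- (2 * K)).
have A0 : 0 < A by rewrite mulr_gt0 ?expR_gt0 ?divr_gt0.
have A8 : A <= delta / 8.
  rewrite /A ler_piMr//; first by rewrite ltW ?divr_gt0.
  by rewrite -expR0 ler_expR oppr_le0 mulr_ge0// ltW.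
have An0 : 0 < A / 2 / n by rewrite !divr_gt0.
have [C C0 HC] := bregman_coercive hh M0 An0.
(* With this [eta], the offset in [bregman_coercive] and the excess term each contribute at most
   [A / 2] after multiplication by [n]. *)
have q0 : 0 < A / 2 / (n * C) by rewrite !divr_gt0// mulr_gt0.
exists (A / 2 / (n * C)) => //.
exists R0 => // eps r G eps0 eR Cr Hex.
pose v x := r x ^+ m.+1 - rh x ^+ m.+1.
have Ch := extremal_competitor ext.
have point z : eps < z -> z <= 1 ->
    z ^+ m * `|detD r G z - D (ratioU r z)| <= A / 2 / n + C * excess r G z.
  move=> ez z1; have z0 : 0 < z := le_lt_trans eps0 ez.
  have zm0 : 0 <= z ^+ m by rewrite exprn_ge0// ltW.
  have zm1 : z ^+ m <= 1 by rewrite exprn_ile1// ltW.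
  have H1 := HC _ _ (detD_gt0 m eps0 Cr ez z1) (cal_D_gt0 cal (ratioU r z)) (HM _).
  apply: le_trans (ler_wpM2l zm0 H1) _; rewrite mulrDr; apply: lerD.
    by rewrite ler_piMl// ltW.
  rewrite mulrCA ler_pM2l//; exact: (excess_ge cal eps0 Cr).
have main x y c : eps < x -> x <= y -> y <= 1 -> segint x y c ->
    (forall z, x <= z -> z <= y -> z ^+ m * `|D (ratioU r z) - D (ratioU rh z)| <= c z) ->
    `|v x| <= `|v y| + A + n * seg x y c.
  move=> ex xy y1 ci Hc; have [i E] := dist_ac eps0 Cr ex xy y1.
  have x1 : x <= 1 := le_trans xy y1.
  have [exi exE] : segint x 1 (excess r G) /\ seg x 1 (excess r G) <= A / 2 / (n * C).
    move: x1; rewrite le_eqVlt => /predU1P[->|x_1]; last exact: Hex.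
    split; last by rewrite seg_xx ltW.
    (* At [x = 1] only integrability over a single point is required; it is inherited from an
       interval starting at the midpoint of [eps] and 1. *)
    have [e2 e3] := midf_lt (lt_le_trans ex (le_trans xy y1)).
    have [i1 _] := Hex _ e2 e3.
    by apply: segintS i1 => //; exact: ltW.
  have exi' : segint x y (excess r G) := segintS (lexx _) y1 exi.
  have exE' : seg x y (excess r G) <= A / 2 / (n * C).
    apply: le_trans exE; rewrite (seg_add exi xy y1) lerDl.
    by apply: seg_ge0 => z yz z1; apply: (excess_ge0 hh cal eps0 Cr) => //; exact: lt_le_trans ex (le_trans xy yz).
  have -> : v x = v y - seg x y (fun z => m.+1%:R * (z ^+ m * (detD r G z - D (ratioU rh z)))).
    by rewrite -E /v; ring.
  apply: le_trans (ler_normB _ _) _; rewrite -addrA lerD2l.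
  apply: le_trans (seg_norm i) _.
  apply: (@le_trans _ _ (seg x y (fun z => n * (A / 2 / n + C * excess r G z + c z)))).
    apply: seg_le => [||z xz zy].
    - exact: segint_norm.
    - by apply/segintZ/segintD => //; apply: segintD; [exact: segint_cst|exact: segintZ].
    have z0 : 0 < z := le_lt_trans eps0 (lt_le_trans ex xz).
    have zm0 : 0 <= z ^+ m by rewrite exprn_ge0// ltW.
    rewrite normrM normr_nat ler_pM2l// normrM [`|z ^+ m|]ger0_norm//.
    apply: le_trans (lerD (point z _ _) (Hc z xz zy)); [|exact: lt_le_trans xz|exact: le_trans y1].
    rewrite -mulrDr ler_wpM2l//; apply: le_trans (ler_normD _ _).
    by rewrite addrA subrK.
  rewrite segZ; last by apply: segintD => //; apply: segintD; [exact: segint_cst|exact: segintZ].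
  rewrite segD//; last by apply: segintD; [exact: segint_cst|exact: segintZ].
  rewrite segD; [|exact: segint_cst|exact: segintZ].
  rewrite seg_cst// segZ// mulrDr lerD2r.
  have : A / 2 / n * (y - x) <= A / 2 / n.
    rewrite ler_piMr//; first exact: ltW.
    by rewrite lerBlDr (le_trans y1)// lerDl (le_trans eps0)// ltW.
  have : C * seg x y (excess r G) <= A / 2 / n.
    apply: le_trans (ler_wpM2l (ltW C0) exE') _; rewrite le_eqVlt; apply/orP; left; apply/eqP.
    by field; rewrite !gt_eqF.
  move=> h1 h2; apply: (@le_trans _ _ (n * (A / 2 / n + A / 2 / n))); first by rewrite ler_pM2l//; exact: lerD h2 h1.
  rewrite le_eqVlt; apply/orP; left; apply/eqP; field; by rewrite gt_eqF.
have vc a : eps <= a -> a <= 1 -> {within `[a, 1], continuous v}.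
  move=> ea a1; have ce : continuous (fun u : R => u ^+ m.+1) by exact: exprn_continuous.
  have c1 := ac_cont a1 (ac_sub ea (lexx _) (let: And4 H _ _ _ := Cr in H)).
  have a0 : 0 <= a := le_trans eps0 ea.
  have c2 := ac_cont a1 (ac_sub a0 (lexx _) (let: And4 H _ _ _ := Ch in H)).
  have c1' := within_comp c1 ce; have c2' := within_comp c2 ce.
  by move=> z; apply: cvgB; [exact: c1'|exact: c2'].
have v1 : v 1 = 0 by rewrite /v; case: Cr Ch => _ -> _ _ [_ -> _ _]; rewrite subrr.
have outer x : R0 <= x -> x <= 1 -> `|v x| <= delta / 4.
  move=> Rx x1; have ac0 : 0 <= R0 := ltW R00.
  have -> : delta / 4 = 2 * A * expR (2 * K * 1).
    by rewrite /A mulr1 expRN; field; rewrite gt_eqF// expR_gt0.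
  apply: (gronwall ac0 (ltW R01) K0 (vc _ (ltW eR) (ltW R01))) => // {Rx x1}x Rx x1.
  have ex : eps < x := lt_le_trans eR Rx.
  have iv : segint x 1 (fun z => L / R0 * `|v z|).
    by apply/segintZ/segint_norm/segint_cont/vc => //; exact: ltW.
  apply: le_trans (main x 1 _ ex x1 (lexx _) iv _) _.
    move=> z xz z1; have Rz : R0 <= z := le_trans Rx xz.
    have z0 : 0 < z := lt_le_trans R00 Rz.
    have zn0 : 0 < z ^+ m.+1 by rewrite exprn_gt0.
    have bnd f g : competitor lambda eps f g -> ratioU f z <= lambda ^+ m.+1 / R0 ^+ m.+1.
      move=> Cf; have ez : eps < z := lt_le_trans ex xz.
      have f0 := competitor_gt0 eps0 Cf ez z1.
      have fl : f z <= lambda.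
        by case: (Cf) => _ <- _ _; exact: competitor_mono eps0 Cf ez z1 (lexx _).
      rewrite /ratioU expr_div_n; apply: ler_pM.
      - by rewrite exprn_ge0// ltW.
      - by rewrite invr_ge0 ltW.
      - by rewrite lerXn2r ?nnegrE// ltW.
      - by rewrite lef_pV2 ?posrE ?exprn_gt0// lerXn2r ?nnegrE// ltW.
    have b1 := bnd _ _ Cr; have b2 := bnd _ _ (extremal_restrict ext eps0 (lt_trans eR R01)).
    have lip : `|D (ratioU r z) - D (ratioU rh z)| <= L * `|ratioU r z - ratioU rh z|.
      have [uu|uu] := leP (ratioU r z) (ratioU rh z).
        by apply: le_trans (HL _ _ uu b2) _; rewrite ler_pM2l// distrC ler_norm.
      rewrite distrC; apply: le_trans (HL _ _ (ltW uu) b1) _; rewrite ler_pM2l// ler_norm//.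
    have UU : ratioU r z - ratioU rh z = v z / z ^+ m.+1.
      by rewrite /ratioU !expr_div_n -mulrBl.
    have zm0 : 0 <= z ^+ m by rewrite exprn_ge0// ltW.
    apply: le_trans (ler_wpM2l zm0 lip) _.
    rewrite UU normrM [`|(_)^-1|]gtr0_norm ?invr_gt0//.
    have -> : z ^+ m * (L * (`|v z| / z ^+ m.+1)) = L / z * `|v z|.
      rewrite exprS; have : z ^+ m != 0 by rewrite expf_neq0// gt_eqF.
      move: (z ^+ m) `|v z| => Z V Z0; field; rewrite Z0 gt_eqF//.
    rewrite ler_wpM2r// ler_pM2l// lef_pV2//.
  rewrite v1 normr0 add0r lerD2l segZ; last by apply/segint_norm/segint_cont/vc => //; exact: ltW.
  by rewrite mulrA mulrA -/K.
have inner x : eps < x -> x <= 1 -> `|v x| <= delta.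
  move=> ex x1; have [Rx|xR] := leP R0 x; first by apply: le_trans (outer x Rx x1) _.
  (* Three contributions: [delta / 4] at radius [R0], the error [A], at most [delta / 8], and at
     most [delta / 4] from bounded slopes. *)
  have R1 := outer R0 (lexx _) (ltW R01).
  apply: le_trans (main x R0 (fun=> M) ex (ltW xR) (ltW R01) (segint_cst _ _ _) _) _.
    move=> z xz zR; have z0 : 0 < z := le_lt_trans eps0 (lt_le_trans ex xz).
    apply: (@le_trans _ _ `|D (ratioU r z) - D (ratioU rh z)|).
      rewrite ler_piMl// exprn_ile1//; first exact: ltW.
      exact: le_trans zR (ltW R01).
    have := HM (ratioU r z); have := HM (ratioU rh z).
    have := cal_D_gt0 cal (ratioU r z); have := cal_D_gt0 cal (ratioU rh z).
    by rewrite ler_norml; lra.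
  rewrite seg_cst ?(ltW xR)//.
  have : n * (M * (R0 - x)) <= n * M * R0.
    by rewrite -mulrA !ler_pM2l// gerBl (le_trans eps0)// ltW.
  lra.
(* The excess is controlled only to the right of [eps], so the end point itself is reached by
   continuity. *)
move=> x; rewrite le_eqVlt => /predU1P[<- _|]; last exact: inner.
have e1 : eps < 1 by lra.
have [_ cl _] := (continuous_within_itvP v e1).1 (vc _ (lexx _) (ltW e1)).
have cln : `|v z| @[z --> eps^'+] --> `|v eps| by exact: cvg_norm cl.
apply: (@cvgr_to_le _ _ _ _ _ _ _ cln).
have nz : \forall z \near eps^'+, eps < z < 1.
  by near=> z; apply/andP; split; near: z; [exact: nbhs_right_gt|exact: nbhs_right_lt].
by apply: filterS nz => z /andP[ez z1]; apply: inner => //; exact: ltW.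
Unshelve. all: by end_near. Qed.

End Stability.

(** * Extremals and minimizers *)

Section CavitatingExtremal.
Context {R : realType} (m : nat) (kappa : R) (h r : R -> R) (lambda_c : R).
Hypothesis n23 : m.+1 = 2%N \/ m.+1 = 3%N.
Hypothesis kappa_gt0 : 0 < kappa.
Hypothesis hh : volumetric_energy h.
Hypothesis rsol : cavitating_solution m.+1 kappa h r.
Hypothesis r_cvg : r x / x @[x --> +oo] --> lambda_c.
Implicit Types x u lambda : R.
Let m_gt0 : (0 < m)%N := dim_gt0 n23.
Let Uc := cavU m.+1 r.
Let wc := cavw r.
Let Lam := lambda_c ^+ m.+1.
Let Uc_gt0 x : 0 < x -> 0 < Uc x. Proof. exact: (cavU_gt0 rsol). Qed.
Let wc_gt0 x : 0 < x -> 0 < wc x. Proof. exact: (cavw_gt0 rsol). Qed.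
Let dUc x : 0 < x -> is_derive x (1 : R) Uc (m.+1%:R * Uc x * (wc x - 1) / x).
Proof. exact: (is_derive_cavU n23 rsol). Qed.
Let dTc x : 0 < x -> is_derive x (1 : R) (fun x => stress kappa h m (wc x * Uc x) (Uc x))
  (m.+1%:R * beta kappa m * wc x * (1 - wc x ^+ m) / x).
Proof. exact: (is_derive_cavT n23 hh rsol). Qed.

Let r0_gt0 : 0 < r 0. Proof. by have [[]] := rsol. Qed.

Let Uc0 : Uc x @[x --> 0^'+] --> +oo.
Proof.
apply/cvgryPge => A; near=> x.
have x0 : 0 < x by near: x; exact: nbhs_right_gt.
have x1 : x <= r 0 / (`|A| + 1).
  by apply/ltW; near: x; apply: nbhs_right_lt; rewrite divr_gt0// ltr_wpDl.
have q1 : `|A| + 1 <= r x / x.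
  rewrite ler_pdivlMr// mulrC -ler_pdivlMr ?ltr_wpDl//; apply: (le_trans x1).
  by rewrite ler_pM2r ?invr_gt0 ?ltr_wpDl//; exact: (cav_ge rsol).
have A0 := normr_ge0 A; have AA := ler_norm A.
apply: (@le_trans _ _ (r x / x)); first by lra.
by rewrite /Uc /cavU exprS ler_peMr ?exprn_ege1//; lra.
Unshelve. all: by end_near. Qed.

Let Tc0 : stress kappa h m (wc x * Uc x) (Uc x) @[x --> 0^'+] --> (0 : R).
Proof.
have [_ _ _] := rsol; apply: cvg_trans; apply: near_eq_cvg; near=> x.
have x0 : 0 < x by near: x; exact: nbhs_right_gt.
rewrite /That (cav_Phihat1 n23 hh rsol x0) /= mulKf// expf_neq0// gt_eqF// divr_gt0//.
exact: (cav_gt0 rsol).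
Unshelve. all: by end_near. Qed.

Let Ucy : Uc x @[x --> +oo] --> Lam.
Proof. by apply: (@cvg_comp _ _ _ (fun x => r x / x) (fun u => u ^+ m.+1) _ _ _ r_cvg); exact: exprn_continuous. Qed.

Let Lam0 : 0 < Lam := Lam_gt0 kappa_gt0 hh m_gt0 Uc_gt0 wc_gt0 dUc dTc Uc0 Tc0 Ucy.

Lemma critical_displacement_gt0 : 0 < lambda_c.
Proof.
have l0 : 0 <= lambda_c.
  apply: (@cvgr_to_ge _ _ _ _ _ _ _ r_cvg); near=> x; apply/ltW.
  have x0 : 0 < x by near: x; apply: nbhs_pinfty_gt; exact: num_real.
  by rewrite divr_gt0//; exact: (cav_gt0 rsol).
rewrite lt_neqAle l0 andbT eq_sym; apply/eqP => lE; move: Lam0.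
by rewrite /Lam lE expr0n ltxx.
Unshelve. all: by end_near. Qed.

Definition cavW U0 := glueW kappa h m Lam U0 (fK kappa h m Uc wc).
Definition cavS U0 := glueT kappa h m Lam U0 (fT kappa h m Uc wc).
Definition cavD U0 := glueD Lam U0 (fD Uc wc).

Lemma cav_calibration U0 : 0 < U0 -> U0 <= Lam ->
  calibration kappa h m (cavW U0) (cavS U0) (cavD U0).
Proof.
exact: (Uc_calibration kappa_gt0 hh m_gt0 Uc_gt0 wc_gt0 dUc dTc Uc0 Tc0 Ucy).
Qed.

(** Along the map [U] is constant, and the tangent line is attached at exactly this constant, a
    fixed point of [D] where the calibration is exact. *)
Lemma homogeneous_extremal lambda : 0 < lambda -> lambda <= lambda_c ->
  let U0 := lambda ^+ m.+1 in
  extremal kappa h m (cavW U0) (cavS U0) (cavD U0) lambda (fun x => lambda * x) (fun=> lambda).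
Proof.
move=> l0 lc U0.
have U00 : 0 < U0 by rewrite exprn_gt0.
have U0L : U0 <= Lam by rewrite lerXn2r ?nnegrE ?(ltW l0)// ltW// critical_displacement_gt0.
have UE x : 0 < x -> ratioU m (fun x => lambda * x) x = U0.
  by move=> x0; rewrite /ratioU mulfK// gt_eqF.
have DE : cavD U0 U0 = U0 by rewrite /cavD /glueD U0L maxxx.
split.
- split => //; last 2 first.
  + by rewrite mulr1.
  + by rewrite mulr0.
  apply: ac_C1.
  + by move=> x _; apply: is_derive_eq; rewrite /GRing.scale/=; ring.
  + by apply: continuous_subspaceT => x; apply: cvgM; [exact: cvg_cst|exact: cvg_id].
  + by apply: continuous_subspaceT => x; exact: cvg_cst.
- by move=> x x0 _; rewrite UE// DE /detD mulfK ?gt_eqF// -exprS.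
- move=> x x0 _; rewrite UE//.
  by apply: glue_eq => //; left.
Qed.

(* Equilibrium solutions are mapped to one another by the rescalings [r (al x) / al]. *)
Lemma cavitating_extremal lambda : lambda_c < lambda -> exists rh drh,
  extremal kappa h m (cavW Lam) (cavS Lam) (cavD Lam) lambda rh drh /\ 0 < rh 0.
Proof.
move=> lc; have lc0 := critical_displacement_gt0.
have l0 : 0 < lambda by exact: lt_trans lc.
have LU : Lam < lambda ^+ m.+1 by rewrite ltrXn2r ?nnegrE ?ltW.
(* The scale at which the cavitating solution has ratio [lambda]; rescaling by it puts the boundary
   condition at 1. *)
have [al [al0 alU]] := Uc_surj dUc Uc0 Ucy LU.
have r_al : r al = lambda * al.
  have q0 : 0 < r al / al by rewrite divr_gt0//; exact: (cav_gt0 rsol).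
  have := alU; rewrite /Uc /cavU => /eqP.
  rewrite eqrXn2 ?(ltW q0) ?(ltW l0)// => /eqP <-; by rewrite divfK// gt_eqF.
pose rh x := r (al * x) / al.
(* The value 0 is the right limit at the centre, proved through [drh_le], and makes the derivative
   continuous on the closed interval. *)
pose drh x := if 0 < x then derive1 r (al * x) else 0.
have qE x : 0 < x -> rh x / x = r (al * x) / (al * x).
  by move=> x0; rewrite /rh; field; rewrite !gt_eqF.
have UE x : 0 < x -> ratioU m rh x = Uc (al * x).
  by move=> x0; rewrite /ratioU qE.
have DE x : 0 < x -> detD m rh drh x = fD Uc wc (Uc (al * x)).
  move=> x0; have y0 : 0 < al * x by rewrite mulr_gt0.
  rewrite /detD /drh x0 /fD /fw (XcK kappa_gt0 hh m_gt0 Uc_gt0 wc_gt0 dUc dTc Uc0 Tc0 Ucy)//.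
  rewrite qE//; exact: (cav_detE n23 rsol y0).
have UL x : 0 < x -> Lam < Uc (al * x).
  by move=> x0; apply: (Uc_gtLam kappa_gt0 hh m_gt0 Uc_gt0 wc_gt0 dUc dTc Uc0 Tc0 Ucy); rewrite mulr_gt0.
have GE x : 0 < x -> cavD Lam (Uc (al * x)) = fD Uc wc (Uc (al * x)).
  by move=> x0; rewrite /cavD /glueD leNgt UL.
have rh_gt0 x : 0 < x -> 0 < rh x.
  by move=> x0; rewrite divr_gt0//; apply: (cav_gt0 rsol); rewrite mulr_gt0.
have drh_rh x : 0 < x -> is_derive x (1 : R) rh (drh x).
  move=> x0; have y0 : 0 < al * x by rewrite mulr_gt0.
  have d1 : is_derive x (1 : R) (fun x => al * x) al.
    by apply: is_derive_eq; rewrite /GRing.scale/=; ring.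
  have d2 : is_derive x (1 : R) (fun x => r (al * x)) _ :=
    @is_derive1_comp _ r (fun x => al * x) x _ _ (cav_derive rsol y0) d1.
  rewrite /rh /drh x0; apply: is_derive_eq; rewrite /GRing.scale/=.
  by move: (derive1 r _) => p; field; rewrite gt_eqF.
have drhE x : 0 < x -> drh x = fD Uc wc (ratioU m rh x) / (rh x / x) ^+ m.
  move=> x0; rewrite UE// -DE// /detD mulfK// expf_neq0// gt_eqF// divr_gt0//.
  exact: rh_gt0.
have rh0 : 0 < rh 0 by rewrite /rh mulr0 divr_gt0.
have rh_ge x : 0 < x -> rh 0 <= rh x.
  by move=> x0; rewrite /rh mulr0 ler_pM2r ?invr_gt0//; apply: (cav_ge rsol); rewrite mulr_gt0.
have c_rh x : 0 < x -> {for x, continuous rh} by move=> x0; exact: is_derive_cont (drh_rh x x0).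
have c_q x : 0 < x -> {for x, continuous (fun x => rh x / x)}.
  move=> x0; apply: cvgM; first exact: c_rh.
  by apply: inv_continuous; rewrite gt_eqF.
(* Continuity of the derivative is not part of being a solution; it is read off from the continuous
   slope [fD] by [drhE]. *)
have c_drh x : 0 < x -> {for x, continuous drh}.
  move=> x0; have q0 : 0 < rh x / x by rewrite divr_gt0 ?rh_gt0.
  have : (fD Uc wc (ratioU m rh z) / (rh z / z) ^+ m) @[z --> x] --> drh x.
    rewrite drhE//; apply: cvgM; last first.
      apply: cvgV; first by rewrite expf_neq0// gt_eqF.
      by apply: (@cvg_comp _ _ _ (fun x => rh x / x) (fun u => u ^+ m) _ _ _ (c_q x x0)); exact: exprn_continuous.
    apply: (@cvg_comp _ _ _ (ratioU m rh) (fD Uc wc) _ (nbhs (ratioU m rh x))).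
      by apply: (@cvg_comp _ _ _ (fun x => rh x / x) (fun u => u ^+ m.+1) _ _ _ (c_q x x0)); exact: exprn_continuous.
    by apply: (fD_continuous kappa_gt0 hh m_gt0 Uc_gt0 wc_gt0 dUc dTc Uc0 Tc0 Ucy); rewrite UE// UL.
  apply: cvg_trans; apply: near_eq_cvg; near=> z.
  have z0 : 0 < z by near: z; exact: lt_nbhsr.
  by rewrite drhE.
have [M HM] := fD_bounded kappa_gt0 hh m_gt0 Uc_gt0 wc_gt0 dUc dTc Uc0 Tc0 Ucy.
have drh_gt0 x : 0 < x -> 0 < drh x.
  by move=> x0; rewrite /drh x0; apply: (cav_derive_gt0 rsol); rewrite mulr_gt0.
have M0 : 0 < M.
  have := fD_gt0 kappa_gt0 hh m_gt0 Uc_gt0 wc_gt0 dUc dTc Uc0 Tc0 Ucy (UL 1 ltr01).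
  have := HM _ (UL 1 ltr01); lra.
(* The determinant is bounded by [M] while the circumferential stretch is at least [rh 0 / x >= 1],
   so already one power of it yields linear decay at the cavity. *)
have drh_le x : 0 < x -> x <= rh 0 -> drh x <= M / rh 0 * x.
  move=> x0 xr; rewrite drhE// UE//.
  have q1 : rh 0 / x <= rh x / x by rewrite ler_pM2r ?invr_gt0// rh_ge.
  have q0 : 1 <= rh 0 / x by rewrite ler_pdivlMr// mul1r.
  have q2 : rh 0 / x <= (rh x / x) ^+ m.
    apply: (le_trans q1); rewrite -[X in X <= _]expr1; apply: ler_weXn2l => //; lra.
  rewrite ler_pdivrMr; last by lra.
  apply: (@le_trans _ _ (M / rh 0 * x * (rh 0 / x))).
    rewrite (_ : _ * _ * _ = M); first exact/HM/UL.
    by field; rewrite !gt_eqF.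
  by rewrite ler_pM2l// mulr_gt0// divr_gt0.
exists rh, drh; split => //; split.
- split => //.
  + have cont0 (f : R -> R) : f x @[x --> 0^'+] --> f 0 -> (forall x, 0 < x -> {for x, continuous f}) ->
        {within `[0, 1], continuous f}.
      move=> f0 fc; apply/(continuous_within_itvP f ltr01); split => //.
        by move=> x; rewrite in_itv/= => /andP[x0 _]; exact: fc.
      by apply: cvg_at_left_filter; exact: fc.
    apply: ac_C1.
    * by move=> x /andP[x0 _]; exact: drh_rh.
    * apply: cont0 => //; rewrite /rh mulr0; apply: cvgM; last exact: cvg_cst.
      have [[_ rc0] _ _ _] := rsol.
      apply/cvgrPdist_le => e e0; move/cvgrPdist_le : rc0 => /(_ e e0)[d /= d0 Hd].
      near=> x; have x0 : 0 < x by near: x; exact: nbhs_right_gt.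
      have xd : x < d / al by near: x; apply: nbhs_right_lt; rewrite divr_gt0.
      apply: Hd => /=; last by rewrite mulr_gt0.
      by rewrite sub0r normrN gtr0_norm ?mulr_gt0// mulrC -ltr_pdivlMr.
    * apply: cont0 => //; rewrite {2}/drh ltxx; apply/cvgrPdist_le => e e0.
      near=> x; have x0 : 0 < x by near: x; exact: nbhs_right_gt.
      have xr : x <= rh 0 by apply/ltW; near: x; exact: nbhs_right_lt.
      have xe : x <= e / (M / rh 0) by apply/ltW; near: x; apply: nbhs_right_lt; rewrite divr_gt0// divr_gt0.
      rewrite sub0r normrN gtr0_norm ?drh_gt0//; apply: (le_trans (drh_le x x0 xr)).
      by rewrite mulrC -ler_pdivlMr// divr_gt0.
  + by rewrite /rh mulr1 r_al mulfK// gt_eqF.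
  + exact: ltW.
- by move=> x x0 _; rewrite DE// UE// GE.
- move=> x x0 _; rewrite UE//; apply: (glue_eq Lam0) => //; last by right; exact: UL.
  exact: Uc_gt0 (mulr_gt0 al0 x0).
Unshelve. all: by end_near. Qed.

End CavitatingExtremal.

(** * From energy comparison to uniform convergence *)

Section Minimizers.
Context {R : realType} (kappa : R) (h : R -> R) (m : nat) (W T D : R -> R) (lambda : R).
Hypothesis n23 : m.+1 = 2%N \/ m.+1 = 3%N.
Hypothesis kappa_gt0 : 0 < kappa.
Hypothesis hh : volumetric_energy h.
Hypothesis cal : calibration kappa h m W T D.
Hypothesis lambda_gt0 : 0 < lambda.
Notation mu := (@lebesgue_measure R).
Notation density := (density kappa h m).
Notation value := (value m W lambda).
Notation Ihat := (Ihat m.+1 kappa h lambda).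
Implicit Types (a b x y z eps : R) (f g r s G : R -> R).
Variables (rh drh : R -> R).
Hypothesis ext : extremal kappa h m W T D lambda rh drh.
Let m_gt0 : (0 < m)%N := dim_gt0 n23.
Let energy eps r G := (\int[mu]_(x in `]eps, 1%R[) (density r G x)%:E)%E.

Lemma Ihat_density eps r G (N : set R) : 0 <= eps -> eps < 1 -> competitor lambda eps r G ->
  measurable N -> mu N = 0%E ->
  (forall x, eps < x < 1 -> ~ N x -> weakD eps 1 r x = G x) ->
  Ihat eps r = (energy eps r G -
    (kappa * (m.+1%:R - 1) / m.+1%:R * lambda ^+ m.+1 * ln lambda)%:E)%E.
Proof.
move=> e0 e1 C mN N0 HN; rewrite /Defs.Ihat; congr (_ - _)%E.
apply: (@integral_eq_off_null _ _ _ mu _ N) => //.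
  by apply/measurable_EFinP; exact: density_measurable e0 e1 C.
move=> x /=; rewrite in_itv/= => /andP[ex x1] Nx; have x0 : 0 < x by lra.
rewrite HN//; last by rewrite ex.
congr EFin.
have -> : density r G x = x ^+ m * Psi kappa h m (detD m r G x) (ratioU m r x) by [].
congr (_ * _).
have rx := competitor_gt0 e0 C ex (ltW x1).
by apply: Phihat_radial => //; [case: C => _ _ _; exact|rewrite divr_gt0].
Qed.

Lemma extremal_admissible eps : 0 <= eps -> eps < 1 -> admissible lambda eps rh /\
  exists N : set R, [/\ measurable N, mu N = 0%E &
    forall x, eps < x < 1 -> ~ N x -> weakD eps 1 rh x = drh x].
Proof.
move=> e0 e1; have [Hac r1 re G0] := extremal_restrict ext e0 e1.
have w11 := ac_W11 e1 Hac.
have ae := ac_ae_eq (W11_ac e1 w11) Hac.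
split; last first.
  have [N [mN N0 HN]] := ae_null_set ae.
  by exists N; split => // x xe /HN; exact.
split => //; move: ae; apply: filterS; first exact: (ae_filter_ringOfSetsType mu).
by move=> x /= xe; rewrite in_itv/= => ex; rewrite xe//; apply: G0; lra.
Qed.

Lemma minimizer_energy eps r : 0 <= eps -> eps < 1 ->
  global_minimizer m.+1 kappa h lambda eps r ->
  exists G, competitor lambda eps r G /\ (energy eps r G <= energy eps rh drh)%E.
Proof.
move=> e0 e1 [radm rmin]; have [G [C [N [mN N0 HN]]]] := admissible_competitor e1 radm.
have [hadm [N' [mN' N'0 HN']]] := extremal_admissible e0 e1.
exists G; split => //; have := rmin _ hadm.
rewrite (Ihat_density e0 e1 C mN N0 HN).
rewrite (Ihat_density e0 e1 (extremal_restrict ext e0 e1) mN' N'0 HN').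
by rewrite leeD2rE.
Qed.

Lemma energy_segint eps r G M : 0 <= eps -> eps < 1 -> competitor lambda eps r G ->
  (energy eps r G <= M%:E)%E ->
  segint eps 1 (density r G) /\ seg eps 1 (density r G) <= M.
Proof.
move=> e0 e1 C EM; have b0 := ltW (beta_gt0 kappa_gt0 m_gt0).
have i : segint eps 1 (density r G).
  apply: (integrable_of_bound (density_measurable kappa m hh e0 e1 C) _ b0 EM).
  by move=> x /andP[ex x1]; exact: density_ge e0 C ex (ltW x1).
split => //; rewrite -seg_oo// -lee_fin fineK//.
by apply: integrable_fin_num => //; exact/segint_oo.
Qed.

(** The extremal restricted to [eps] is a competitor with energy close to [value]; minimality
    transfers this bound to [r], whose excess is then small. Allowing [eps = 0] lets the same
    estimate identify minimizers of the limit problem. *)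
Lemma minimizer_close d : 0 < d -> exists2 a0, 0 < a0 & forall eps r,
  0 <= eps -> eps < a0 -> eps < 1 -> global_minimizer m.+1 kappa h lambda eps r ->
  forall x, eps <= x -> x <= 1 -> `|r x - rh x| <= d.
Proof.
move=> d0; have dn0 : 0 < d ^+ m.+1 by rewrite exprn_gt0.
(* Stability controls n-th powers, so it is invoked at [d ^+ m.+1] and the root is taken by
   [exprn_distr_le]. *)
have [eta eta0 [a1 a10 H1]] := stability hh cal lambda_gt0 ext dn0.
have eta20 : 0 < eta / 2 by rewrite divr_gt0.
have [a2 a20 H2] := excess_integral_le kappa_gt0 hh m_gt0 cal lambda_gt0 eta20.
have [a3 a30 H3] := extremal_energy_eps cal lambda_gt0 ext eta20.
exists (Num.min a1 (Num.min a2 a3)); first by rewrite !lt_min a10 a20.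
move=> eps r e0; rewrite !lt_min => /and3P[ea1 ea2 ea3] e1 rmin x ex x1.
have [G [C EG]] := minimizer_energy e0 e1 rmin.
have Eh : (energy eps rh drh <= (value + eta / 2)%:E)%E.
  move: e0; rewrite le_eqVlt => /predU1P[<-|e0]; last exact: H3.
  apply: le_trans (extremal_energy0 kappa_gt0 hh m_gt0 cal lambda_gt0 ext) _.
  by rewrite lee_fin; lra.
have [i iE] := energy_segint e0 e1 C (le_trans EG Eh).
have key : `|r x ^+ m.+1 - rh x ^+ m.+1| <= d ^+ m.+1.
  apply: (H1 eps r G) => // a ea a_1.
  have [j jE] := H2 eps r G a e0 ea2 C i ea a_1.
  by split => //; lra.
have Ch := extremal_restrict ext e0 e1.
have nneg f g : competitor lambda eps f g -> 0 <= f x.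
  move=> Cf; move: ex; rewrite le_eqVlt => /predU1P[<-|ex]; first by case: Cf.
  exact/ltW/(competitor_gt0 e0 Cf ex x1).
have := le_trans (exprn_distr_le m (nneg _ _ C) (nneg _ _ Ch)) key.
by rewrite ler_pXn2r ?nnegrE// ltW.
Qed.

(** An energy below [value] would be finite, and [excess_integral_le] with half the deficit would
    make the integral of the nonnegative excess over 1/2 to 1 negative. *)
Lemma extremal_minimizer : global_minimizer m.+1 kappa h lambda 0 rh.
Proof.
have [hadm [N' [mN' N'0 HN']]] := extremal_admissible (lexx 0) ltr01.
split => // s sadm; have [G [C [N [mN N0 HN]]]] := admissible_competitor ltr01 sadm.
rewrite (Ihat_density (lexx 0) ltr01 C mN N0 HN).
rewrite (Ihat_density (lexx 0) ltr01 (extremal_competitor ext) mN' N'0 HN').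
rewrite leeD2rE//; apply: le_trans (extremal_energy0 kappa_gt0 hh m_gt0 cal lambda_gt0 ext) _.
rewrite leNgt; apply/negP => lt.
have [i _] := energy_segint (lexx 0) ltr01 C (ltW lt).
have : seg 0 1 (density s G) < value.
  rewrite -seg_oo// -lte_fin fineK//; apply: integrable_fin_num => //; exact/segint_oo.
rewrite -subr_gt0 => gap0.
have gap20 : 0 < (value - seg 0 1 (density s G)) / 2 by rewrite divr_gt0.
have [a0 a00 H] := excess_integral_le kappa_gt0 hh m_gt0 cal lambda_gt0 gap20.
have [_] := H 0 s G (2^-1) (lexx _) a00 C i ltac:(lra) ltac:(lra).
have : 0 <= seg 2^-1 1 (excess kappa h m W T s G).
  by apply: seg_ge0 => x x2 x1; apply: (excess_ge0 hh cal (lexx 0) C); lra.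
lra.
Qed.

(** At [eps = 0] the stability estimate applies for every tolerance [d], and so forces equality. *)
Lemma minimizer_unique s x : global_minimizer m.+1 kappa h lambda 0 s ->
  0 <= x -> x <= 1 -> s x = rh x.
Proof.
move=> smin x0 x1; apply/eqP; rewrite -subr_eq0 -normr_eq0 eq_le normr_ge0 andbT.
apply/ler_addgt0Pr => d d0; rewrite add0r.
by have [a0 a00 H] := minimizer_close d0; exact: (H 0 s (lexx _) a00 ltr01 smin).
Qed.

Lemma sup_dist_cvg (r : R -> R -> R) s :
  (forall eps, 0 < eps -> eps < 1 -> global_minimizer m.+1 kappa h lambda eps (r eps)) ->
  (forall x, 0 <= x -> x <= 1 -> s x = rh x) ->
  sup_dist eps (r eps) s @[eps --> 0^'+] --> 0%E.
Proof.
move=> rmin sE.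
have bnd d : 0 < d -> \forall eps \near 0^'+,
    (0 <= sup_dist eps (r eps) s)%E /\ (sup_dist eps (r eps) s <= d%:E)%E.
  move=> d0; have [a0 a00 H] := minimizer_close d0; near=> eps.
  have e0 : 0 < eps by near: eps; exact: nbhs_right_gt.
  have ea : eps < a0 by near: eps; exact: nbhs_right_lt.
  have e1 : eps < 1 by near: eps; exact: nbhs_right_lt.
  split.
    apply: (@le_trans _ _ (`|r eps 1 - s 1|)%:E); first by rewrite lee_fin.
    by apply: ereal_sup_ubound; exists 1 => //=; rewrite in_itv/= lexx ltW.
  apply: ge_ereal_sup => _ [x /= + <-]; rewrite in_itv/= => /andP[ex x1].
  rewrite lee_fin sE//; first exact: H (ltW e0) ea e1 (rmin _ e0 e1) _ ex x1.
  by rewrite (le_trans (ltW e0)).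
apply/fine_cvgP; split.
  have := bnd 1 ltr01; apply: filterS => eps [b0 b1].
  by rewrite ge0_fin_numE//; apply: le_lt_trans b1 (ltry _).
apply/cvgrPdist_le => d d0; have := bnd d d0; apply: filterS => eps [b0 b1].
rewrite sub0r normrN /= ger0_norm ?fine_ge0// -lee_fin fineK//.
by rewrite ge0_fin_numE//; apply: le_lt_trans b1 (ltry _).
Unshelve. all: by end_near. Qed.

End Minimizers.

Theorem proposition4p3 (R : realType) (n : nat) (kappa : R) (h : R -> R)
    (lambda lambda_c : R) (r : R -> R -> R)
    (n23 : n = 2%N \/ n = 3%N) (kappa_gt0 : 0 < kappa)
    (hh : volumetric_energy h)
    (stress_free : partial (Phihat (n := n) kappa h) 0 (const_mx 1) = 0)
    (lambda_gt0 : 0 < lambda)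
    (r_min : forall eps : R, 0 < eps -> eps < 1 ->
       unique_global_minimizer n kappa h lambda eps (r eps))
    (lambda_cP : critical_displacement n kappa h lambda_c) :
  (lambda <= lambda_c ->
     sup_dist eps (r eps) (fun x => lambda * x) @[eps --> 0^'+] --> 0%E) /\
  (lambda_c < lambda ->
     (exists r_lambda, cavitating_minimizer n kappa h lambda r_lambda) /\
     forall r_lambda, cavitating_minimizer n kappa h lambda r_lambda ->
       sup_dist eps (r eps) r_lambda @[eps --> 0^'+] --> 0%E).
Proof.
case: n n23 stress_free r_min lambda_cP => [[]//|m] n23 _ r_min [rc rc_sol rc_cvg].
have lc0 := critical_displacement_gt0 n23 kappa_gt0 hh rc_sol rc_cvg.
have rmin eps : 0 < eps -> eps < 1 -> global_minimizer m.+1 kappa h lambda eps (r eps).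
  by move=> e0 e1; have [] := r_min eps e0 e1.
split=> [l_le|l_gt].
  have ext := homogeneous_extremal n23 kappa_gt0 hh rc_sol rc_cvg lambda_gt0 l_le.
  have U00 : 0 < lambda ^+ m.+1 by rewrite exprn_gt0.
  have U0L : lambda ^+ m.+1 <= lambda_c ^+ m.+1 by rewrite lerXn2r ?nnegrE ?(ltW lambda_gt0) ?(ltW lc0).
  have cal := cav_calibration n23 kappa_gt0 hh rc_sol rc_cvg U00 U0L.
  exact: (sup_dist_cvg n23 kappa_gt0 hh cal lambda_gt0 ext).
have [rh [drh [ext rh0]]] := cavitating_extremal n23 kappa_gt0 hh rc_sol rc_cvg l_gt.
have L0 : 0 < lambda_c ^+ m.+1 by rewrite exprn_gt0.
have cal := cav_calibration n23 kappa_gt0 hh rc_sol rc_cvg L0 (lexx _).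
split=> [|s [smin _]].
  by exists rh; split => //; exact: (extremal_minimizer n23 kappa_gt0 hh cal lambda_gt0 ext).
(* The given cavitating minimizer coincides on the closed unit interval with the rescaled solution,
   to which convergence has been proved. *)
apply: (sup_dist_cvg n23 kappa_gt0 hh cal lambda_gt0 ext) => // x.
exact: (minimizer_unique n23 kappa_gt0 hh cal lambda_gt0 ext).
Qed.
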